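(* Let $n$ be a positive smooth function on $[0,1]$ and consider the manifold $\mathcal M=[0,1]\times\mathbf S^1$ with the metric described in the context. Assume the standing assumptions in the context and let $u_1\in(0,c_* )$ be the unique number with $\rho(u_1)u_1 n(1)=\rho(u_0)u_0 n(0)$. Assume $\partial_1\phi\ge0$ on $\partial\Omega$. Then problem (P$_\mathcal M$) with exit data $c_1\in(0,c_* )$ admits a transonic shock solution (in the sense defined in the context) if and only if $c_1=u_1$. Moreover the solution is unique modulo a translation of the shock along the $x^1$-direction: every transonic shock solution has shock $\{x^1=x^1_b\}$ for a constant $x^1_b\in(0,1)$ and coincides (up to an additive constant) with the solution $\phi_b=\phi_b(x^1)$ depending only on $x^1$ with shock at $x^1_b$; conversely every $x^1_b\in(0,1)$ yields such a solution.
   Context: Constants: $\gamma>1$, $c_0>0$, $c_*:=\sqrt{2c_0^2/(\gamma+1)}$, $u_0\in\big(c_*,\sqrt{2c_0^2/(\gamma-1)}\big)$. For a speed $q\in[0,\sqrt{2c_0^2/(\gamma-1)})$, $\rho(q)=\big(\frac1\gamma(c_0^2-\frac{\gamma-1}{2}q^2)\big)^{1/(\gamma-1)}$, $c^2=c_0^2-\frac{\gamma-1}2q^2$. Standing assumption: $\rho(u_0)u_0 n(0)<\rho(c_* )c_*\min_{[0,1]}n$. Setting: $\mathcal M=\Omega=\{(x^1,x^2):x^1\in[0,1],x^2\in\mathbf S^1\cong[0,2\pi]\}$ with metric $\mathrm dx^1\otimes\mathrm dx^1+n(x^1)^2\,\mathrm dx^2\otimes\mathrm dx^2$; entry $\Sigma_0=\{x^1=0\}$,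 exit $\Sigma_1=\{x^1=1\}$. For a potential $\phi$, $\nabla\phi=(\partial_1\phi,\frac1{n}\partial_2\phi)$ in an orthonormal frame, $|\nabla\phi|^2=(\partial_1\phi)^2+\frac{(\partial_2\phi)^2}{n(x^1)^2}$; potential flow equation $\mathrm{div}(\rho(|\nabla\phi|)\nabla\phi)=\frac1{n}\big(\partial_1(n\rho\,\partial_1\phi)+\partial_2(\frac{\rho}{n}\partial_2\phi)\big)=0$. Supersonic: $|\nabla\phi|>c_*$; subsonic: $|\nabla\phi|<c_*$. Problem (P$_\mathcal M$): the equation in $\Omega$, $\nabla\phi=(u_0,0)$ on $\Sigma_0$, $|\nabla\phi|=c_1$ on $\Sigma_1$. Transonic shock solution: $\phi\in C^{0,1}(\Omega)\cap C^2(\Omega^-\cup\Omega^+)$, where for a $C^1$ function $x^1_s(x^2)$ with values in $(0,1)$, $S=\{x^1=x^1_s(x^2)\}$, $\Omega^-=\{x^1<x^1_s(x^2)\}$, $\Omega^+=\{x^1>x^1_s(x^2)\}$, such that $\phi$ is supersonic in $\Omega^-$, subsonic in $\Omega^+$, solves the equation in $\Omega^-\cup\Omega^+$, satisfies the boundary conditions pointwise, and on $S$ satisfies $(\rho(|\nabla\phi_-|)\nabla\phi_--\rho(|\nabla\phi_+|)\nabla\phi_+)\cdot\mathbf n_s=0$ and $\frac12|\nabla\phi_-|^2+\frac{c_-^2}{\gamma-1}=\frac12|\nabla\phi_+|^2+\frac{c_+^2}{\gamma-1}$ ($\phi_\mp$ one-sided limits, $c_\mp$ corresponding sonic speeds,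 $\mathbf n_s$ unit normal of $S$ in $\mathcal M$). The solution $\phi_b(x^1)$ with shock at $x^1_b$: $u=\phi_b'$ solves $u'=\frac{n'(x^1)}{n(x^1)}\frac{c^2u}{u^2-c^2}$ on $(0,x^1_b)$ with $u(0)=u_0$ (supersonic), jumps at $x^1_b$ to the subsonic $u_+<c_*$ with $\rho(u_+)u_+=\rho(u_-)u_-$, and solves the same ODE subsonically on $(x^1_b,1]$; $\phi_b$ is continuous. *)

(* Defs.v *)
From Stdlib Require Import Reals Lra.
From Coquelicot Require Import Coquelicot.
Open Scope R_scope.

Definition qmax (gam c0 : R) : R := sqrt (2 * c0 ^ 2 / (gam - 1)).

Definition cstar (gam c0 : R) : R := sqrt (2 * c0 ^ 2 / (gam + 1)).

Definition csq (gam c0 q : R) : R := c0 ^ 2 - (gam - 1) / 2 * q ^ 2.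

Definition rho (gam c0 q : R) : R :=
  Rpower (/ gam * csq gam c0 q) (/ (gam - 1)).

(** * Geometry of M = [0,1] x S^1, metric dx1^2 + n(x1)^2 dx2^2.
    Functions on S^1 = [0,2pi]/~ are represented as 2pi-periodic
    functions on R; points of R*R are pairs (x1, x2). *)

Definition periodic2pi (f : R -> R) : Prop := forall s, f (s + 2 * PI) = f s.

Definition d1 (phi : R -> R -> R) (x1 x2 : R) : R := Derive (fun t => phi t x2) x1.
Definition d2 (phi : R -> R -> R) (x1 x2 : R) : R := Derive (fun t => phi x1 t) x2.

(* |grad phi| at a point of abscissa x1, given the coordinate partials
   (a, b) = (d1 phi, d2 phi): grad phi = (a, b/n) in an orthonormal frame *)
Definition speed (n : R -> R) (x1 a b : R) : R :=
  sqrt (a ^ 2 + b ^ 2 / (n x1) ^ 2).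

Definition uncurry (f : R -> R -> R) : R * R -> R := fun p => f (fst p) (snd p).

Definition C2_on (U : R * R -> Prop) (phi : R -> R -> R) : Prop :=
  forall x1 x2, U (x1, x2) ->
    ex_derive (fun t => phi t x2) x1 /\ ex_derive (fun t => phi x1 t) x2 /\
    ex_derive (fun t => d1 phi t x2) x1 /\ ex_derive (fun t => d1 phi x1 t) x2 /\
    ex_derive (fun t => d2 phi t x2) x1 /\ ex_derive (fun t => d2 phi x1 t) x2 /\
    continuous (uncurry phi) (x1, x2) /\
    continuous (uncurry (d1 phi)) (x1, x2) /\
    continuous (uncurry (d2 phi)) (x1, x2) /\
    continuous (uncurry (d1 (d1 phi))) (x1, x2) /\
    continuous (uncurry (d2 (d1 phi))) (x1, x2) /\
    continuous (uncurry (d1 (d2 phi))) (x1, x2) /\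
    continuous (uncurry (d2 (d2 phi))) (x1, x2).

(* the potential flow operator
   div(rho(|grad phi|) grad phi)
     = (1/n) ( d1 (n rho d1 phi) + d2 ((rho/n) d2 phi) ) *)
Definition potential_div (gam c0 : R) (n : R -> R) (phi : R -> R -> R)
    (x1 x2 : R) : R :=
  let q := fun t s => speed n t (d1 phi t s) (d2 phi t s) in
  / n x1 *
  (Derive (fun t => n t * rho gam c0 (q t x2) * d1 phi t x2) x1 +
   Derive (fun s => rho gam c0 (q x1 s) / n x1 * d2 phi x1 s) x2).

(** * Transonic shock solutions of (P_M) with exit datum c1.
    The shock is S = {x1 = xs(x2)}; Omega^- = {0 <= x1 < xs(x2)},
    Omega^+ = {xs(x2) < x1 <= 1}.  The one-sided values of grad phi on
    Sigma_0, Sigma_1 and on S are the limits (G^-_1, G^-_2) resp.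
    (G^+_1, G^+_2) of the coordinate partials (d1 phi, d2 phi) from the
    interior of Omega^- resp. Omega^+. *)

Definition int_minus (xs : R -> R) (p : R * R) : Prop :=
  0 < fst p /\ fst p < xs (snd p).
Definition int_plus (xs : R -> R) (p : R * R) : Prop :=
  xs (snd p) < fst p /\ fst p < 1.

Definition transonic_shock_solution (gam c0 u0 c1 : R) (n : R -> R)
    (phi : R -> R -> R) (xs : R -> R) : Prop :=
  periodic2pi xs /\
  (forall s, ex_derive xs s) /\ (forall s, continuous (Derive xs) s) /\
  (forall s, 0 < xs s < 1) /\
  (forall x1 x2, phi x1 (x2 + 2 * PI) = phi x1 x2) /\
  (exists L, forall a1 a2 b1 b2, 0 <= a1 <= 1 -> 0 <= b1 <= 1 ->
      Rabs (phi a1 a2 - phi b1 b2) <= L * (Rabs (a1 - b1) + Rabs (a2 - b2))) /\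
  C2_on (int_minus xs) phi /\ C2_on (int_plus xs) phi /\
  exists Gm1 Gm2 Gp1 Gp2 : R -> R -> R,
    (forall x1 x2, 0 <= x1 <= xs x2 ->
       filterlim (uncurry (d1 phi)) (within (int_minus xs) (locally (x1, x2)))
         (locally (Gm1 x1 x2)) /\
       filterlim (uncurry (d2 phi)) (within (int_minus xs) (locally (x1, x2)))
         (locally (Gm2 x1 x2))) /\
    (forall x1 x2, xs x2 <= x1 <= 1 ->
       filterlim (uncurry (d1 phi)) (within (int_plus xs) (locally (x1, x2)))
         (locally (Gp1 x1 x2)) /\
       filterlim (uncurry (d2 phi)) (within (int_plus xs) (locally (x1, x2)))
         (locally (Gp2 x1 x2))) /\
    (forall x1 x2, 0 <= x1 < xs x2 ->
       cstar gam c0 < speed n x1 (Gm1 x1 x2) (Gm2 x1 x2) < qmax gam c0) /\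
    (forall x1 x2, xs x2 < x1 <= 1 ->
       speed n x1 (Gp1 x1 x2) (Gp2 x1 x2) < cstar gam c0) /\
    (forall x1 x2, int_minus xs (x1, x2) \/ int_plus xs (x1, x2) ->
       potential_div gam c0 n phi x1 x2 = 0) /\
    (forall x2, Gm1 0 x2 = u0 /\ Gm2 0 x2 = 0) /\
    (forall x2, speed n 1 (Gp1 1 x2) (Gp2 1 x2) = c1) /\
    (forall x2,
       let x1 := xs x2 in
       let am := Gm1 x1 x2 in let bm := Gm2 x1 x2 / n x1 in
       let ap := Gp1 x1 x2 in let bp := Gp2 x1 x2 / n x1 in
       let qm := sqrt (am ^ 2 + bm ^ 2) in let qp := sqrt (ap ^ 2 + bp ^ 2) in
       (* unit normal of S in the orthonormal frame *)
       let nu1 := 1 / sqrt (1 + (Derive xs x2 / n x1) ^ 2) in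
       let nu2 := - (Derive xs x2 / n x1) / sqrt (1 + (Derive xs x2 / n x1) ^ 2) in
       (rho gam c0 qm * am - rho gam c0 qp * ap) * nu1
         + (rho gam c0 qm * bm - rho gam c0 qp * bp) * nu2 = 0 /\
       / 2 * qm ^ 2 + csq gam c0 qm / (gam - 1)
         = / 2 * qp ^ 2 + csq gam c0 qp / (gam - 1)).

Definition d1_nonneg_on_boundary (phi : R -> R -> R) : Prop :=
  forall x2,
    (forall D, filterlim (fun t => (phi t x2 - phi 0 x2) / t) (at_right 0) (locally D) ->
       0 <= D) /\
    (forall D, filterlim (fun t => (phi t x2 - phi 1 x2) / (t - 1)) (at_left 1) (locally D) ->
       0 <= D).

Definition ode_rhs (gam c0 : R) (n : R -> R) (x u : R) : R :=
  Derive n x / n x * (csq gam c0 u * u / (u ^ 2 - csq gam c0 u)).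

Definition is_phi_b (gam c0 u0 : R) (n : R -> R) (xb : R) (phib : R -> R) : Prop :=
  (forall x, 0 <= x <= 1 ->
     filterlim phib (within (fun y => 0 <= y <= 1) (locally x)) (locally (phib x))) /\
  exists u : R -> R,
    (forall x, 0 < x < 1 -> x <> xb -> is_derive phib x (u x)) /\
    filterlim u (at_right 0) (locally u0) /\
    (forall x, 0 < x < xb ->
       cstar gam c0 < u x < qmax gam c0 /\ is_derive u x (ode_rhs gam c0 n x (u x))) /\
    (forall x, xb < x < 1 ->
       0 < u x < cstar gam c0 /\ is_derive u x (ode_rhs gam c0 n x (u x))) /\
    (exists u1', filterlim u (at_left 1) (locally u1') /\ 0 < u1' < cstar gam c0) /\
    exists um up,
      filterlim u (at_left xb) (locally um) /\ filterlim u (at_right xb) (locally up) /\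
      0 < up < cstar gam c0 /\ rho gam c0 up * up = rho gam c0 um * um.

(* Main.v *)
(** Upstream of the shock, consider [n] times the momentum flux of [grad phi] relative
    to the axial supersonic flow.  Its divergence is quadratic in the difference of the
    velocities, while its [x1]-component is positive definite near the axial flow.
    The jump conditions make the normal velocity ahead of the shock supersonic, so that
    the flux through the shock has a sign too, and a continuation in [x1] shows that the
    upstream flow is axial.
    Downstream, let [psi] be the difference of [phi] and an axial subsonic potential
    with the same mass flux.  The two mass fluxes agree across the shock, so testing
    the difference of the equations with [h psi], [h] nondecreasing, leaves only an
    exit term.  If [c1 <= u1] this term has a sign for [h > 0]; if [c1 > u1] it has a
    sign for [h] supported near the minimum of [psi] on the exit, where the velocity is
    axial.  Monotonicity of the flux in the subsonic range then forces [grad psi = 0],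
    and continuity of [phi] makes the shock straight. *)

(* Nothing says that the given solution is close to the axial flow, so the upstream estimate, valid
   for small differences only, can be applied just beyond the part already known to be axial. The
   weight [cutoff] vanishes with its derivative at the far end, so no data are needed there. The
   upstream divergence is computed exactly from mass conservation, irrotationality and
   [u' = (n'/n) kappa u]; this last equation cancels the first-order part of the source. The
   gradient has limits on the boundary but no derivatives there. Every integration by parts
   therefore goes through [flux_rigidity], which sweeps the region by curves and differentiates in
   the interior only. Continuity of [phi] across the shock yields the tangential jump condition.
   With conservation of mass it gives [k^2 < M^2 - 1] for the slope [k] of the shock and the Mach
   number [M] ahead of it, exactly the condition under which the upstream flux through the shock is
   a positive definite quadratic form. *)
From Stdlib Require Import Reals Lra Psatz Classical ClassicalEpsilon Ranalysis5.
From Coquelicot Require Import Coquelicot.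
Require Import Defs.
Open Scope R_scope.

(** * Limits and partial derivatives *)

Section Filter_limits.

Context {T : Type} {F : (T -> Prop) -> Prop} {FF : Filter F}.

Lemma flim_plus (f g : T -> R) (a b : R) :
  filterlim f F (locally a) -> filterlim g F (locally b) ->
  filterlim (fun x => f x + g x) F (locally (a + b)).
Proof.
intros Hf Hg.
eapply filterlim_comp_2; [exact Hf | exact Hg |].
exact (filterlim_plus (V := R_NormedModule) a b).
Qed.

Lemma flim_opp (f : T -> R) (a : R) :
  filterlim f F (locally a) -> filterlim (fun x => - f x) F (locally (- a)).
Proof.
intros Hf. eapply filterlim_comp; [exact Hf |].
exact (filterlim_opp (V := R_NormedModule) a).
Qed.

Lemma flim_minus (f g : T -> R) (a b : R) :
  filterlim f F (locally a) -> filterlim g F (locally b) ->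
  filterlim (fun x => f x - g x) F (locally (a - b)).
Proof. intros Hf Hg. apply flim_plus; [exact Hf | now apply flim_opp]. Qed.

Lemma flim_mult (f g : T -> R) (a b : R) :
  filterlim f F (locally a) -> filterlim g F (locally b) ->
  filterlim (fun x => f x * g x) F (locally (a * b)).
Proof.
intros Hf Hg.
eapply filterlim_comp_2; [exact Hf | exact Hg |].
exact (filterlim_mult (K := R_AbsRing) a b).
Qed.

Lemma flim_comp (h : R -> R) (f : T -> R) (a : R) :
  continuous h a -> filterlim f F (locally a) ->
  filterlim (fun x => h (f x)) F (locally (h a)).
Proof. intros Hh Hf. eapply filterlim_comp; [exact Hf | exact Hh]. Qed.

Lemma flim_inv (f : T -> R) (a : R) :
  a <> 0 -> filterlim f F (locally a) ->
  filterlim (fun x => / f x) F (locally (/ a)).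
Proof.
intros Ha. apply flim_comp.
apply (ex_derive_continuous (V := R_NormedModule)). now auto_derive.
Qed.

Lemma flim_eps (f : T -> R) (a : R) :
  filterlim f F (locally a) <->
  forall eps : R, 0 < eps -> F (fun x => Rabs (f x - a) < eps).
Proof.
split.
- intros H eps He. apply (proj1 (filterlim_locally f a) H (mkposreal eps He)).
- intros H. apply filterlim_locally. intros eps. exact (H eps (cond_pos eps)).
Qed.

End Filter_limits.

Lemma flim_within {T U : Type} {F : (T -> Prop) -> Prop} {FF : Filter F}
    (D : T -> Prop) (f : T -> U) (G : (U -> Prop) -> Prop) :
  filterlim f F G -> filterlim f (within D F) G.
Proof.
intros Hf P HP. unfold filtermap, within.
apply filter_imp with (fun x => P (f x)); [now intros | exact (Hf P HP)].
Qed.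

Lemma flim_le {T} {F : (T -> Prop) -> Prop} {FF : ProperFilter F}
    (f g : T -> R) (a b : R) :
  F (fun x => f x <= g x) ->
  filterlim f F (locally a) -> filterlim g F (locally b) -> a <= b.
Proof.
intros H Hf Hg.
exact (filterlim_le (F := F) f g (Finite a) (Finite b) H Hf Hg).
Qed.

Lemma flim_eq {T} {F : (T -> Prop) -> Prop} {FF : ProperFilter F}
    (f : T -> R) (a b : R) :
  filterlim f F (locally a) -> filterlim f F (locally b) -> a = b.
Proof. exact (filterlim_locally_unique (V := R_NormedModule) f a b). Qed.

Lemma continuous_of_is_derive (f : R -> R) (x l : R) :
  is_derive f x l -> continuous f x.
Proof. intros H. apply (ex_derive_continuous (V := R_NormedModule)). now exists l. Qed.

Lemma continuous_sq (x : R) : continuous (fun y => y ^ 2) x.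
Proof. apply (ex_derive_continuous (V := R_NormedModule)). auto_derive. exact I. Qed.

Lemma continuous_fst2 (x s : R) :
  filterlim (fun p : R * R => fst p) (locally (x, s)) (locally x).
Proof. exact (continuous_fst x s). Qed.

Lemma continuous_snd2 (x s : R) :
  filterlim (fun p : R * R => snd p) (locally (x, s)) (locally s).
Proof. exact (continuous_snd x s). Qed.

Lemma locally_box (P : R * R -> Prop) (x s : R) :
  locally (x, s) P <->
  exists d, 0 < d /\ forall x' s', Rabs (x' - x) < d -> Rabs (s' - s) < d -> P (x', s').
Proof.
split.
- intros [d Hd]. exists d. split; [apply cond_pos |].
  intros x' s' Hx Hs. apply Hd. now split.
- intros [d [Hd H]]. exists (mkposreal d Hd). intros [x' s'] [Hx Hs]. now apply H.
Qed.

(** The partials are explicit arguments rather than [Derive] terms: the rules below then compute the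
    partials of a compound expression, and a divergence identity becomes a [field] goal. *)
Definition isC1 (U : R -> R -> Prop) (f fx fy : R -> R -> R) : Prop :=
  forall x s, U x s ->
    is_derive (fun t => f t s) x (fx x s) /\
    is_derive (fun t => f x t) s (fy x s) /\
    continuous (uncurry f) (x, s) /\
    continuous (uncurry fx) (x, s) /\
    continuous (uncurry fy) (x, s).

Definition open2 (U : R -> R -> Prop) : Prop :=
  forall x s, U x s -> locally (x, s) (fun p => U (fst p) (snd p)).

Ltac split5 := split; [| split; [| split; [| split]]].

Lemma is_derive_periodic (f : R -> R) (d s l : R) :
  (forall t, f (t + d) = f t) -> is_derive f (s + d) l -> is_derive f s l.
Proof.
intros Hp D. apply (is_derive_ext (fun t => f (t + d))); [exact Hp |].
evar_last.
- apply (is_derive_comp f (fun t => t + d)); [exact D |].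
  auto_derive; [exact I | reflexivity].
- unfold scal; simpl; unfold mult; simpl. ring.
Qed.

Lemma ex_RInt_cont (f : R -> R) (u v : R) : (forall s, continuous f s) -> ex_RInt f u v.
Proof. intros Kf. apply (ex_RInt_continuous (V := R_CompleteNormedModule)). now intros. Qed.

Lemma is_derive_RInt0 (f : R -> R) (x : R) : (forall s, continuous f s) ->
  is_derive (fun x => RInt f 0 x) x (f x).
Proof.
intros Kf. apply (is_derive_RInt f (fun x => RInt f 0 x) 0); [| apply Kf].
apply filter_forall. intros y. apply (RInt_correct (V := R_CompleteNormedModule)).
now apply ex_RInt_cont.
Qed.

(** * Calculus of functions with explicit partial derivatives *)

Section C1_calculus.

Variable U : R -> R -> Prop.

Lemma C1_ext (f g fx gx fy gy : R -> R -> R) :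
  open2 U ->
  (forall x s, U x s -> f x s = g x s) ->
  (forall x s, U x s -> fx x s = gx x s) ->
  (forall x s, U x s -> fy x s = gy x s) ->
  isC1 U f fx fy -> isC1 U g gx gy.
Proof.
intros HU Hf Hfx Hfy H x s Hxs.
destruct (H x s Hxs) as (D1 & D2 & K & K1 & K2).
pose proof (HU x s Hxs) as L.
assert (Lx : locally x (fun t => f t s = g t s)).
{ apply locally_box in L. destruct L as [d [Hd L]].
  exists (mkposreal d Hd). intros t Ht. apply Hf, (L t s); [exact Ht |].
  now rewrite Rminus_diag, Rabs_R0. }
assert (Ls : locally s (fun t => f x t = g x t)).
{ apply locally_box in L. destruct L as [d [Hd L]].
  exists (mkposreal d Hd). intros t Ht. apply Hf, (L x t); [| exact Ht].
  now rewrite Rminus_diag, Rabs_R0. }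
split5.
- rewrite <- Hfx by exact Hxs. exact (is_derive_ext_loc _ _ _ _ Lx D1).
- rewrite <- Hfy by exact Hxs. exact (is_derive_ext_loc _ _ _ _ Ls D2).
- refine (continuous_ext_loc _ _ _ _ K).
  revert L; apply filter_imp; intros [x' s'] ?; now apply Hf.
- refine (continuous_ext_loc _ _ _ _ K1).
  revert L; apply filter_imp; intros [x' s'] ?; now apply Hfx.
- refine (continuous_ext_loc _ _ _ _ K2).
  revert L; apply filter_imp; intros [x' s'] ?; now apply Hfy.
Qed.

Lemma C1_const (c : R) : isC1 U (fun _ _ => c) (fun _ _ => 0) (fun _ _ => 0).
Proof.
intros x s _; split5; try (exact (is_derive_const c _)); exact (continuous_const _ _).
Qed.

Lemma C1_fst (h h' : R -> R) :
  (forall x s, U x s -> is_derive h x (h' x) /\ continuous h' x) ->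
  isC1 U (fun x _ => h x) (fun x _ => h' x) (fun _ _ => 0).
Proof.
intros H x s Hxs; destruct (H x s Hxs) as [D K]; split5.
- exact D.
- exact (is_derive_const (h x) s).
- apply (flim_comp h (fun p : R * R => fst p)); [| apply continuous_fst2].
  now apply continuous_of_is_derive with (h' x).
- now apply (flim_comp h' (fun p : R * R => fst p)); [| apply continuous_fst2].
- exact (continuous_const _ _).
Qed.

Lemma C1_plus (f fx fy g gx gy : R -> R -> R) :
  isC1 U f fx fy -> isC1 U g gx gy ->
  isC1 U (fun x s => f x s + g x s) (fun x s => fx x s + gx x s) (fun x s => fy x s + gy x s).
Proof.
intros Hf Hg x s Hxs.
destruct (Hf x s Hxs) as (D1 & D2 & K & K1 & K2).
destruct (Hg x s Hxs) as (D1' & D2' & K' & K1' & K2').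
split5.
1, 2: apply (is_derive_plus (K := R_AbsRing) (V := R_NormedModule)); assumption.
all: apply (flim_plus (F := locally (x, s))); assumption.
Qed.

Lemma C1_opp (f fx fy : R -> R -> R) :
  isC1 U f fx fy -> isC1 U (fun x s => - f x s) (fun x s => - fx x s) (fun x s => - fy x s).
Proof.
intros Hf x s Hxs.
destruct (Hf x s Hxs) as (D1 & D2 & K & K1 & K2).
split5.
1, 2: apply (is_derive_opp (K := R_AbsRing) (V := R_NormedModule)); assumption.
all: apply (flim_opp (F := locally (x, s))); assumption.
Qed.

Lemma C1_minus (f fx fy g gx gy : R -> R -> R) :
  isC1 U f fx fy -> isC1 U g gx gy ->
  isC1 U (fun x s => f x s - g x s) (fun x s => fx x s - gx x s) (fun x s => fy x s - gy x s).
Proof. intros Hf Hg. apply C1_plus; [exact Hf |]. now apply C1_opp. Qed.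

Lemma C1_mult (f fx fy g gx gy : R -> R -> R) :
  isC1 U f fx fy -> isC1 U g gx gy ->
  isC1 U (fun x s => f x s * g x s)
    (fun x s => fx x s * g x s + f x s * gx x s)
    (fun x s => fy x s * g x s + f x s * gy x s).
Proof.
intros Hf Hg x s Hxs.
destruct (Hf x s Hxs) as (D1 & D2 & K & K1 & K2).
destruct (Hg x s Hxs) as (D1' & D2' & K' & K1' & K2').
split5.
- apply (is_derive_mult (fun t => f t s) (fun t => g t s)); try assumption; exact Rmult_comm.
- apply (is_derive_mult (fun t => f x t) (fun t => g x t)); try assumption; exact Rmult_comm.
- now apply (flim_mult (F := locally (x, s))).
- now apply (flim_plus (F := locally (x, s))); apply (flim_mult (F := locally (x, s))).
- now apply (flim_plus (F := locally (x, s))); apply (flim_mult (F := locally (x, s))).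
Qed.

Lemma C1_comp (h h' : R -> R) (f fx fy : R -> R -> R) :
  (forall x s, U x s -> is_derive h (f x s) (h' (f x s)) /\ continuous h' (f x s)) ->
  isC1 U f fx fy ->
  isC1 U (fun x s => h (f x s)) (fun x s => fx x s * h' (f x s)) (fun x s => fy x s * h' (f x s)).
Proof.
intros Hh Hf x s Hxs. destruct (Hh x s Hxs) as [D Kh].
destruct (Hf x s Hxs) as (D1 & D2 & K & K1 & K2).
split5.
- now apply (is_derive_comp h (fun t => f t s)).
- now apply (is_derive_comp h (fun t => f x t)).
- apply (flim_comp (F := locally (x, s)) h); [| exact K].
  now apply continuous_of_is_derive with (h' (f x s)).
- apply (flim_mult (F := locally (x, s))); [exact K1 |].
  now apply (flim_comp (F := locally (x, s)) h').
- apply (flim_mult (F := locally (x, s))); [exact K2 |].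
  now apply (flim_comp (F := locally (x, s)) h').
Qed.

Lemma C1_inv (f fx fy : R -> R -> R) :
  (forall x s, U x s -> f x s <> 0) -> isC1 U f fx fy ->
  isC1 U (fun x s => / f x s)
    (fun x s => fx x s * - / (f x s) ^ 2) (fun x s => fy x s * - / (f x s) ^ 2).
Proof.
intros Hn. apply (C1_comp (fun y => / y) (fun y => - / y ^ 2)).
intros x s Hxs. specialize (Hn x s Hxs). split.
- auto_derive; [exact Hn |]. now field.
- apply (ex_derive_continuous (V := R_NormedModule)). auto_derive.
  now rewrite Rmult_1_r; apply Rmult_integral_contrapositive.
Qed.

(** Continuity of [fx] near the point and existence of [fy] at it already give total
    differentiability, hence the chain rule along the curve. *)
Lemma C1_along (f fx fy : R -> R -> R) (k : R -> R) (s k' : R) :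
  open2 U -> isC1 U f fx fy -> U (k s) s -> is_derive k s k' ->
  is_derive (fun t => f (k t) t) s (fx (k s) s * k' + fy (k s) s).
Proof.
intros HU Hf Hs Hk.
destruct (Hf _ _ Hs) as (D1 & D2 & _ & K1 & _).
assert (Hd := is_derive_filterdiff f (k s) s fx (fy (k s) s)).
assert (H1 : filterdiff (fun u : R * R => f (fst u) (snd u)) (locally (k s, s))
   (fun u : R * R => plus (scal (fst u) (fx (k s) s)) (scal (snd u) (fy (k s) s)))).
{ apply Hd; [| exact D2 | exact K1].
  generalize (HU _ _ Hs); apply filter_imp. intros [a b] Hab. now apply Hf. }
assert (H2 : filterdiff (fun t => f (k t) t) (locally s)
   (fun y : R => plus (scal (scal y k') (fx (k s) s)) (scal y (fy (k s) s)))).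
{ apply (filterdiff_comp'_2 (K := R_AbsRing) (T := R_NormedModule) (U := R_NormedModule)
    (V := R_NormedModule) (W := R_NormedModule) k (fun t => t) f s
    (fun y => scal y k') (fun y => y)
    (fun a b => plus (scal a (fx (k s) s)) (scal b (fy (k s) s)))).
  - exact Hk.
  - apply filterdiff_id.
  - exact H1. }
apply filterdiff_ext_lin with (1 := H2). intros y.
unfold plus, scal; simpl; unfold mult; simpl. ring.
Qed.

End C1_calculus.

(** * Flux through a moving curve *)

Definition opn (a b : R -> R) (x s : R) : Prop := a s < x < b s.
Definition cls (a b : R -> R) (x s : R) : Prop := a s <= x <= b s.

(** Continuity relative to the closed region only: on the shock the gradient has different limits
    from the two sides, and its one-sided extensions are uncontrolled elsewhere. *)
Definition cont_cls (a b : R -> R) (f : R -> R -> R) : Prop :=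
  forall x s, cls a b x s ->
    filterlim (uncurry f) (within (fun p => cls a b (fst p) (snd p)) (locally (x, s)))
      (locally (f x s)).

Lemma open2_opn (a b : R -> R) :
  (forall s, continuous a s) -> (forall s, continuous b s) -> open2 (opn a b).
Proof.
intros Ha Hb x s [H1 H2].
assert (La := proj1 (flim_eps (F := locally s) a (a s)) (Ha s) ((x - a s) / 2) ltac:(lra)).
assert (Lb := proj1 (flim_eps (F := locally s) b (b s)) (Hb s) ((b s - x) / 2) ltac:(lra)).
destruct La as [da La], Lb as [db Lb].
apply locally_box.
exists (Rmin (Rmin da db) (Rmin ((x - a s) / 2) ((b s - x) / 2))).
split.
{ repeat apply Rmin_glb_lt; try apply cond_pos; lra. }
intros x' s' Hx Hs.
assert (A1 : Rabs (s' - s) < da)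
  by (eapply Rlt_le_trans; [exact Hs | eapply Rle_trans; [apply Rmin_l | apply Rmin_l]]).
assert (A2 : Rabs (s' - s) < db)
  by (eapply Rlt_le_trans; [exact Hs | eapply Rle_trans; [apply Rmin_l | apply Rmin_r]]).
assert (A3 : Rabs (x' - x) < (x - a s) / 2)
  by (eapply Rlt_le_trans; [exact Hx | eapply Rle_trans; [apply Rmin_r | apply Rmin_l]]).
assert (A4 : Rabs (x' - x) < (b s - x) / 2)
  by (eapply Rlt_le_trans; [exact Hx | eapply Rle_trans; [apply Rmin_r | apply Rmin_r]]).
specialize (La s' A1). specialize (Lb s' A2).
apply Rabs_def2 in La, Lb, A3, A4. unfold opn; simpl. lra.
Qed.

(** * Integrals over a period that depend on a parameter *)

Lemma continuous_RInt_param (f : R -> R -> R) (al be t : R) : al <= be ->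
  (forall t s, continuous (uncurry f) (t, s)) ->
  continuous (fun t => RInt (f t) al be) t.
Proof.
intros Hab Hf.
assert (Hs : forall t s, continuous (f t) s).
{ intros t' s. apply (filterlim_comp _ _ _ (fun s => (t', s)) (uncurry f) _ (locally (t', s))).
  - intros P [d Hd]. exists d. intros y Hy. apply Hd. split; [apply ball_center | exact Hy].
  - exact (Hf t' s). }
assert (Hi : forall t c d, ex_RInt (f t) c d).
{ intros. now apply ex_RInt_cont. }
assert (Hu := uniform_continuity_2d f (t - 1) (t + 1) al be).
apply flim_eps. intros eps He.
set (L := Rabs (be - al) + 1).
assert (HL : 0 < L) by (unfold L; pose proof (Rabs_pos (be - al)); lra).
assert (He' : 0 < eps / L) by (now apply Rdiv_lt_0_compat).
destruct (Hu (fun x y _ _ => proj2 (continuity_2d_pt_filterlim f x y) (Hf x y))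
  (mkposreal _ He')) as [d Hd]. simpl in Hd.
exists (mkposreal (Rmin d 1) (Rmin_glb_lt _ _ _ (cond_pos d) Rlt_0_1)).
intros t' Ht'. change (Rabs (t' - t) < Rmin d 1) in Ht'.
assert (T1 : Rabs (t' - t) < d) by (eapply Rlt_le_trans; [exact Ht' | apply Rmin_l]).
assert (T2 : Rabs (t' - t) < 1) by (eapply Rlt_le_trans; [exact Ht' | apply Rmin_r]).
apply Rabs_def2 in T2.
assert (E : RInt (f t') al be - RInt (f t) al be = RInt (fun s => f t' s - f t s) al be).
{ symmetry. apply (RInt_minus (V := R_CompleteNormedModule)); apply Hi. }
rewrite E.
eapply Rle_lt_trans.
- apply (abs_RInt_le_const (fun s => f t' s - f t s) al be (eps / L)); [exact Hab | |].
  + apply (ex_RInt_minus (V := R_NormedModule)); apply Hi.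
  + intros s Hss. left. apply Hd; try lra. rewrite Rminus_diag, Rabs_R0; apply cond_pos.
- assert (be - al < L) by (unfold L; rewrite Rabs_pos_eq; lra).
  apply Rlt_le_trans with (L * (eps / L)); [| right; field; lra].
  apply Rmult_lt_compat_r; assumption.
Qed.

Lemma RInt_nonneg_eq0 (f : R -> R) (al be c : R) :
  (forall s, continuous f s) -> (forall s, 0 <= f s) ->
  RInt f al be = 0 -> al < c < be -> f c = 0.
Proof.
intros Hf Hp H0 Hc.
destruct (Rle_lt_or_eq_dec _ _ (Hp c)) as [Hlt | Heq]; [exfalso | now symmetry].
destruct (proj1 (flim_eps (F := locally c) f (f c)) (Hf c) (f c) Hlt) as [d Hd].
assert (Hi : forall u v, ex_RInt f u v).
{ intros. now apply ex_RInt_cont. }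
set (u := Rmax al (c - d)). set (v := Rmin be (c + d)).
pose proof (cond_pos d) as Hd0.
assert (Hu : al <= u < c) by (unfold u, Rmax; destruct Rle_dec; lra).
assert (Hu2 : c - d <= u) by apply Rmax_r.
assert (Hv : c < v <= be) by (unfold v, Rmin; destruct Rle_dec; lra).
assert (Hv2 : v <= c + d) by apply Rmin_r.
assert (E : RInt f al be = RInt f al u + (RInt f u v + RInt f v be)).
{ rewrite <- (RInt_Chasles (V := R_CompleteNormedModule) f al u be) by apply Hi.
  rewrite <- (RInt_Chasles (V := R_CompleteNormedModule) f u v be) by apply Hi. reflexivity. }
assert (I1 : 0 <= RInt f al u) by (apply RInt_ge_0; [lra | apply Hi | intros; apply Hp]).
assert (I3 : 0 <= RInt f v be) by (apply RInt_ge_0; [lra | apply Hi | intros; apply Hp]).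
assert (I2 : 0 < RInt f u v).
{ apply RInt_gt_0; [lra | | intros; apply Hf]. intros x Hx.
  assert (Hb : Rabs (x - c) < d) by (apply Rabs_def1; lra).
  specialize (Hd x Hb). apply Rabs_def2 in Hd. lra. }
lra.
Qed.

(** Precomposition with [clamp] makes a function controlled on [0, 1] continuous on the whole line,
    with no one-sided limits at 0 and 1. *)
Definition clamp (t : R) : R := Rmax 0 (Rmin 1 t).

Lemma clamp_range (t : R) : 0 <= clamp t <= 1.
Proof. unfold clamp, Rmax, Rmin; repeat destruct Rle_dec; lra. Qed.

Lemma clamp_id (t : R) : 0 <= t <= 1 -> clamp t = t.
Proof. intros; unfold clamp, Rmax, Rmin; repeat destruct Rle_dec; lra. Qed.

Lemma continuous_clamp (t : R) : continuous clamp t.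
Proof.
apply flim_eps. intros eps He. exists (mkposreal _ He).
intros y Hy. change (Rabs (y - t) < eps) in Hy.
eapply Rle_lt_trans; [| exact Hy].
unfold clamp, Rmax, Rmin, Rabs; repeat destruct Rle_dec; repeat destruct Rcase_abs; lra.
Qed.

(** * Monotonicity of the total flux *)

Section Flux.

Variables (a b a' b' : R -> R) (W1 W2 W11 W12 W21 W22 : R -> R -> R).
Hypothesis Da : forall s, is_derive a s (a' s).
Hypothesis Db : forall s, is_derive b s (b' s).
Hypothesis Ka : forall s, continuous a' s.
Hypothesis Kb : forall s, continuous b' s.
Hypothesis Hab : forall s, a s < b s.
Hypothesis Pa : forall s, a (s + 2 * PI) = a s.
Hypothesis Pb : forall s, b (s + 2 * PI) = b s.
Hypothesis PW : forall x s, opn a b x s -> W2 x (s + 2 * PI) = W2 x s.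
Hypothesis HW1 : isC1 (opn a b) W1 W11 W12.
Hypothesis HW2 : isC1 (opn a b) W2 W21 W22.
Hypothesis KW1 : cont_cls a b W1.
Hypothesis KW2 : cont_cls a b W2.
Hypothesis Hdiv : forall x s, opn a b x s -> 0 <= W11 x s + W22 x s.
Hypothesis Hfa : forall s, 0 <= W1 (a s) s - a' s * W2 (a s) s.
Hypothesis Hfb : forall s, W1 (b s) s - b' s * W2 (b s) s <= 0.

(** The curves [x = X t s] interpolate between the two boundary curves. [X'] is the derivative in
    [s], so [w] pairs the field with the normal (1, - X'): it is the density in [s] of the flux
    through the curve of parameter [t]. *)
Let X (t s : R) : R := (1 - t) * a s + t * b s.
Let X' (t s : R) : R := (1 - t) * a' s + t * b' s.
Let w (t s : R) : R := W1 (X t s) s - X' t s * W2 (X t s) s.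
Let wc (t s : R) : R := w (clamp t) s.

Let X_opn (t s : R) : 0 < t < 1 -> opn a b (X t s) s.
Proof. intros Ht. specialize (Hab s). unfold opn, X. nra. Qed.

Let X_cls (t s : R) : 0 <= t <= 1 -> cls a b (X t s) s.
Proof. intros Ht. specialize (Hab s). unfold cls, X. nra. Qed.

Let Ka0 (s : R) : continuous a s.
Proof. exact (continuous_of_is_derive _ _ _ (Da s)). Qed.
Let Kb0 (s : R) : continuous b s.
Proof. exact (continuous_of_is_derive _ _ _ (Db s)). Qed.

Let lim_aff (F : (R * R -> Prop) -> Prop) (FF : Filter F) (f g : R * R -> R) (h k : R -> R)
    (t s : R) :
  filterlim f F (locally t) -> filterlim g F (locally s) ->
  continuous h s -> continuous k s ->
  filterlim (fun p => (1 - f p) * h (g p) + f p * k (g p)) F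
    (locally ((1 - t) * h s + t * k s)).
Proof.
intros Hf Hg Hh Hk.
apply flim_plus; apply flim_mult; try exact Hf; try (now apply flim_comp).
apply flim_minus; [apply filterlim_const | exact Hf].
Qed.

Let wc_cont (t s : R) : continuous (uncurry wc) (t, s).
Proof.
assert (Lt : filterlim (fun p : R * R => clamp (fst p)) (locally (t, s)) (locally (clamp t))).
{ apply flim_comp; [apply continuous_clamp | apply continuous_fst2]. }
assert (Ls := continuous_snd2 t s).
assert (LX := lim_aff _ _ _ _ a b _ _ Lt Ls (Ka0 s) (Kb0 s)).
assert (LX' := lim_aff _ _ _ _ a' b' _ _ Lt Ls (Ka s) (Kb s)).
assert (LP : filterlim (fun p : R * R => (X (clamp (fst p)) (snd p), snd p)) (locally (t, s))
   (within (fun p => cls a b (fst p) (snd p)) (locally (X (clamp t) s, s)))).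
{ intros P HP. unfold within in HP. apply locally_box in HP. destruct HP as [d [Hd HP]].
  assert (L1 := proj1 (flim_eps (F := locally (t, s)) _ _) LX d Hd).
  assert (L2 := proj1 (flim_eps (F := locally (t, s)) _ _) Ls d Hd).
  unfold filtermap. generalize (filter_and _ _ L1 L2). apply filter_imp. intros [t' s'] [B1 B2]; simpl in *.
  apply (HP _ _ B1 B2). apply X_cls, clamp_range. }
assert (C := X_cls (clamp t) s (clamp_range t)).
apply (flim_minus (F := locally (t, s)) (fun p => W1 (X (clamp (fst p)) (snd p)) (snd p))
  (fun p => X' (clamp (fst p)) (snd p) * W2 (X (clamp (fst p)) (snd p)) (snd p))).
- exact (filterlim_comp _ _ _ _ _ _ _ _ LP (KW1 _ _ C)).
- apply flim_mult; [exact LX' |].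
  exact (filterlim_comp _ _ _ _ _ _ _ _ LP (KW2 _ _ C)).
Qed.

Let cont_sec (f : R -> R -> R) (t s : R) :
  continuous (uncurry f) (t, s) -> continuous (f t) s.
Proof.
intros Hf. apply (filterlim_comp _ _ _ (fun s => (t, s)) (uncurry f) _ (locally (t, s))).
- intros P [d Hd]. exists d. intros y Hy. apply Hd. split; [apply ball_center | exact Hy].
- exact Hf.
Qed.

Let dw (t s : R) : R :=
  W11 (X t s) s * (b s - a s)
  - ((b' s - a' s) * W2 (X t s) s + X' t s * (W21 (X t s) s * (b s - a s))).

Let dw_derive (t s : R) : 0 < t < 1 -> is_derive (fun u => wc u s) t (dw t s).
Proof.
intros Ht.
apply (is_derive_ext_loc (fun u => w u s)).
{ apply (locally_interval _ t 0 1); simpl; try lra.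
  intros y H1 H2. unfold wc. rewrite clamp_id; [reflexivity | simpl in *; lra]. }
destruct (HW1 _ _ (X_opn t s Ht)) as (D1 & _).
destruct (HW2 _ _ (X_opn t s Ht)) as (D2 & _).
assert (DX : is_derive (fun u => X u s) t (b s - a s)).
{ unfold X. auto_derive; [exact I | ring]. }
assert (DX' : is_derive (fun u => X' u s) t (b' s - a' s)).
{ unfold X'. auto_derive; [exact I | ring]. }
assert (E1 := is_derive_comp (fun y => W1 y s) (fun u => X u s) t _ _ D1 DX).
assert (E2 := is_derive_comp (fun y => W2 y s) (fun u => X u s) t _ _ D2 DX).
assert (E3 := is_derive_mult _ _ _ _ _ DX' E2 Rmult_comm).
assert (E4 := is_derive_minus _ _ _ _ _ E1 E3).
evar_last; [exact E4 |].
unfold dw, minus, plus, opp, scal, mult; simpl; unfold mult; simpl. ring.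
Qed.

Let lim_X (t s : R) : 0 < t < 1 ->
  filterlim (fun p : R * R => (X (fst p) (snd p), snd p)) (locally (t, s))
    (locally (X t s, s)).
Proof.
intros Ht P HP. apply locally_box in HP. destruct HP as [d [Hd HP]].
assert (LX := lim_aff _ _ _ _ a b _ _ (continuous_fst2 t s) (continuous_snd2 t s) (Ka0 s) (Kb0 s)).
assert (L1 := proj1 (flim_eps (F := locally (t, s)) _ _) LX d Hd).
assert (L2 := proj1 (flim_eps (F := locally (t, s)) _ _) (continuous_snd2 t s) d Hd).
unfold filtermap. generalize (filter_and _ _ L1 L2). apply filter_imp. intros [t' s'] [B1 B2]; simpl in *.
exact (HP _ _ B1 B2).
Qed.

Let lim_ba (t s : R) :
  filterlim (fun p : R * R => b (snd p) - a (snd p)) (locally (t, s)) (locally (b s - a s)).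
Proof.
apply flim_minus; apply flim_comp; try apply continuous_snd2; [apply Kb0 | apply Ka0].
Qed.

Let dw_cont (t s : R) : 0 < t < 1 -> continuous (uncurry dw) (t, s).
Proof.
intros Ht.
destruct (HW1 _ _ (X_opn t s Ht)) as (_ & _ & _ & K11 & _).
destruct (HW2 _ _ (X_opn t s Ht)) as (_ & _ & K2 & K21 & _).
assert (LX := lim_X t s Ht).
assert (LX' := lim_aff _ _ _ _ a' b' _ _ (continuous_fst2 t s) (continuous_snd2 t s) (Ka s) (Kb s)).
assert (Lba := lim_ba t s).
apply (flim_minus (F := locally (t, s))
  (fun p => W11 (X (fst p) (snd p)) (snd p) * (b (snd p) - a (snd p)))).
- apply flim_mult; [| exact Lba]. exact (filterlim_comp _ _ _ _ _ _ _ _ LX K11).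
- apply flim_plus.
  + apply flim_mult; [| exact (filterlim_comp _ _ _ _ _ _ _ _ LX K2)].
    apply flim_minus; apply flim_comp; try apply continuous_snd2; [apply Kb | apply Ka].
  + apply flim_mult; [exact LX' |]. apply flim_mult; [| exact Lba].
    exact (filterlim_comp _ _ _ _ _ _ _ _ LX K21).
Qed.

(** The divergence times the Jacobian [b - a] of the coordinates (t, s). *)
Let dv (t s : R) : R := (W11 (X t s) s + W22 (X t s) s) * (b s - a s).

Let dv_cont (t s : R) : 0 < t < 1 -> continuous (dv t) s.
Proof.
intros Ht. apply cont_sec.
destruct (HW1 _ _ (X_opn t s Ht)) as (_ & _ & _ & K11 & _).
destruct (HW2 _ _ (X_opn t s Ht)) as (_ & _ & _ & _ & K22).
assert (LX := lim_X t s Ht).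
apply (flim_mult (F := locally (t, s))
  (fun p => W11 (X (fst p) (snd p)) (snd p) + W22 (X (fst p) (snd p)) (snd p))); [| apply lim_ba].
apply flim_plus.
- exact (filterlim_comp _ _ _ _ _ _ _ _ LX K11).
- exact (filterlim_comp _ _ _ _ _ _ _ _ LX K22).
Qed.

(* The [x]-derivative of the flux integrand is the divergence minus the
   [s]-derivative of the periodic function [W2 (b - a)]. *)
Let RInt_dw (t al : R) : 0 < t < 1 ->
  RInt (dw t) al (al + 2 * PI) = RInt (dv t) al (al + 2 * PI).
Proof.
intros Ht.
set (g := fun s => W2 (X t s) s * (b s - a s)).
set (g' := fun s => (W21 (X t s) s * X' t s + W22 (X t s) s) * (b s - a s)
                    + W2 (X t s) s * (b' s - a' s)).
assert (Dg : forall s, is_derive g s (g' s)).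
{ intros s.
  assert (DX : is_derive (X t) s (X' t s)).
  { unfold X, X'. assert (H1 := is_derive_scal a s (1 - t) _ (Da s)).
    assert (H2 := is_derive_scal b s t _ (Db s)).
    exact (is_derive_plus _ _ _ _ _ H1 H2). }
  assert (E1 := C1_along _ _ _ _ _ _ _ (open2_opn a b Ka0 Kb0) HW2 (X_opn t s Ht) DX).
  assert (E2 := is_derive_minus _ _ _ _ _ (Db s) (Da s)).
  exact (is_derive_mult _ _ _ _ _ E1 E2 Rmult_comm). }
assert (E : forall s, dw t s = dv t s - g' s).
{ intros s. unfold dw, dv, g'. ring. }
assert (Kdw : forall s, continuous (dw t) s).
{ intros s. apply cont_sec. now apply dw_cont. }
assert (Kdv : forall s, continuous (dv t) s) by (intros; now apply dv_cont).
assert (Kg' : forall s, continuous g' s).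
{ intros s. apply (continuous_ext (fun s => dv t s - dw t s)).
  - intros y. change (dv t y - dw t y = g' y). rewrite E. ring.
  - apply (flim_minus (F := locally s)); [apply Kdv | apply Kdw]. }
assert (Ig : RInt g' al (al + 2 * PI) = 0).
{ rewrite (is_RInt_unique _ _ _ _ (is_RInt_derive (V := R_CompleteNormedModule) g g' al (al + 2 * PI)
    (fun s _ => Dg s) (fun s _ => Kg' s))).
  change (g (al + 2 * PI) + - g al = 0). unfold g.
  assert (EX : X t (al + 2 * PI) = X t al) by (unfold X; now rewrite Pa, Pb).
  rewrite EX, Pa, Pb, PW by now apply X_opn. ring. }
rewrite (RInt_ext _ (fun s => minus (dv t s) (g' s))) by (intros; apply E).
rewrite (RInt_minus (V := R_CompleteNormedModule)).
- rewrite Ig. apply (Rminus_0_r (RInt (dv t) al (al + 2 * PI))).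
- now apply ex_RInt_cont.
- now apply ex_RInt_cont.
Qed.

Let F (al t : R) : R := RInt (wc t) al (al + 2 * PI).

Let F_derive (al t : R) : 0 < t < 1 ->
  is_derive (F al) t (RInt (dv t) al (al + 2 * PI)).
Proof.
intros Ht. rewrite <- RInt_dw by exact Ht.
assert (Lt : locally t (fun u => 0 < u < 1)).
{ apply (locally_interval _ t 0 1); simpl; try lra. intros y H1 H2; simpl in *; lra. }
rewrite (RInt_ext (dw t) (fun s => Derive (fun u => wc u s) t)).
2: { intros s _. symmetry. apply is_derive_unique. now apply dw_derive. }
apply is_derive_RInt_param.
- revert Lt; apply filter_imp. intros u Hu s _. exists (dw u s). now apply dw_derive.
- intros s _. apply continuity_2d_pt_ext_loc with dw.
  + destruct Lt as [d Hd]. exists d. intros u v Hu _. symmetry.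
    apply is_derive_unique, dw_derive, Hd, Hu.
  + apply continuity_2d_pt_filterlim. now apply dw_cont.
- apply filter_forall. intros u.
  apply ex_RInt_cont. intros s. now apply cont_sec.
Qed.

Let F_zero (al t : R) : 0 <= t <= 1 -> F al t = 0.
Proof.
assert (Hpi := PI_RGT_0).
assert (Hw0 : forall s, 0 <= wc 0 s).
{ intros s. unfold wc, w. rewrite clamp_id by lra.
  replace (X 0 s) with (a s) by (unfold X; ring).
  replace (X' 0 s) with (a' s) by (unfold X'; ring). apply Hfa. }
assert (Hw1 : forall s, wc 1 s <= 0).
{ intros s. unfold wc, w. rewrite clamp_id by lra.
  replace (X 1 s) with (b s) by (unfold X; ring).
  replace (X' 1 s) with (b' s) by (unfold X'; ring). apply Hfb. }
assert (Hi : forall t, ex_RInt (wc t) al (al + 2 * PI)).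
{ intros u. apply ex_RInt_cont. intros s. now apply cont_sec. }
assert (F0 : 0 <= F al 0).
{ apply RInt_ge_0; [lra | apply Hi | intros; apply Hw0]. }
assert (F1 : F al 1 <= 0).
{ assert (0 <= - F al 1); [| lra].
  unfold F. rewrite <- (RInt_opp (V := R_CompleteNormedModule)) by apply Hi.
  apply RInt_ge_0; [lra | apply (ex_RInt_opp (V := R_NormedModule)), Hi |].
  intros s _. specialize (Hw1 s). unfold opp; simpl. lra. }
assert (mono : forall u v, 0 <= u <= v -> v <= 1 -> F al u <= F al v).
{ intros u v Huv Hv.
  destruct (Req_dec u v) as [-> | Hne]; [apply Rle_refl |].
  (* The intermediate point may be an end of [0, 1], where [F] need not be differentiable; the
     positive part has a known sign there too and agrees with the derivative inside. *)
  destruct (MVT_gen (F al) u v (fun t => Rmax 0 (Derive (F al) t))) as [c [Hc Ec]].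
  - intros x Hx. rewrite Rmin_left, Rmax_right in Hx by lra.
    rewrite (is_derive_unique _ _ _ (F_derive al x ltac:(lra))).
    rewrite Rmax_right; [apply F_derive; lra |].
    apply RInt_ge_0; [lra | |].
    + apply ex_RInt_cont. intros; apply dv_cont; lra.
    + intros s _. assert (Ho := X_opn x s ltac:(lra)). specialize (Hdiv _ _ Ho).
      specialize (Hab s). unfold dv. nra.
  - intros x Hx. apply continuity_pt_filterlim. apply (continuous_RInt_param wc); [lra | apply wc_cont].
  - assert (0 <= Rmax 0 (Derive (F al) c)) by apply Rmax_l. nra. }
intros Ht. pose proof (mono 0 t ltac:(lra) ltac:(lra)). pose proof (mono t 1 ltac:(lra) ltac:(lra)).
lra.
Qed.

(** The total flux is nonnegative on the first curve, does not decrease, and is nonpositive on the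
    last one, so it vanishes on all of them. Its derivative is the integral of a continuous
    nonnegative divergence, which must vanish pointwise; the same argument applies to the flux
    density on the last curve. *)
Lemma flux_rigidity :
  (forall x s, opn a b x s -> W11 x s + W22 x s = 0) /\
  (forall s, W1 (b s) s - b' s * W2 (b s) s = 0).
Proof.
assert (Hpi := PI_RGT_0).
split.
- intros x s Hxs.
  set (t := (x - a s) / (b s - a s)).
  assert (Hb := Hab s). destruct Hxs as [Hx1 Hx2].
  assert (Ht : 0 < t < 1).
  { split; [apply Rdiv_lt_0_compat; lra |].
    apply Rmult_lt_reg_r with (b s - a s); [lra |]. unfold t. field_simplify; lra. }
  assert (EX : X t s = x) by (unfold X, t; field; lra).
  (* Starting the period at [s - PI] puts [s] strictly inside the interval of integration. *)
  assert (Z : RInt (dv t) (s - PI) (s - PI + 2 * PI) = 0).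
  { rewrite <- (is_derive_unique _ _ _ (F_derive (s - PI) t Ht)).
    rewrite (Derive_ext_loc _ (fun _ => 0)); [apply Derive_const |].
    apply (locally_interval _ t 0 1); simpl; try lra.
    intros y H1 H2. apply F_zero. simpl in *; lra. }
  assert (Z2 : dv t s = 0).
  { apply RInt_nonneg_eq0 with (s - PI) (s - PI + 2 * PI); try lra.
    - intros; now apply dv_cont.
    - intros s'. assert (Ho := X_opn t s' Ht). specialize (Hdiv _ _ Ho).
      specialize (Hab s'). unfold dv. nra. }
  unfold dv in Z2. rewrite EX in Z2.
  apply Rmult_integral in Z2. destruct Z2; [assumption | lra].
- intros s.
  assert (Ew : forall s, wc 1 s = W1 (b s) s - b' s * W2 (b s) s).
  { intros s'. unfold wc, w. rewrite clamp_id by lra.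
    replace (X 1 s') with (b s') by (unfold X; ring).
    replace (X' 1 s') with (b' s') by (unfold X'; ring). reflexivity. }
  assert (Z := F_zero (s - PI) 1 ltac:(lra)). unfold F in Z.
  assert (Kw : forall s, continuous (wc 1) s) by (intros; now apply cont_sec).
  assert (Z2 : - wc 1 s = 0).
  { apply (RInt_nonneg_eq0 (fun s => - wc 1 s)) with (s - PI) (s - PI + 2 * PI); try lra.
    - intros s'. apply (flim_opp (F := locally s')), Kw.
    - intros s'. specialize (Hfb s'). rewrite Ew. lra.
    - rewrite (RInt_opp (V := R_CompleteNormedModule)).
      + rewrite Z. unfold opp; simpl. ring.
      + now apply ex_RInt_cont. }
  rewrite <- Ew. lra.
Qed.

End Flux.

(** * One-sided traces of the potential *)

(** Compactness arguments run over one period; this carries their conclusion to the whole line. *)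
Lemma periodic_reduce (P : R -> Prop) :
  (forall s, P s <-> P (s + 2 * PI)) -> (forall s, 0 <= s <= 2 * PI -> P s) -> forall s, P s.
Proof.
intros Hp H0. assert (Hpi := PI_RGT_0).
assert (H : forall n s, - (2 * PI * INR n) <= s <= 2 * PI * INR n -> P s).
{ induction n as [| n IH]; intros s Hs.
  - simpl in Hs. apply H0. lra.
  - rewrite S_INR in Hs. destruct (Rlt_le_dec s 0).
    + apply Hp. destruct (Rle_dec 0 (s + 2 * PI)); [apply H0; lra |].
      apply IH. lra.
    + replace s with ((s - 2 * PI) + 2 * PI) by ring. apply (Hp (s - 2 * PI)).
      destruct (Rle_dec s (2 * PI)).
      * apply (Hp (s - 2 * PI)). replace (s - 2 * PI + 2 * PI) with s by ring. apply H0; lra.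
      * apply IH. pose proof (pos_INR n). nra. }
intros s. destruct (INR_unbounded (Rabs s / (2 * PI))) as [n Hn].
apply (H n). apply Rabs_le_between.
apply Rmult_lt_compat_r with (r := 2 * PI) in Hn; [| lra].
unfold Rdiv in Hn. rewrite Rmult_assoc, Rinv_l in Hn by lra. lra.
Qed.

(** * Functions continuous up to the boundary of a region between two curves *)

Section Region.

Variables a b : R -> R.
Hypothesis Ka : forall s, continuous a s.
Hypothesis Kb : forall s, continuous b s.
Hypothesis Hab : forall s, a s < b s.

(** Any motion along the section towards its midpoint enters the open region at once. *)
Lemma cls_near (x s eta : R) : cls a b x s -> 0 < eta ->
  exists y, Rabs (y - x) < eta /\ opn a b y s.
Proof.
intros [H1 H2] He. assert (H := Hab s).
set (th := Rmin (1 / 2) (eta / (b s - a s))).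
assert (T0 : 0 < th) by (apply Rmin_glb_lt; [lra | apply Rdiv_lt_0_compat; lra]).
assert (T1 : th <= 1 / 2) by apply Rmin_l.
assert (T2 : th * (b s - a s) <= eta).
{ apply Rle_trans with (eta / (b s - a s) * (b s - a s)).
  - apply Rmult_le_compat_r; [lra | apply Rmin_r].
  - right; field; lra. }
exists (x + th * ((a s + b s) / 2 - x)). split.
- replace (x + th * ((a s + b s) / 2 - x) - x) with (th * ((a s + b s) / 2 - x)) by ring.
  apply Rabs_def1; clear - T0 T1 T2 H1 H2 H He; nra.
- unfold opn. clear - T0 T1 H1 H2 H. split; nra.
Qed.

Lemma within_opn_proper (x s : R) : cls a b x s ->
  ProperFilter (within (fun p => opn a b (fst p) (snd p)) (locally (x, s))).
Proof.
intros Hc. constructor.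
- intros P HP. unfold within in HP. apply locally_box in HP. destruct HP as [d [Hd HP]].
  destruct (cls_near x s d Hc Hd) as [y [Hy Ho]].
  exists (y, s). apply HP; [exact Hy | now rewrite Rminus_diag, Rabs_R0 | exact Ho].
- apply within_filter. apply locally_filter.
Qed.

Lemma cont_cls_eq (f g : R -> R -> R) : cont_cls a b f -> cont_cls a b g ->
  (forall x s, opn a b x s -> f x s = g x s) -> forall x s, cls a b x s -> f x s = g x s.
Proof.
intros Hf Hg H x s Hc.
assert (PF := within_opn_proper x s Hc).
assert (Le : forall h, cont_cls a b h ->
  filterlim (uncurry h) (within (fun p => opn a b (fst p) (snd p)) (locally (x, s)))
    (locally (h x s))).
{ intros h Hh. specialize (Hh x s Hc). intros P HP. generalize (Hh P HP).
  unfold filtermap, within. apply filter_imp. intros p Hp Ho. apply Hp.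
  unfold opn, cls in *; lra. }
apply (flim_eq (F := within (fun p => opn a b (fst p) (snd p)) (locally (x, s))) (uncurry f));
  [now apply Le |].
apply filterlim_within_ext with (uncurry g); [| now apply Le].
intros [x' s'] Ho. symmetry. now apply H.
Qed.

(** Each [g x' s'] is nearly attained by [f] at an interior point so close to (x', s') that it still
    lies in the neighbourhood where [f] is close to [g x s]. *)
Lemma cont_cls_of_limits (f g : R -> R -> R) :
  (forall x s, cls a b x s ->
    filterlim (uncurry f) (within (fun p => opn a b (fst p) (snd p)) (locally (x, s)))
      (locally (g x s))) ->
  cont_cls a b g.
Proof.
intros H x s Hc. apply flim_eps. intros eps He.
assert (L := proj1 (flim_eps _ _) (H x s Hc) (eps / 2) ltac:(lra)).
apply locally_box in L. destruct L as [d [Hd L]].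
apply locally_box. exists (d / 2). split; [lra |]. intros x' s' Hx Hs Hc'.
assert (L' := proj1 (flim_eps _ _) (H x' s' Hc') (eps / 2) ltac:(lra)).
apply locally_box in L'. destruct L' as [d' [Hd' L']].
destruct (cls_near x' s' (Rmin d' (d / 2)) Hc') as [y [Hy Ho]]; [apply Rmin_glb_lt; lra |].
assert (Hy1 : Rabs (y - x') < d') by (eapply Rlt_le_trans; [exact Hy | apply Rmin_l]).
assert (Hy2 : Rabs (y - x') < d / 2) by (eapply Rlt_le_trans; [exact Hy | apply Rmin_r]).
specialize (L y s'). specialize (L' y s').
simpl in *. unfold uncurry in *; simpl in *.
assert (E1 : Rabs (f y s' - g x s) < eps / 2).
{ apply L; [| lra | exact Ho]. replace (y - x) with ((y - x') + (x' - x)) by ring.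
  eapply Rle_lt_trans; [apply Rabs_triang | lra]. }
assert (E2 : Rabs (f y s' - g x' s') < eps / 2).
{ apply L'; [exact Hy1 | now rewrite Rminus_diag, Rabs_R0 | exact Ho]. }
apply Rabs_def2 in E1, E2. apply Rabs_def1; lra.
Qed.

Lemma cont_cls_shift (f : R -> R -> R) (d : R) :
  (forall s, a (s + d) = a s) -> (forall s, b (s + d) = b s) ->
  cont_cls a b f -> cont_cls a b (fun x s => f x (s + d)).
Proof.
intros Pa Pb Hf x s Hc.
assert (Hc' : cls a b x (s + d)) by (unfold cls in *; now rewrite Pa, Pb).
apply flim_eps. intros eps He.
assert (L := proj1 (flim_eps _ _) (Hf _ _ Hc') eps He).
apply locally_box in L. destruct L as [dl [Hd L]].
apply locally_box. exists dl. split; [exact Hd |]. intros x' s' Hx Hs Hc''.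
apply (L x' (s' + d)); [exact Hx | | simpl in *; unfold cls in *; now rewrite Pa, Pb].
now replace (s' + d - (s + d)) with (s' - s) by ring.
Qed.

Lemma cont_cls_periodic (f : R -> R -> R) (d : R) :
  (forall s, a (s + d) = a s) -> (forall s, b (s + d) = b s) -> cont_cls a b f ->
  (forall x s, opn a b x s -> f x (s + d) = f x s) ->
  forall x s, cls a b x s -> f x (s + d) = f x s.
Proof.
intros Pa Pb Kf Hf. apply (cont_cls_eq (fun x s => f x (s + d)) f); try assumption.
now apply cont_cls_shift.
Qed.

Lemma cont_cls_eps (f : R -> R -> R) : cont_cls a b f ->
  forall x s, cls a b x s -> forall eps, 0 < eps ->
  exists d, 0 < d /\ forall x' s', cls a b x' s' -> Rabs (x' - x) < d -> Rabs (s' - s) < d ->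
    Rabs (f x' s' - f x s) < eps.
Proof.
intros Hf x s Hc eps He.
assert (L := proj1 (flim_eps _ _) (Hf _ _ Hc) eps He).
apply locally_box in L. destruct L as [d [Hd L]].
exists d. split; [exact Hd |]. intros x' s' Hc' Hx Hs. now apply (L x' s').
Qed.

(** * Regularity and periodicity of the one-sided gradient *)

Section Potential.

Variables (phi G1 G2 : R -> R -> R).
Hypothesis Hphi : C2_on (fun p => opn a b (fst p) (snd p)) phi.
Hypothesis HG1 : forall x s, cls a b x s ->
  filterlim (uncurry (d1 phi)) (within (fun p => opn a b (fst p) (snd p)) (locally (x, s)))
    (locally (G1 x s)).
Hypothesis HG2 : forall x s, cls a b x s ->
  filterlim (uncurry (d2 phi)) (within (fun p => opn a b (fst p) (snd p)) (locally (x, s)))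
    (locally (G2 x s)).

Lemma opn_cls (x s : R) : opn a b x s -> cls a b x s.
Proof. unfold opn, cls; lra. Qed.

Lemma limit_inside (f g : R -> R -> R) (x s : R) :
  filterlim (uncurry f) (within (fun p => opn a b (fst p) (snd p)) (locally (x, s)))
      (locally (g x s)) ->
  continuous (uncurry f) (x, s) -> opn a b x s -> f x s = g x s.
Proof.
intros H K Ho.
assert (PF := within_opn_proper x s (opn_cls _ _ Ho)).
apply (flim_eq (F := within (fun p => opn a b (fst p) (snd p)) (locally (x, s))) (uncurry f));
  [| exact H].
now apply flim_within.
Qed.

Lemma G1_inside (x s : R) : opn a b x s -> d1 phi x s = G1 x s.
Proof.
intros Ho. apply limit_inside; [now apply HG1, opn_cls | | exact Ho].
now destruct (Hphi x s Ho) as (_ & _ & _ & _ & _ & _ & _ & K & _).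
Qed.

Lemma G2_inside (x s : R) : opn a b x s -> d2 phi x s = G2 x s.
Proof.
intros Ho. apply limit_inside; [now apply HG2, opn_cls | | exact Ho].
now destruct (Hphi x s Ho) as (_ & _ & _ & _ & _ & _ & _ & _ & K & _).
Qed.

Lemma schwarz_inside (x s : R) : opn a b x s -> d1 (d2 phi) x s = d2 (d1 phi) x s.
Proof.
intros Ho.
destruct (Hphi x s Ho) as (_ & _ & _ & _ & _ & _ & _ & _ & _ & _ & K1 & K2 & _).
apply (Schwarz phi x s).
- apply locally_2d_locally. generalize (open2_opn a b Ka Kb x s Ho). apply filter_imp.
  intros [x' s'] Ho'. destruct (Hphi x' s' Ho') as (D1 & D2 & _ & D4 & D5 & _). now repeat split.
- now apply continuity_2d_pt_filterlim.
- now apply continuity_2d_pt_filterlim.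
Qed.

Lemma phi_isC1 : isC1 (opn a b) phi G1 G2.
Proof.
apply C1_ext with phi (d1 phi) (d2 phi); try (now intros).
- now apply open2_opn.
- exact G1_inside.
- exact G2_inside.
- intros x s Ho. destruct (Hphi x s Ho) as (D1 & D2 & _ & _ & _ & _ & K & K1 & K2 & _).
  split5; try assumption; now apply Derive_correct.
Qed.

Lemma G1_isC1 : isC1 (opn a b) G1 (d1 (d1 phi)) (d2 (d1 phi)).
Proof.
apply C1_ext with (d1 phi) (d1 (d1 phi)) (d2 (d1 phi)); try (now intros).
- now apply open2_opn.
- exact G1_inside.
- intros x s Ho.
  destruct (Hphi x s Ho) as (_ & _ & D1 & D2 & _ & _ & _ & K & _ & K1 & K2 & _).
  split5; try assumption; now apply Derive_correct.
Qed.

(** The x-partial is given as [d2 (d1 phi)], the very s-partial of [G1]. This is the irrotationality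
    of the flow, and the upstream divergence identity rests on it. *)
Lemma G2_isC1 : isC1 (opn a b) G2 (d2 (d1 phi)) (d2 (d2 phi)).
Proof.
apply C1_ext with (d2 phi) (d1 (d2 phi)) (d2 (d2 phi)); try (now intros).
- now apply open2_opn.
- exact G2_inside.
- exact schwarz_inside.
- intros x s Ho.
  destruct (Hphi x s Ho) as (_ & _ & _ & _ & D1 & D2 & _ & _ & K & _ & _ & K1 & K2).
  split5; try assumption; now apply Derive_correct.
Qed.

Hypothesis Pa : forall s, a (s + 2 * PI) = a s.
Hypothesis Pb : forall s, b (s + 2 * PI) = b s.
Hypothesis Pphi : forall x s, phi x (s + 2 * PI) = phi x s.

Lemma opn_periodic (x s : R) : opn a b x s -> opn a b x (s + 2 * PI).
Proof. unfold opn. now rewrite Pa, Pb. Qed.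

Lemma G1_periodic (x s : R) : opn a b x s -> G1 x (s + 2 * PI) = G1 x s.
Proof.
intros Ho. rewrite <- !G1_inside by (try apply opn_periodic; exact Ho).
apply Derive_ext. intros t. apply Pphi.
Qed.

Lemma G2_periodic (x s : R) : opn a b x s -> G2 x (s + 2 * PI) = G2 x s.
Proof.
intros Ho.
destruct (phi_isC1 _ _ (opn_periodic _ _ Ho)) as (_ & D & _).
destruct (phi_isC1 _ _ Ho) as (_ & D' & _).
rewrite <- (is_derive_unique _ _ _ D').
symmetry. now apply is_derive_unique, is_derive_periodic with (2 * PI).
Qed.

End Potential.

End Region.

(* Slide the curve [x = c s] towards [x = e s], into the region. *)
Lemma trace_derive (a b c e c' e' : R -> R) (phi G1 G2 : R -> R -> R) (s0 : R) :
  (forall s, continuous a s) -> (forall s, continuous b s) ->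
  isC1 (opn a b) phi G1 G2 -> cont_cls a b G1 -> cont_cls a b G2 ->
  (forall s, is_derive c s (c' s)) -> (forall s, is_derive e s (e' s)) ->
  (forall s, continuous c' s) -> (forall s, continuous e' s) ->
  (forall t s, 0 < t < 1 -> opn a b ((1 - t) * c s + t * e s) s) ->
  (forall s, cls a b (c s) s) ->
  (forall s, filterlim (fun t => phi ((1 - t) * c s + t * e s) s) (at_right 0)
     (locally (phi (c s) s))) ->
  is_derive (fun s => phi (c s) s) s0 (G1 (c s0) s0 * c' s0 + G2 (c s0) s0).
Proof.
intros Ka Kb HC KG1 KG2 Dc De Kc' Ke' Ho Hc Kphi.
set (L := G1 (c s0) s0 * c' s0 + G2 (c s0) s0).
set (X := fun t s => (1 - t) * c s + t * e s).
set (X' := fun t s => (1 - t) * c' s + t * e' s).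
set (D := fun t s => G1 (X t s) s * X' t s + G2 (X t s) s).
assert (Dphi : forall t s, 0 < t < 1 -> is_derive (fun s => phi (X t s) s) s (D t s)).
{ intros t s Ht. apply (C1_along (opn a b)); [now apply open2_opn | exact HC | now apply Ho |].
  assert (H1 := is_derive_scal c s (1 - t) _ (Dc s)).
  assert (H2 := is_derive_scal e s t _ (De s)).
  exact (is_derive_plus _ _ _ _ _ H1 H2). }
assert (Kc : forall s, continuous c s) by (intros s; exact (continuous_of_is_derive _ _ _ (Dc s))).
assert (Ke : forall s, continuous e s) by (intros s; exact (continuous_of_is_derive _ _ _ (De s))).
assert (Laff : forall h k : R -> R, continuous h s0 -> continuous k s0 ->
  filterlim (fun p : R * R => (1 - fst p) * h (snd p) + fst p * k (snd p)) (locally (0, s0))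
    (locally (h s0))).
{ intros h k Kh Kk. replace (h s0) with ((1 - 0) * h s0 + 0 * k s0) by ring.
  apply flim_plus; apply flim_mult; try apply continuous_fst2;
    try (apply flim_comp; [assumption | apply continuous_snd2]).
  apply flim_minus; [apply filterlim_const | apply continuous_fst2]. }
set (Q := within (fun p : R * R => 0 < fst p < 1) (locally (0, s0))).
assert (FQ : Filter Q) by (apply within_filter; apply locally_filter).
assert (LX := Laff c e (Kc s0) (Ke s0)). assert (LX' := Laff c' e' (Kc' s0) (Ke' s0)).
assert (LP : filterlim (fun p : R * R => (X (fst p) (snd p), snd p)) Q
   (within (fun p => cls a b (fst p) (snd p)) (locally (c s0, s0)))).
{ intros P HP. unfold within in HP. apply locally_box in HP. destruct HP as [d [Hd HP]].
  assert (L1 := proj1 (flim_eps (F := locally (0, s0)) _ _) LX d Hd).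
  assert (L2 := proj1 (flim_eps (F := locally (0, s0)) _ _) (continuous_snd2 0 s0) d Hd).
  unfold filtermap, Q, within. generalize (filter_and _ _ L1 L2). apply filter_imp.
  intros [t s] [B1 B2] Ht; simpl in *. apply (HP _ _ B1 B2).
  assert (Hts := Ho t s Ht). unfold opn, cls, X in *; simpl; lra. }
assert (LD : filterlim (fun p : R * R => D (fst p) (snd p)) Q (locally L)).
{ apply flim_plus.
  - apply flim_mult.
    + exact (filterlim_comp _ _ _ _ (uncurry G1) _ _ _ LP (KG1 _ _ (Hc s0))).
    + now apply flim_within.
  - exact (filterlim_comp _ _ _ _ (uncurry G2) _ _ _ LP (KG2 _ _ (Hc s0))). }
(* The mean value theorem is applied on the interior curves, with an error uniform in [t]. Letting
   [t] tend to 0 transfers the estimate to the limiting curve, near which [phi] is differentiable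
   from one side at most. *)
assert (key : forall eps, 0 < eps -> exists d, 0 < d /\ forall s, Rabs (s - s0) < d ->
  Rabs (phi (c s) s - phi (c s0) s0 - L * (s - s0)) <= eps * Rabs (s - s0)).
{ intros eps He. assert (E := proj1 (flim_eps (F := Q) _ _) LD eps He).
  unfold Q, within in E. apply locally_box in E. destruct E as [d [Hd E]].
  exists d. split; [exact Hd |]. intros s Hs.
  assert (Ht : at_right 0 (fun t => Rabs (phi (X t s) s - phi (X t s0) s0 - L * (s - s0))
     <= eps * Rabs (s - s0))).
  { exists (mkposreal (Rmin d 1) (Rmin_glb_lt _ _ _ Hd Rlt_0_1)). intros t Ht Ht0.
    change (Rabs (t - 0) < Rmin d 1) in Ht.
    assert (T1 : Rabs (t - 0) < d) by (eapply Rlt_le_trans; [exact Ht | apply Rmin_l]).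
    assert (T2 : Rabs (t - 0) < 1) by (eapply Rlt_le_trans; [exact Ht | apply Rmin_r]).
    apply Rabs_def2 in T2. assert (T3 : 0 < t < 1) by lra.
    destruct (MVT_gen (fun s => phi (X t s) s) s0 s (D t)) as [z [Hz Ez]].
    - intros y Hy. now apply Dphi.
    - intros y Hy. apply continuity_pt_filterlim.
      exact (continuous_of_is_derive _ _ _ (Dphi t y T3)).
    - rewrite Ez. replace (D t z * (s - s0) - L * (s - s0)) with ((D t z - L) * (s - s0)) by ring.
      rewrite Rabs_mult. apply Rmult_le_compat_r; [apply Rabs_pos |]. left.
      apply (E t z T1); [| exact T3]. eapply Rle_lt_trans; [| exact Hs].
      revert Hz. unfold Rmin, Rmax; destruct Rle_dec; intros Hz.
      + rewrite !Rabs_pos_eq; lra.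
      + rewrite !Rabs_left1; lra. }
  apply (flim_le (F := at_right 0)
    (fun t => Rabs (phi (X t s) s - phi (X t s0) s0 - L * (s - s0)))
    (fun _ => eps * Rabs (s - s0))).
  - exact Ht.
  - apply flim_comp; [apply (continuous_Rabs) |].
    apply flim_minus; [apply flim_minus; apply Kphi | apply filterlim_const].
  - apply filterlim_const. }
apply is_derive_Reals. intros eps He.
destruct (key (eps / 2) ltac:(lra)) as [d [Hd K]].
exists (mkposreal d Hd). intros h Hh Hhd. simpl in Hhd.
specialize (K (s0 + h)). replace (s0 + h - s0) with h in K by ring. specialize (K Hhd).
assert (Hh0 : 0 < Rabs h) by (now apply Rabs_pos_lt).
replace ((phi (c (s0 + h)) (s0 + h) - phi (c s0) s0) / h - L) with
  ((phi (c (s0 + h)) (s0 + h) - phi (c s0) s0 - L * h) / h) by (field; exact Hh).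
unfold Rdiv. rewrite Rabs_mult, Rabs_inv.
apply Rmult_lt_reg_r with (Rabs h); [exact Hh0 |].
rewrite Rmult_assoc, Rinv_l, Rmult_1_r by lra. nra.
Qed.

(** * Gas dynamics *)

Lemma taylor2 (h h1 h2 : R -> R) (x y : R) :
  (forall z, Rmin x y <= z <= Rmax x y -> is_derive h z (h1 z) /\ is_derive h1 z (h2 z)) ->
  exists z, Rmin x y <= z <= Rmax x y /\
    h y = h x + h1 x * (y - x) + h2 z / 2 * (y - x) ^ 2.
Proof.
intros H.
destruct (Req_dec x y) as [-> | Hne].
{ exists y. rewrite Rmin_left, Rmax_left by lra. split; [lra | ring]. }
set (K := (h y - h x - h1 x * (y - x)) / (y - x) ^ 2).
(* [K] is chosen so that [g] vanishes at both [x] and [y]; Rolle's theorem then gives the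
   intermediate point. *)
set (g := fun t => h y - h t - h1 t * (y - t) - K * (y - t) ^ 2).
set (g' := fun t => - (h2 t * (y - t)) + 2 * K * (y - t)).
assert (Hg : forall t, Rmin x y <= t <= Rmax x y -> derivable_pt_lim g t (g' t)).
{ intros t Ht. destruct (H t Ht) as [D1 D2]. apply is_derive_Reals.
  unfold g, g'. auto_derive.
  - repeat split; [now exists (h1 t) | now exists (h2 t)].
  - replace (Derive (fun x0 => h x0) t) with (h1 t)
      by (symmetry; now apply is_derive_unique).
    replace (Derive (fun x0 => h1 x0) t) with (h2 t)
      by (symmetry; now apply is_derive_unique).
    ring. }
assert (Gx : g x = 0) by (unfold g, K; field; lra).
assert (Gy : g y = 0) by (unfold g; ring).
assert (E : exists c, Rmin x y <= c <= Rmax x y /\ c <> y /\ g' c = 0).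
{ destruct (Rlt_dec x y) as [L | L].
  - rewrite Rmin_left, Rmax_right in Hg by lra.
    destruct (MVT_cor2 g g' x y L Hg) as [c [E Hc]].
    exists c. rewrite Rmin_left, Rmax_right by lra.
    split; [lra | split; [lra |]]. rewrite Gx, Gy in E.
    apply Rmult_eq_reg_r with (y - x); lra.
  - rewrite Rmin_right, Rmax_left in Hg by lra.
    destruct (MVT_cor2 g g' y x ltac:(lra) Hg) as [c [E Hc]].
    exists c. rewrite Rmin_right, Rmax_left by lra.
    split; [lra | split; [lra |]]. rewrite Gx, Gy in E.
    apply Rmult_eq_reg_r with (x - y); lra. }
destruct E as [c [Hc [Hcy Ec]]]. exists c. split; [exact Hc |].
assert (EK : K = h2 c / 2).
{ unfold g' in Ec. apply Rmult_eq_reg_r with (2 * (y - c)); [field_simplify; lra | lra]. }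
rewrite <- EK. unfold K. field. lra.
Qed.

Lemma locally_box4 (P : R * (R * (R * R)) -> Prop) (x y z t : R) :
  locally (x, (y, (z, t))) P ->
  exists d, 0 < d /\ forall x' y' z' t', Rabs (x' - x) < d -> Rabs (y' - y) < d ->
    Rabs (z' - z) < d -> Rabs (t' - t) < d -> P (x', (y', (z', t'))).
Proof.
intros [d Hd]. exists d. split; [apply cond_pos |].
intros x' y' z' t' H1 H2 H3 H4. apply Hd. now repeat split.
Qed.

Lemma locally_bounded (h : R -> R) (x : R) : continuous h x ->
  exists e M, 0 < e /\ forall y, Rabs (y - x) < e -> Rabs (h y) <= M.
Proof.
intros H. destruct (proj1 (flim_eps (F := locally x) h (h x)) H 1 Rlt_0_1) as [e He].
exists e, (Rabs (h x) + 1). split; [apply cond_pos |]. intros y Hy.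
assert (H1 := He y Hy). simpl in H1.
replace (h y) with ((h y - h x) + h x) by ring.
eapply Rle_trans; [apply Rabs_triang | lra].
Qed.

Section Gas.

Variables gam c0 : R.
Hypothesis Hgam : 1 < gam.
Hypothesis Hc0 : 0 < c0.

(* [c2 s], [rs s], [Pi s]: squared sound speed, density and pressure as
   functions of the squared speed [s]; [Pi' = - rs / 2] by Bernoulli. *)
Definition c2 (s : R) : R := c0 ^ 2 - (gam - 1) / 2 * s.
Definition rs (s : R) : R := Rpower (/ gam * c2 s) (/ (gam - 1)).
Definition Pi (s : R) : R := rs s * c2 s / gam.

Definition sstar : R := 2 * c0 ^ 2 / (gam + 1).
Definition smax : R := 2 * c0 ^ 2 / (gam - 1).

Lemma sstar_pos : 0 < sstar.
Proof. unfold sstar. apply Rdiv_lt_0_compat; nra. Qed.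

Lemma sstar_lt_smax : sstar < smax.
Proof.
unfold sstar, smax, Rdiv. apply Rmult_lt_compat_l; [nra |].
apply Rinv_lt_contravar; nra.
Qed.

Lemma cstar_pos : 0 < cstar gam c0.
Proof. apply sqrt_lt_R0, sstar_pos. Qed.

Lemma cstar_lt_qmax : cstar gam c0 < qmax gam c0.
Proof. apply sqrt_lt_1_alt. split; [left; apply sstar_pos | apply sstar_lt_smax]. Qed.

Lemma cstar_sq : cstar gam c0 ^ 2 = sstar.
Proof. apply pow2_sqrt. left; apply sstar_pos. Qed.

Lemma qmax_sq : qmax gam c0 ^ 2 = smax.
Proof. apply pow2_sqrt. pose proof sstar_pos; pose proof sstar_lt_smax; unfold smax in *; lra. Qed.

Lemma c2_pos (s : R) : s < smax -> 0 < c2 s.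
Proof.
intros H. unfold smax in H. unfold c2.
apply Rmult_lt_compat_r with (r := gam - 1) in H; [| lra].
unfold Rdiv in H. rewrite Rmult_assoc, Rinv_l in H by lra. lra.
Qed.

Lemma c2_smax : c2 smax = 0.
Proof. unfold c2, smax. field. lra. Qed.

Lemma c2_sstar : c2 sstar = sstar.
Proof. unfold c2, sstar. field. lra. Qed.

(** [c2] is decreasing and [sstar] is its fixed point, so being below the critical speed is the same
    as having Mach number less than 1. *)
Lemma sub_c2 (s : R) : s < sstar -> s < c2 s.
Proof. intros H. pose proof c2_sstar as E. unfold c2 in *. nra. Qed.

Lemma super_c2 (s : R) : sstar < s -> c2 s < s.
Proof. intros H. pose proof c2_sstar as E. unfold c2 in *. nra. Qed.

Lemma c2_anti (s t : R) : s < t -> c2 t < c2 s.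
Proof. intros H. unfold c2. nra. Qed.

Lemma rs_pos (s : R) : 0 < rs s.
Proof. apply exp_pos. Qed.

Lemma rs_derive (s : R) : 0 < c2 s -> is_derive rs s (- rs s / (2 * c2 s)).
Proof.
intros H. unfold rs, Rpower.
assert (H2 : 0 < / gam * c2 s) by (apply Rmult_lt_0_compat; [apply Rinv_0_lt_compat; lra | exact H]).
unfold c2 in *. auto_derive; [exact H2 |].
change (c0 * (c0 * 1) + - ((gam - 1) / 2 * s)) with (c0 ^ 2 - (gam - 1) / 2 * s).
field. repeat split; lra.
Qed.

Lemma Derive_rs (s : R) : 0 < c2 s -> ex_derive rs s /\ Derive rs s = - rs s / (2 * c2 s).
Proof.
intros H. assert (D := rs_derive s H). split; [now exists (- rs s / (2 * c2 s)) |].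
now apply is_derive_unique.
Qed.

Lemma Pi_derive (s : R) : 0 < c2 s -> is_derive Pi s (- rs s / 2).
Proof.
intros H. unfold Pi. destruct (Derive_rs s H) as [D E].
unfold c2 in *. auto_derive; [exact D |].
change (Derive (fun x => rs x) s) with (Derive rs s). rewrite E. field. repeat split; lra.
Qed.

Lemma continuous_c2 (s : R) : continuous c2 s.
Proof. apply (ex_derive_continuous (V := R_NormedModule)). unfold c2. auto_derive. exact I. Qed.

Lemma continuous_rs (s : R) : 0 < c2 s -> continuous rs s.
Proof. intros H. exact (continuous_of_is_derive _ _ _ (rs_derive s H)). Qed.

(** * Mass flux as a function of the speed *)

Lemma flux_derive (q : R) : 0 < c2 (q ^ 2) ->
  is_derive (fun q => rs (q ^ 2) * q) q (rs (q ^ 2) * (1 - q ^ 2 / c2 (q ^ 2))).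
Proof.
intros H. destruct (Derive_rs _ H) as [D E]. auto_derive; [exact D |].
change (Derive (fun x => rs x)) with (Derive rs). change (q * (q * 1)) with (q ^ 2). rewrite E. field. lra.
Qed.

Lemma flux_incr (a b : R) : 0 <= a < b -> b ^ 2 <= sstar -> rs (a ^ 2) * a < rs (b ^ 2) * b.
Proof.
intros Hab Hb. pose proof sstar_lt_smax.
destruct (MVT_cor2 (fun q => rs (q ^ 2) * q)
  (fun q => rs (q ^ 2) * (1 - q ^ 2 / c2 (q ^ 2))) a b) as [c [E Hc]]; [lra | |].
- intros c Hc. apply is_derive_Reals, flux_derive, c2_pos. nra.
- assert (Hcs : c ^ 2 < sstar) by nra.
  assert (H1 := sub_c2 _ Hcs). assert (H2 := rs_pos (c ^ 2)).
  assert (H3 : 0 < c2 (c ^ 2)) by (apply c2_pos; lra).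
  assert (H4 : c ^ 2 / c2 (c ^ 2) < 1).
  { apply Rmult_lt_reg_r with (c2 (c ^ 2)); [exact H3 |]. field_simplify; lra. }
  assert (H5 : 0 < rs (c ^ 2) * (1 - c ^ 2 / c2 (c ^ 2)) * (b - a)).
  { repeat apply Rmult_lt_0_compat; lra. }
  lra.
Qed.

Lemma flux_decr (a b : R) : 0 <= a < b -> sstar <= a ^ 2 -> b ^ 2 < smax ->
  rs (b ^ 2) * b < rs (a ^ 2) * a.
Proof.
intros Hab Ha Hb.
destruct (MVT_cor2 (fun q => rs (q ^ 2) * q)
  (fun q => rs (q ^ 2) * (1 - q ^ 2 / c2 (q ^ 2))) a b) as [c [E Hc]]; [lra | |].
- intros c Hc. apply is_derive_Reals, flux_derive, c2_pos. nra.
- assert (Hcs : sstar < c ^ 2) by nra.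
  assert (H1 := super_c2 _ Hcs). assert (H2 := rs_pos (c ^ 2)).
  assert (H3 : 0 < c2 (c ^ 2)) by (apply c2_pos; nra).
  assert (H4 : 1 < c ^ 2 / c2 (c ^ 2)).
  { apply Rmult_lt_reg_r with (c2 (c ^ 2)); [exact H3 |]. field_simplify; lra. }
  assert (H5 : 0 < rs (c ^ 2) * (c ^ 2 / c2 (c ^ 2) - 1) * (b - a)).
  { repeat apply Rmult_lt_0_compat; lra. }
  lra.
Qed.

(* With slope [k] of the shock, [u / sqrt (1 + k^2)] is the normal velocity
   ahead of it: the flux condition forces it to be supersonic. *)
Lemma normal_supersonic (u ap bp k : R) :
  0 < u -> sstar < u ^ 2 < smax ->
  ap ^ 2 + bp ^ 2 <= sstar ->
  u * k = ap * k + bp ->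
  rs (u ^ 2) * u = rs (ap ^ 2 + bp ^ 2) * (ap - k * bp) ->
  (1 + k ^ 2) * c2 (u ^ 2) < u ^ 2.
Proof.
intros Hu Hs Hp Ht Hf.
destruct (Rlt_le_dec ((1 + k ^ 2) * c2 (u ^ 2)) (u ^ 2)) as [? | Hle]; [assumption | exfalso].
set (v := ap - k * bp) in *.
assert (E1 : (1 + k ^ 2) * (ap ^ 2 + bp ^ 2) = v ^ 2 + (u * k) ^ 2)
  by (rewrite Ht; unfold v; ring).
assert (Rp := rs_pos (ap ^ 2 + bp ^ 2)). assert (Ru := rs_pos (u ^ 2)).
assert (Hv : 0 < v).
{ apply Rmult_lt_reg_l with (rs (ap ^ 2 + bp ^ 2)); [exact Rp |].
  rewrite <- Hf, Rmult_0_r. now apply Rmult_lt_0_compat. }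
assert (Hvu : v < u) by nra.
set (N := 1 + k ^ 2) in *.
assert (HN : 1 <= N) by (unfold N; nra).
(* [v] and [u] are the normal velocities behind and ahead of the shock, both scaled by [sqrt N]; the
   tangential part [u * k] is common to them. [g q] is the mass flux at scaled normal velocity [q]
   and [st q] the squared speed. Were the normal velocity ahead not supersonic, [g] would increase
   strictly from [v] to [u], against the equality of the fluxes. *)
set (g := fun q => rs ((q ^ 2 + (u * k) ^ 2) / N) * q).
set (st := fun q => (q ^ 2 + (u * k) ^ 2) / N).
assert (stu : st u = u ^ 2) by (unfold st, N; field; nra).
assert (stmono : forall q, 0 < q < u -> st q < u ^ 2).
{ intros q Hq. rewrite <- stu. unfold st, Rdiv. apply Rmult_lt_compat_r; [| nra].
  apply Rinv_0_lt_compat. lra. }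
destruct (MVT_cor2 g (fun q => rs (st q) * (1 - q ^ 2 / (N * c2 (st q)))) v u Hvu)
  as [c [E Hc]].
- intros c Hc. apply is_derive_Reals.
  assert (Hst : st c < smax).
  { destruct (Req_dec c u) as [-> | Hne]; [lra |].
    assert (st c < u ^ 2) by (apply stmono; lra). lra. }
  assert (H := c2_pos _ Hst). destruct (Derive_rs _ H) as [D ED].
  unfold g. change (is_derive (fun q => rs ((q ^ 2 + (u * k) ^ 2) / N) * q) c
    (rs (st c) * (1 - c ^ 2 / (N * c2 (st c))))).
  auto_derive.
  + replace ((c * (c * 1) + u * k * (u * k * 1)) * / N) with (st c) by (unfold st; field; lra).
    exact D.
  + replace ((c * (c * 1) + u * k * (u * k * 1)) * / N) with (st c) by (unfold st; field; lra).
    change (Derive (fun x => rs x)) with (Derive rs). rewrite ED. field. lra.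
- assert (Hst : st c < u ^ 2) by (apply stmono; lra).
  assert (H1 := c2_anti _ _ Hst). assert (H2 := rs_pos (st c)).
  assert (H0 : 0 < c2 (u ^ 2)) by (apply c2_pos; lra).
  assert (H3 : c ^ 2 < N * c2 (st c)) by nra.
  assert (H4 : c ^ 2 / (N * c2 (st c)) < 1).
  { apply Rmult_lt_reg_r with (N * c2 (st c)); [nra |]. field_simplify; [lra | nra]. }
  assert (H5 : 0 < rs (st c) * (1 - c ^ 2 / (N * c2 (st c))) * (u - v)).
  { repeat apply Rmult_lt_0_compat; lra. }
  assert (Gv : g v = rs (ap ^ 2 + bp ^ 2) * v).
  { unfold g. rewrite <- E1. do 2 f_equal. field. lra. }
  assert (Gu : g u = rs (u ^ 2) * u).
  { unfold g. change (rs (st u) * u = rs (u ^ 2) * u). now rewrite stu. }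
  rewrite Gv, Gu in E. lra.
Qed.

(** [d] is the product of the flux difference with the velocity difference. With [P] the length of
    (p1, p2), it splits into a radial part, nonnegative because the flux increases with the speed in
    the subsonic range, and a positive multiple of the Cauchy-Schwarz defect [P - p1]. *)
Lemma flux_monotone (p1 p2 q : R) :
  p1 ^ 2 + p2 ^ 2 <= sstar -> 0 < q -> q ^ 2 <= sstar ->
  let d := (rs (p1 ^ 2 + p2 ^ 2) * p1 - rs (q ^ 2) * q) * (p1 - q)
           + rs (p1 ^ 2 + p2 ^ 2) * p2 ^ 2 in
  0 <= d /\ (d = 0 -> p1 = q /\ p2 = 0).
Proof.
intros Hp Hq Hqs d.
set (P := sqrt (p1 ^ 2 + p2 ^ 2)).
assert (HP : 0 <= P) by apply sqrt_pos.
assert (HP2 : P ^ 2 = p1 ^ 2 + p2 ^ 2) by (apply pow2_sqrt; nra).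
assert (HpP : p1 <= P) by nra.
assert (Rp := rs_pos (P ^ 2)). assert (Rq := rs_pos (q ^ 2)).
assert (E : d = (rs (P ^ 2) * P - rs (q ^ 2) * q) * (P - q)
              + (rs (P ^ 2) + rs (q ^ 2)) * (q * (P - p1))).
{ unfold d. rewrite <- HP2.
  replace (p2 ^ 2) with (P ^ 2 - p1 ^ 2) by lra. ring. }
rewrite <- HP2 in Hp.
assert (M : P <> q -> 0 < (rs (P ^ 2) * P - rs (q ^ 2) * q) * (P - q)).
{ intros Hne. destruct (Rlt_le_dec P q) as [L | L].
  - assert (rs (P ^ 2) * P < rs (q ^ 2) * q) by (apply flux_incr; lra). nra.
  - assert (rs (q ^ 2) * q < rs (P ^ 2) * P) by (apply flux_incr; lra).
    apply Rmult_lt_0_compat; lra. }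
assert (M2 : 0 <= (rs (P ^ 2) + rs (q ^ 2)) * (q * (P - p1))).
{ apply Rmult_le_pos; [lra |]. apply Rmult_le_pos; lra. }
destruct (Req_dec P q) as [EPq | Hne].
- rewrite EPq in E, M2.
  split; [rewrite E; lra |].
  intros D0. rewrite D0 in E.
  assert (Z : (rs (q ^ 2) + rs (q ^ 2)) * (q * (q - p1)) = 0) by lra.
  apply Rmult_integral in Z. destruct Z as [Z | Z]; [lra |].
  apply Rmult_integral in Z. destruct Z as [Z | Z]; [lra |].
  assert (E1 : p1 = q) by lra. split; [exact E1 |].
  rewrite E1, EPq in HP2. nra.
- specialize (M Hne). split; [lra | intros; lra].
Qed.

(** * Second-order expansion about an axial supersonic state *)

Definition Pi2 (s : R) : R := rs s / (4 * c2 s).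

Lemma Pi1_derive (s : R) : 0 < c2 s -> is_derive (fun s => - rs s / 2) s (Pi2 s).
Proof.
intros H. destruct (Derive_rs s H) as [D E]. auto_derive; [exact D |].
change (Derive (fun x => rs x) s) with (Derive rs s). rewrite E. unfold Pi2. field. lra.
Qed.

Lemma Pi_taylor (x y : R) : x < smax -> y < smax ->
  exists z, Rmin x y <= z <= Rmax x y /\
    Pi y = Pi x - rs x / 2 * (y - x) + Pi2 z / 2 * (y - x) ^ 2.
Proof.
intros Hx Hy.
destruct (taylor2 Pi (fun s => - rs s / 2) Pi2 x y) as [z [Hz E]].
- intros z Hz. assert (Hz' : z < smax) by (unfold Rmax in Hz; destruct Rle_dec; lra).
  split; [now apply Pi_derive, c2_pos | now apply Pi1_derive, c2_pos].
- exists z. split; [exact Hz | rewrite E; field].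
Qed.

(** As [Pi' = - rs / 2] and [Pi'' = Pi2], the first derivative of the density is [- 2 * Pi2] and
    [rs2] is the second. *)
Definition rs2 (s : R) : R := rs s * (2 - gam) / (4 * (c2 s * (c2 s * 1))).

Lemma Pi2_derive (s : R) : 0 < c2 s -> is_derive (fun s => - 2 * Pi2 s) s (rs2 s).
Proof.
intros H. destruct (Derive_rs s H) as [D E]. unfold Pi2, c2 in *. auto_derive.
- split; [exact D |].
  change (c0 * (c0 * 1) + - ((gam - 1) / 2 * s)) with (c0 ^ 2 - (gam - 1) / 2 * s).
  split; [lra | exact I].
- change (Derive (fun x => rs x) s) with (Derive rs s). rewrite E. unfold rs2, c2.
  change (c0 * (c0 * 1) + - ((gam - 1) / 2 * s)) with (c0 ^ 2 - (gam - 1) / 2 * s).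
  field. lra.
Qed.

Definition sq (u x1 x2 : R) : R := (u + x1) ^ 2 + x2 ^ 2.

(* Relative momentum flux of the velocity [(u + x1, x2)] with respect to [(u, 0)]. *)
Definition energy1 (u x1 x2 : R) : R :=
  Pi (u ^ 2) - Pi (sq u x1 x2) - rs (sq u x1 x2) * (u + x1) * x1.
Definition energy2 (u x1 x2 : R) : R := - (rs (sq u x1 x2) * x2 * x1).

(** Axial flows satisfy [u' = (n'/n) kappa u]. When [u] is such a flow, the coordinate divergence of
    [(n * energy1, energy2)] is [n' * esource]. *)
Definition kappa (u : R) : R := c2 (u ^ 2) * u / (u ^ 2 - c2 (u ^ 2)).
Definition esource (u x1 x2 : R) : R :=
  Pi (u ^ 2) - Pi (sq u x1 x2) - rs (sq u x1 x2) * x2 ^ 2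
  + kappa u * (rs (sq u x1 x2) * (u + x1) - rs (u ^ 2) * u).

(** * Local estimates of the energy and its source *)

Section Local.

Variable us : R.
Hypothesis Hus : 0 < us.
Hypothesis Hsup : sstar < us ^ 2 < smax.

(** All smallness conditions come from one neighbourhood filter in four variables: the axial speed,
    the two components of the perturbation, and the intermediate point of the Taylor expansion of
    [Pi]. *)
Let T4 : Type := (R * (R * (R * R)))%type.
Let pt : T4 := (us, (0, (0, us ^ 2))).
Let pu (p : T4) : R := fst p.
Let p1 (p : T4) : R := fst (snd p).
Let p2 (p : T4) : R := fst (snd (snd p)).
Let pz (p : T4) : R := snd (snd (snd p)).

Let Lu : filterlim pu (locally pt) (locally us).
Proof. apply continuous_fst. Qed.
Let L1 : filterlim p1 (locally pt) (locally 0).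
Proof.
apply (filterlim_comp _ _ _ snd fst _ (locally (0, (0, us ^ 2)))).
- apply continuous_snd.
- apply continuous_fst.
Qed.
Let Ls2 : filterlim (fun p : T4 => snd (snd p)) (locally pt) (locally (0, us ^ 2)).
Proof.
apply (filterlim_comp _ _ _ snd snd _ (locally (0, (0, us ^ 2)))); apply continuous_snd.
Qed.
Let L2 : filterlim p2 (locally pt) (locally 0).
Proof. apply (filterlim_comp _ _ _ _ fst _ _ _ Ls2). apply continuous_fst. Qed.
Let Lz : filterlim pz (locally pt) (locally (us ^ 2)).
Proof. apply (filterlim_comp _ _ _ _ snd _ _ _ Ls2). apply continuous_snd. Qed.

Let Lsq0 : filterlim (fun p => pu p ^ 2) (locally pt) (locally (us ^ 2)).
Proof.
apply (flim_comp (fun u => u ^ 2)); [apply continuous_sq | exact Lu].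
Qed.

Let Lsq : filterlim (fun p => sq (pu p) (p1 p) (p2 p)) (locally pt) (locally (us ^ 2)).
Proof.
replace (us ^ 2) with ((us + 0) ^ 2 + 0 ^ 2) by ring.
apply flim_plus.
- apply (flim_comp (fun u => u ^ 2)); [apply continuous_sq | now apply flim_plus].
- apply (flim_comp (fun u => u ^ 2)); [apply continuous_sq | exact L2].
Qed.

Lemma sq_near (eps : R) : 0 < eps -> exists d, 0 < d /\ forall u x1 x2,
  Rabs (u - us) < d -> Rabs x1 < d -> Rabs x2 < d ->
  Rabs (u ^ 2 - us ^ 2) < eps /\ Rabs (sq u x1 x2 - us ^ 2) < eps.
Proof.
intros He.
assert (A := filter_and _ _ (proj1 (flim_eps (F := locally pt) _ _) Lsq0 eps He)
  (proj1 (flim_eps (F := locally pt) _ _) Lsq eps He)).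
destruct (locally_box4 _ _ _ _ _ A) as [d [Hd B]].
exists d. split; [exact Hd |]. intros u x1 x2 Hu H1 H2.
apply (B u x1 x2 (us ^ 2)); rewrite ?Rminus_0_r; try assumption.
now rewrite Rminus_diag, Rabs_R0.
Qed.

Let Hc2 : 0 < c2 (us ^ 2).
Proof. apply c2_pos; lra. Qed.

(** To second order the flux is [rs / 2] times [x2^2 + 2 k x1 x2 + D x1^2], where [D] is the squared
    Mach number minus 1. The form is positive definite when [k^2 < D], and this is the hypothesis.
    The bound is uniform for states and slopes near [us] and [k]. *)
Lemma energy_pos (k : R) : (1 + k ^ 2) * c2 (us ^ 2) < us ^ 2 ->
  exists d, 0 < d /\ forall u x1 x2 k',
    Rabs (u - us) < d -> Rabs x1 < d -> Rabs x2 < d -> Rabs (k' - k) < d ->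
    d * (x1 ^ 2 + x2 ^ 2) <= energy1 u x1 x2 - k' * energy2 u x1 x2.
Proof.
intros Hk.
set (D := us ^ 2 / c2 (us ^ 2) - 1).
set (g := D - k ^ 2).
assert (Hg : 0 < g).
{ unfold g, D. apply Rmult_lt_reg_r with (c2 (us ^ 2)); [exact Hc2 |]. field_simplify; lra. }
assert (HD : 0 < D) by (unfold g in Hg; nra).
(* Each diagonal coefficient loses [eta] to the Taylor error and keeps another [eta] as coercivity.
   The bound 1/4 leaves [al = 1 - 2 eta] positive. The other bound costs [al * be] at most [g / 2]
   compared with [D], and the remaining [g / 2] absorbs the passage from [k] to [k']. *)
set (eta := Rmin (1 / 4) (g / (4 * (1 + D)))).
assert (Heta : 0 < eta) by (apply Rmin_glb_lt; [lra | apply Rdiv_lt_0_compat; lra]).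
assert (Heta4 : eta <= 1 / 4) by apply Rmin_l.
assert (HetaD : eta * (4 * (1 + D)) <= g).
{ apply Rle_trans with (g / (4 * (1 + D)) * (4 * (1 + D))).
  - apply Rmult_le_compat_r; [lra | apply Rmin_r].
  - right; field; lra. }
set (tau := fun p => Pi2 (pz p) * / rs (sq (pu p) (p1 p) (p2 p))).
set (A := fun p => 2 * pu p + p1 p).
assert (LA : filterlim A (locally pt) (locally (2 * us + 0))).
{ apply flim_plus; [apply flim_mult; [apply filterlim_const | exact Lu] | exact L1]. }
assert (LR : filterlim (fun p => rs (sq (pu p) (p1 p) (p2 p))) (locally pt) (locally (rs (us ^ 2)))).
{ apply flim_comp; [now apply continuous_rs | exact Lsq]. }
assert (R0 := rs_pos (us ^ 2)).
assert (Lt : filterlim tau (locally pt) (locally (Pi2 (us ^ 2) * / rs (us ^ 2)))).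
{ apply flim_mult; [| apply flim_inv; [lra | exact LR]].
  apply flim_comp; [| exact Lz].
  apply (flim_mult (F := locally (us ^ 2))); [now apply continuous_rs |].
  apply (flim_inv (F := locally (us ^ 2))); [lra |].
  apply (flim_mult (F := locally (us ^ 2))); [apply filterlim_const | apply continuous_c2]. }
assert (LtA : filterlim (fun p => tau p * (A p * A p)) (locally pt) (locally (1 + D))).
{ replace (1 + D) with (Pi2 (us ^ 2) * / rs (us ^ 2) * ((2 * us + 0) * (2 * us + 0)))
    by (unfold D, Pi2; field; lra).
  apply flim_mult; [exact Lt | now apply flim_mult]. }
assert (LtA1 : filterlim (fun p => 2 * tau p * (A p * p1 p)) (locally pt) (locally 0)).
{ replace 0 with (2 * (Pi2 (us ^ 2) * / rs (us ^ 2)) * ((2 * us + 0) * 0)) by ring.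
  apply flim_mult; [| now apply flim_mult].
  apply flim_mult; [apply filterlim_const | exact Lt]. }
assert (EV := filter_and _ _
  (filter_and _ _ (proj1 (flim_eps (F := locally pt) _ _) LtA eta Heta)
                  (proj1 (flim_eps (F := locally pt) _ _) LtA1 eta Heta))
  (proj1 (flim_eps (F := locally pt) _ _) LR (rs (us ^ 2) / 2) ltac:(lra))).
destruct (locally_box4 _ _ _ _ _ EV) as [d1 [Hd1 B1]].
set (d2 := Rmin d1 (smax - us ^ 2)).
assert (Hd2 : 0 < d2) by (apply Rmin_glb_lt; lra).
assert (Hd2a : d2 <= d1) by apply Rmin_l.
assert (Hd2b : d2 <= smax - us ^ 2) by apply Rmin_r.
destruct (sq_near d2 Hd2) as [d3 [Hd3 B3]].
assert (Lk := continuous_sq k).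
destruct (proj1 (flim_eps (F := locally k) _ _) Lk (g / 2) ltac:(lra)) as [d4 B4].
pose proof (cond_pos d4) as Hd4.
set (d := Rmin (Rmin d1 d3) (Rmin d4 (rs (us ^ 2) * eta / 4))).
assert (Hd : 0 < d).
{ repeat apply Rmin_glb_lt; try lra. apply Rdiv_lt_0_compat; [now apply Rmult_lt_0_compat | lra]. }
assert (Hda : d <= d1) by (eapply Rle_trans; apply Rmin_l).
assert (Hdb : d <= d3) by (eapply Rle_trans; [apply Rmin_l | apply Rmin_r]).
assert (Hdc : d <= d4) by (eapply Rle_trans; [apply Rmin_r | apply Rmin_l]).
assert (Hdd : d <= rs (us ^ 2) * eta / 4) by (eapply Rle_trans; [apply Rmin_r | apply Rmin_r]).
exists d. split; [exact Hd |]. intros u x1 x2 k' Hu H1 H2 Hk'.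
destruct (B3 u x1 x2) as [S1 S2]; try lra.
assert (Bk := B4 k' (Rlt_le_trans _ _ _ Hk' Hdc)).
apply Rabs_def2 in S1, S2, Bk.
destruct (Pi_taylor (sq u x1 x2) (u ^ 2)) as [z [Hz EP]]; try lra.
assert (Hzd : Rabs (z - us ^ 2) < d1).
{ apply Rabs_def1; unfold Rmin, Rmax in Hz; repeat destruct Rle_dec; lra. }
destruct (B1 u x1 x2 z) as [[C1 C2] C3]; rewrite ?Rminus_0_r; try lra.
unfold tau, A, pu, p1, p2, pz in C1, C2, C3; simpl fst in *; simpl snd in *.
set (r := rs (sq u x1 x2)) in *.
assert (Hr : 0 < r) by apply rs_pos.
set (t := Pi2 z * / r) in *.
set (a := 2 * u + x1) in *.
apply Rabs_def2 in C1, C2, C3.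
assert (Et : Pi2 z = t * r) by (unfold t; field; lra).
assert (Ht : 0 < t).
{ unfold t, Pi2. apply Rmult_lt_0_compat; [| now apply Rinv_0_lt_compat].
  apply Rdiv_lt_0_compat; [apply rs_pos |]. apply Rmult_lt_0_compat; [lra |].
  apply c2_pos. unfold Rmax in Hz; destruct Rle_dec; lra. }
assert (EE : energy1 u x1 x2 - k' * energy2 u x1 x2
  = r / 2 * (x2 ^ 2 - x1 ^ 2 + 2 * k' * x1 * x2 + t * (a * x1 + x2 ^ 2) ^ 2)).
{ unfold energy1, energy2. fold r. rewrite EP, Et. unfold a, sq. field. }
rewrite EE.
assert (G1 : (1 + D - eta) * x1 ^ 2 - eta * x2 ^ 2 <= t * (a * x1 + x2 ^ 2) ^ 2).
{ replace (t * (a * x1 + x2 ^ 2) ^ 2) with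
    (t * (a * a) * x1 ^ 2 + 2 * t * (a * x1) * x2 ^ 2 + t * (x2 ^ 2) ^ 2) by ring.
  assert (0 <= t * (x2 ^ 2) ^ 2) by (apply Rmult_le_pos; [lra | apply pow2_ge_0]).
  assert (P1 := pow2_ge_0 x1). assert (P2 := pow2_ge_0 x2).
  assert ((1 + D - eta) * x1 ^ 2 <= t * (a * a) * x1 ^ 2) by (apply Rmult_le_compat_r; lra).
  assert (- eta * x2 ^ 2 <= 2 * t * (a * x1) * x2 ^ 2) by (apply Rmult_le_compat_r; lra).
  lra. }
set (al := 1 - 2 * eta). set (be := D - 2 * eta).
assert (Hal : 0 < al) by (unfold al; lra).
assert (Hab : k' ^ 2 <= al * be).
{ unfold al, be. unfold g in *. nra. }
assert (G2 : 0 <= al * x2 ^ 2 + 2 * k' * x1 * x2 + be * x1 ^ 2).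
{ apply Rmult_le_reg_l with al; [exact Hal |]. rewrite Rmult_0_r.
  replace (al * (al * x2 ^ 2 + 2 * k' * x1 * x2 + be * x1 ^ 2)) with
    ((al * x2 + k' * x1) ^ 2 + (al * be - k' ^ 2) * x1 ^ 2) by ring.
  assert (P1 := pow2_ge_0 x1). assert (P2 := pow2_ge_0 (al * x2 + k' * x1)).
  assert (0 <= (al * be - k' ^ 2) * x1 ^ 2) by (apply Rmult_le_pos; lra). lra. }
assert (G3 : eta * (x1 ^ 2 + x2 ^ 2)
   <= x2 ^ 2 - x1 ^ 2 + 2 * k' * x1 * x2 + t * (a * x1 + x2 ^ 2) ^ 2).
{ unfold al, be in G2. lra. }
assert (N0 : 0 <= x1 ^ 2 + x2 ^ 2) by nra.
apply Rle_trans with (r / 2 * (eta * (x1 ^ 2 + x2 ^ 2))).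
- rewrite <- Rmult_assoc. apply Rmult_le_compat_r; [exact N0 |]. nra.
- apply Rmult_le_compat_l; lra.
Qed.

(** The linear part in [x1] has coefficient [rs u + kappa u * (rs - 4 Pi2 u^2)]. Its bracket is the
    derivative of the mass flux, and [kappa] is its exact compensator, so the coefficient is zero
    ([Ek]). The rest is quadratic, with coefficients bounded near [us]. *)
Lemma esource_bound : exists d C, 0 < d /\ 0 <= C /\ forall u x1 x2,
  Rabs (u - us) < d -> Rabs x1 < d -> Rabs x2 < d ->
  Rabs (esource u x1 x2) <= C * (x1 ^ 2 + x2 ^ 2).
Proof.
assert (Krs := continuous_rs _ Hc2).
assert (Kc2 := continuous_c2 (us ^ 2)).
assert (KPi2 : continuous Pi2 (us ^ 2)).
{ apply (flim_mult (F := locally (us ^ 2))); [exact Krs |].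
  apply (flim_inv (F := locally (us ^ 2))); [lra |].
  apply (flim_mult (F := locally (us ^ 2))); [apply filterlim_const | exact Kc2]. }
assert (Krs2 : continuous rs2 (us ^ 2)).
{ apply (flim_mult (F := locally (us ^ 2))).
  - apply (flim_mult (F := locally (us ^ 2))); [exact Krs | apply filterlim_const].
  - apply (flim_inv (F := locally (us ^ 2))); [nra |].
    apply (flim_mult (F := locally (us ^ 2))); [apply filterlim_const |].
    apply (flim_mult (F := locally (us ^ 2))); [exact Kc2 |].
    apply (flim_mult (F := locally (us ^ 2))); [exact Kc2 | apply filterlim_const]. }
assert (Kkappa : continuous kappa us).
{ assert (Ksq := continuous_sq us).
  assert (Kc : continuous (fun u => c2 (u ^ 2)) us).
  { now apply (flim_comp (F := locally us) c2). }
  assert (Hsc := super_c2 _ (proj1 Hsup)).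
  apply (flim_mult (F := locally us)).
  - apply (flim_mult (F := locally us)); [exact Kc | apply filterlim_id].
  - apply (flim_inv (F := locally us)); [lra |].
    now apply (flim_minus (F := locally us)). }
destruct (locally_bounded _ _ Krs) as (e1 & M1 & He1 & B1).
destruct (locally_bounded _ _ KPi2) as (e2 & M2 & He2 & B2).
destruct (locally_bounded _ _ Krs2) as (e3 & M3 & He3 & B3).
destruct (locally_bounded _ _ Kkappa) as (e4 & M4 & He4 & B4).
set (e := Rmin (Rmin e1 e2) (Rmin e3 (Rmin (smax - us ^ 2) (us ^ 2 - sstar)))).
assert (He : 0 < e) by (repeat apply Rmin_glb_lt; lra).
assert (Hea : e <= e1) by (eapply Rle_trans; apply Rmin_l).
assert (Heb : e <= e2) by (eapply Rle_trans; [apply Rmin_l | apply Rmin_r]).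
assert (Hec : e <= e3) by (eapply Rle_trans; [apply Rmin_r | apply Rmin_l]).
assert (He5 : e <= Rmin (smax - us ^ 2) (us ^ 2 - sstar))
  by (eapply Rle_trans; [apply Rmin_r | apply Rmin_r]).
assert (Hed : e <= smax - us ^ 2) by (eapply Rle_trans; [exact He5 | apply Rmin_l]).
assert (Hee : e <= us ^ 2 - sstar) by (eapply Rle_trans; [exact He5 | apply Rmin_r]).
destruct (sq_near e He) as [d3 [Hd3 N3]].
set (d := Rmin d3 (Rmin e4 1)).
assert (Hd : 0 < d) by (repeat apply Rmin_glb_lt; lra).
assert (Hda : d <= d3) by apply Rmin_l.
assert (Hdb : d <= e4) by (eapply Rle_trans; [apply Rmin_r | apply Rmin_l]).
assert (Hdc : d <= 1) by (eapply Rle_trans; [apply Rmin_r | apply Rmin_r]).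
(* Besides the four functions, [K] bounds [u] and [sg], thanks to the summand [2 * us + 4]; as it is
   at least 4, lower powers of [K] are absorbed by [K ^ 3]. *)
set (K := Rabs M1 + Rabs M2 + Rabs M3 + Rabs M4 + 2 * us + 4).
assert (HK : M1 <= K /\ M2 <= K /\ M3 <= K /\ M4 <= K /\ 2 * us + 4 <= K).
{ unfold K. pose proof (Rabs_pos M1); pose proof (Rabs_pos M2); pose proof (Rabs_pos M3);
  pose proof (Rabs_pos M4); pose proof (Rle_abs M1); pose proof (Rle_abs M2);
  pose proof (Rle_abs M3); pose proof (Rle_abs M4); lra. }
destruct HK as (HK1 & HK2 & HK3 & HK4 & HK5).
assert (K0 : 4 <= K) by lra.
assert (K2 : 4 * K <= K ^ 2) by (clear - K0; nra).
assert (K3 : 4 * K ^ 2 <= K ^ 3) by (clear - K0; nra).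
(* Comes from [sg^2 <= 8 u^2 x1^2 + 2 N^2] together with [N <= 2]. *)
set (S := 8 * K ^ 2 + 5).
assert (HS : 1 <= S) by (unfold S; lra).
exists d, (4 * K ^ 3 + 4 * K ^ 3 * S + 4 * K ^ 3 * S + K).
split; [exact Hd | split; [clear - K0 K2 K3 HS; nra |]].
intros u x1 x2 Hu H1 H2.
destruct (N3 u x1 x2) as [S1 S2]; try lra.
assert (Bk := B4 u ltac:(lra)).
assert (near : forall z, Rmin (u ^ 2) (sq u x1 x2) <= z <= Rmax (u ^ 2) (sq u x1 x2) ->
  Rabs (z - us ^ 2) < e /\ z < smax).
{ intros z Hz. apply Rabs_def2 in S1, S2.
  split; [apply Rabs_def1 |]; unfold Rmin, Rmax in Hz; repeat destruct Rle_dec; lra. }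
destruct (Pi_taylor (sq u x1 x2) (u ^ 2)) as [z [Hz EP]];
  try (apply Rabs_def2 in S1, S2; lra).
rewrite Rmin_comm, Rmax_comm in Hz. destruct (near z Hz) as [Nz Mz].
destruct (taylor2 rs (fun s => - 2 * Pi2 s) rs2 (u ^ 2) (sq u x1 x2)) as [z2 [Hz2 ER]].
{ intros y Hy. destruct (near y Hy) as [_ My].
  split; [| now apply Pi2_derive, c2_pos].
  replace (- 2 * Pi2 y) with (- rs y / (2 * c2 y)).
  - now apply rs_derive, c2_pos.
  - unfold Pi2. field. assert (0 < c2 y) by (now apply c2_pos). lra. }
destruct (near z2 Hz2) as [Nz2 _].
assert (X1 := B1 (u ^ 2) ltac:(lra)). assert (X2 := B1 (sq u x1 x2) ltac:(lra)).
assert (X3 := B2 (u ^ 2) ltac:(lra)). assert (X4 := B2 z ltac:(lra)).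
assert (X5 := B3 z2 ltac:(lra)).
assert (Cq : 0 < c2 (u ^ 2)) by (apply c2_pos; apply Rabs_def2 in S1; lra).
assert (Uq : c2 (u ^ 2) < u ^ 2) by (apply super_c2; apply Rabs_def2 in S1; lra).
set (N := x1 ^ 2 + x2 ^ 2).
set (sg := 2 * u * x1 + N).
assert (Hsg : sq u x1 x2 - u ^ 2 = sg) by (unfold sg, N, sq; ring).
assert (Hsg' : u ^ 2 - sq u x1 x2 = - sg) by (unfold sg, N, sq; ring).
rewrite Hsg in ER. rewrite Hsg' in EP.
apply Rabs_def2 in H1, H2, Hu.
assert (HN : 0 <= N <= 2) by (unfold N; clear - H1 H2 Hdc; split; nra).
assert (HuK : Rabs u <= K) by (apply Rabs_le; lra).
assert (HsK : Rabs sg <= K).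
{ apply Rabs_le. unfold sg, K in *. assert (- (2 * us + 2) <= 2 * u * x1 <= 2 * us + 2)
    by (clear - Hus H1 Hu Hdc; nra).
  pose proof (Rabs_pos M1); pose proof (Rabs_pos M2); pose proof (Rabs_pos M3);
  pose proof (Rabs_pos M4). lra. }
set (A1 := rs (u ^ 2) * (/ 2) + - (2 * (kappa u * (Pi2 (u ^ 2) * u)))).
set (A2 := - Pi2 (u ^ 2) + rs2 z2 * sg * (/ 4) + Pi2 z * (/ 2) + kappa u * (u * rs2 z2) * (/ 2)).
set (A3 := kappa u * (- (2 * Pi2 (u ^ 2)) + rs2 z2 * sg * (/ 2))).
assert (EE : esource u x1 x2 = A1 * N + A2 * sg ^ 2 + A3 * (sg * x1) + - (rs (sq u x1 x2) * x2 ^ 2)).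
{ assert (Ek : rs (u ^ 2) * u + kappa u * (rs (u ^ 2) - 4 * Pi2 (u ^ 2) * u ^ 2) = 0).
  { unfold kappa, Pi2. field. lra. }
  assert (Ek2 : (rs (u ^ 2) * u + kappa u * (rs (u ^ 2) - 4 * Pi2 (u ^ 2) * u ^ 2)) * x1 = 0)
    by (rewrite Ek; ring).
  unfold esource, A1, A2, A3. rewrite EP. clear EP X2.
  generalize dependent (rs (sq u x1 x2)). intros rp ->.
  apply Rminus_diag_uniq. rewrite <- Ek2. unfold sg. field. }
assert (mulb : forall a b A B, Rabs a <= A -> Rabs b <= B -> Rabs (a * b) <= A * B).
{ intros a b A B Ha Hb. rewrite Rabs_mult. apply Rmult_le_compat; try apply Rabs_pos; assumption. }
assert (addb : forall a b A B, Rabs a <= A -> Rabs b <= B -> Rabs (a + b) <= A + B).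
{ intros a b A B Ha Hb. eapply Rle_trans; [apply Rabs_triang | lra]. }
assert (oppb : forall a A, Rabs a <= A -> Rabs (- a) <= A) by (intros; now rewrite Rabs_Ropp).
assert (cst : forall a, 0 <= a -> Rabs a <= a) by (intros; rewrite Rabs_pos_eq; lra).
assert (Y1 : Rabs (rs (u ^ 2)) <= K) by lra. assert (Y2 : Rabs (rs (sq u x1 x2)) <= K) by lra.
assert (Y3 : Rabs (Pi2 (u ^ 2)) <= K) by lra. assert (Y4 : Rabs (Pi2 z) <= K) by lra.
assert (Y5 : Rabs (rs2 z2) <= K) by lra. assert (Y6 : Rabs (kappa u) <= K) by lra.
assert (ZA1 : Rabs A1 <= 4 * K ^ 3).
{ apply Rle_trans with (K * / 2 + 2 * (K * (K * K))).
  - apply addb; [apply mulb; [exact Y1 | apply cst; lra] |].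
    apply oppb, mulb; [apply cst; lra | apply mulb; [exact Y6 | now apply mulb]].
  - clear - K0 K2 K3; nra. }
assert (ZA2 : Rabs A2 <= 4 * K ^ 3).
{ apply Rle_trans with (K + K * K * / 4 + K * / 2 + K * (K * K) * / 2).
  - repeat apply addb; try (now apply oppb); repeat apply mulb; try assumption; apply cst; lra.
  - clear - K0 K2 K3; nra. }
assert (ZA3 : Rabs A3 <= 4 * K ^ 3).
{ apply Rle_trans with (K * (2 * K + K * K * / 2)).
  - apply mulb; [exact Y6 |]. apply addb; [apply oppb |]; repeat apply mulb;
      try assumption; apply cst; lra.
  - clear - K0 K2 K3; nra. }
assert (Zs : sg ^ 2 <= S * N).
{ apply Rabs_le_between in HuK.
  assert (U2 : u ^ 2 <= K ^ 2) by (clear - HuK; nra).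
  assert (I1 : sg ^ 2 <= 2 * (4 * u ^ 2 * x1 ^ 2) + 2 * N ^ 2).
  { unfold sg. pose proof (pow2_ge_0 (2 * u * x1 - N)) as P0. clear - P0; nra. }
  assert (I2 : u ^ 2 * x1 ^ 2 <= K ^ 2 * N).
  { apply Rmult_le_compat; try apply pow2_ge_0; [exact U2 |]. unfold N. clear; nra. }
  unfold S. clear - I1 I2 HN. nra. }
assert (Zs1 : Rabs (sg * x1) <= S * N).
{ assert (I1 : x1 ^ 2 <= N) by (unfold N; clear; nra).
  pose proof (pow2_ge_0 (sg - x1)) as P1. pose proof (pow2_ge_0 (sg + x1)) as P2.
  assert (I2 : 1 * N <= S * N) by (apply Rmult_le_compat_r; lra).
  apply Rabs_le; clear - Zs I1 I2 P1 P2; split; nra. }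
rewrite EE.
replace ((4 * K ^ 3 + 4 * K ^ 3 * S + 4 * K ^ 3 * S + K) * N) with
  (4 * K ^ 3 * N + 4 * K ^ 3 * (S * N) + 4 * K ^ 3 * (S * N) + K * N) by ring.
repeat apply addb.
- apply mulb; [exact ZA1 | apply cst; lra].
- apply mulb; [exact ZA2 |]. rewrite Rabs_pos_eq by apply pow2_ge_0. exact Zs.
- now apply mulb.
- apply oppb, mulb; [exact Y2 |]. rewrite Rabs_pos_eq by apply pow2_ge_0. unfold N. clear; nra.
Qed.

End Local.

(** * Conservation of mass *)

(** A finite subcover makes the local radii uniform, since [P] persists for smaller radii. The radii
    are picked by choice, and [compactness_value_1d] answers under a double negation. *)
Lemma uniform_delta (P : R -> R -> Prop) (al be : R) :
  (forall d d' s, d' <= d -> P d s -> P d' s) ->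
  (forall s0, exists d, 0 < d /\ forall s, Rabs (s - s0) < d -> P d s) ->
  exists d, 0 < d /\ forall s, al <= s <= be -> P d s.
Proof.
intros Hm H.
set (dl := fun s0 => proj1_sig (constructive_indefinite_description _ (H s0))).
assert (Hdl : forall s0, 0 < dl s0 /\ forall s, Rabs (s - s0) < dl s0 -> P (dl s0) s).
{ intros s0. unfold dl. now destruct (constructive_indefinite_description _ (H s0)). }
destruct (compactness_value_1d al be (fun s => mkposreal _ (proj1 (Hdl s)))) as [d Hd].
exists d. split; [apply cond_pos |]. intros s Hs.
destruct (NNPP _ (Hd s Hs)) as [t [_ [Ht1 Ht2]]]. simpl in *.
apply Hm with (1 := Ht2). now apply (proj2 (Hdl t)).
Qed.

Lemma speed_sq (n : R -> R) (x a b : R) : n x <> 0 ->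
  speed n x a b ^ 2 = a * a + (b * / n x) * (b * / n x).
Proof.
intros Hn. unfold speed. rewrite pow2_sqrt.
- field. exact Hn.
- apply Rplus_le_le_0_compat; [apply pow2_ge_0 |].
  apply Rmult_le_pos; [apply pow2_ge_0 |]. left. apply Rinv_0_lt_compat. nra.
Qed.

Lemma ode_rhs_continuous (n u : R -> R) (x : R) :
  continuous n x -> continuous (Derive n) x -> continuous u x ->
  n x <> 0 -> u x ^ 2 <> c2 (u x ^ 2) ->
  continuous (fun x => Derive n x / n x * kappa (u x)) x.
Proof.
intros Kn Kn' Ku Hn Hc.
assert (Ksq : continuous (fun x => u x ^ 2) x).
{ now apply (flim_comp (F := locally x) (fun u => u ^ 2)); [apply continuous_sq |]. }
assert (Kc : continuous (fun x => c2 (u x ^ 2)) x).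
{ apply (flim_comp (F := locally x) c2); [apply continuous_c2 | exact Ksq]. }
apply (flim_mult (F := locally x)).
- apply (flim_mult (F := locally x)); [exact Kn' | now apply (flim_inv (F := locally x))].
- apply (flim_mult (F := locally x)).
  + now apply (flim_mult (F := locally x)).
  + apply (flim_inv (F := locally x)); [lra | now apply (flim_minus (F := locally x))].
Qed.

Section Mass.

Variable n : R -> R.
Hypothesis Dn : forall x, is_derive n x (Derive n x).
Hypothesis Kn' : forall x, continuous (Derive n) x.
Hypothesis Hnpos : forall x, 0 <= x <= 1 -> 0 < n x.

Lemma rho_speed (x a b : R) : n x <> 0 ->
  rho gam c0 (speed n x a b) = rs (a * a + (b * / n x) * (b * / n x)).
Proof. intros Hn. now rewrite <- speed_sq. Qed.

Variables a b : R -> R.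
Hypothesis Ka : forall s, continuous a s.
Hypothesis Kb : forall s, continuous b s.
Hypothesis Ha0 : forall s, 0 <= a s.
Hypothesis Hb1 : forall s, b s <= 1.

Variables G1 G2 H11 H12 H22 : R -> R -> R.
Hypothesis HG1 : isC1 (opn a b) G1 H11 H12.
Hypothesis HG2 : isC1 (opn a b) G2 H12 H22.

(** The angular component of the velocity in the orthonormal frame. It and the squared speed [sqp]
    are written with products and inverses so that the rules for [isC1] apply verbatim. *)
Definition bq (x s : R) : R := G2 x s * / n x.
Definition sqp (x s : R) : R := G1 x s * G1 x s + bq x s * bq x s.

Hypothesis Hsub : forall x s, opn a b x s -> sqp x s < smax.

Lemma opn_n (x s : R) : opn a b x s -> 0 < n x.
Proof. intros [H1 H2]. specialize (Ha0 s). specialize (Hb1 s). apply Hnpos. lra. Qed.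

Lemma inv_n_isC1 :
  isC1 (opn a b) (fun x _ => / n x) (fun x _ => Derive n x * - / (n x) ^ 2)
    (fun x _ => 0 * - / (n x) ^ 2).
Proof.
apply (C1_inv (opn a b) (fun x _ => n x)).
- intros x s Ho. apply opn_n in Ho. lra.
- apply C1_fst. intros x s _. now split.
Qed.

Lemma n_isC1 : isC1 (opn a b) (fun x _ => n x) (fun x _ => Derive n x) (fun _ _ => 0).
Proof. apply C1_fst. intros x s _. now split. Qed.

Definition bqx (x s : R) : R := H12 x s * / n x + G2 x s * (Derive n x * - / (n x) ^ 2).
Definition bqy (x s : R) : R := H22 x s * / n x + G2 x s * (0 * - / (n x) ^ 2).

Lemma bq_isC1 : isC1 (opn a b) bq bqx bqy.
Proof. exact (C1_mult _ _ _ _ _ _ _ HG2 inv_n_isC1). Qed.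

Definition sqx (x s : R) : R :=
  (H11 x s * G1 x s + G1 x s * H11 x s) + (bqx x s * bq x s + bq x s * bqx x s).
Definition sqy (x s : R) : R :=
  (H12 x s * G1 x s + G1 x s * H12 x s) + (bqy x s * bq x s + bq x s * bqy x s).

Lemma sqp_isC1 : isC1 (opn a b) sqp sqx sqy.
Proof.
exact (C1_plus _ _ _ _ _ _ _ (C1_mult _ _ _ _ _ _ _ HG1 HG1) (C1_mult _ _ _ _ _ _ _ bq_isC1 bq_isC1)).
Qed.

Lemma rs_sqp_isC1 : isC1 (opn a b) (fun x s => rs (sqp x s))
  (fun x s => sqx x s * (- 2 * Pi2 (sqp x s)))
  (fun x s => sqy x s * (- 2 * Pi2 (sqp x s))).
Proof.
apply (C1_comp (opn a b) rs (fun s => - 2 * Pi2 s)); [| exact sqp_isC1].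
intros x s Ho. assert (Hc := c2_pos _ (Hsub x s Ho)). split.
- evar_last; [now apply rs_derive |]. unfold Pi2. field. lra.
- eapply continuous_of_is_derive. now apply Pi2_derive.
Qed.

Lemma Pi_sqp_isC1 : isC1 (opn a b) (fun x s => Pi (sqp x s))
  (fun x s => sqx x s * (- rs (sqp x s) / 2))
  (fun x s => sqy x s * (- rs (sqp x s) / 2)).
Proof.
apply (C1_comp (opn a b) Pi (fun s => - rs s / 2)); [| exact sqp_isC1].
intros x s Ho. assert (Hc := c2_pos _ (Hsub x s Ho)). split.
- now apply Pi_derive.
- eapply continuous_of_is_derive. now apply Pi1_derive.
Qed.

Definition mass1 (x s : R) : R := n x * (rs (sqp x s) * G1 x s).
Definition mass2 (x s : R) : R := rs (sqp x s) * bq x s.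

(** The vanishing of [potential_div] is a statement about [Derive]; here it becomes one about
    genuine partials of the coordinate flux. They are existentially quantified because later
    arguments use only that their sum is zero. *)
Lemma mass_conservation (phi : R -> R -> R) :
  (forall x s, opn a b x s -> d1 phi x s = G1 x s) ->
  (forall x s, opn a b x s -> d2 phi x s = G2 x s) ->
  (forall x s, opn a b x s -> potential_div gam c0 n phi x s = 0) ->
  exists M1x M1y M2x M2y,
    isC1 (opn a b) mass1 M1x M1y /\ isC1 (opn a b) mass2 M2x M2y /\
    forall x s, opn a b x s -> M1x x s + M2y x s = 0.
Proof.
intros E1 E2 Heq.
assert (C1 := C1_mult _ _ _ _ _ _ _ n_isC1 (C1_mult _ _ _ _ _ _ _ rs_sqp_isC1 HG1)).
assert (C2 := C1_mult _ _ _ _ _ _ _ rs_sqp_isC1 bq_isC1).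
eexists; eexists; eexists; eexists. split; [exact C1 | split; [exact C2 |]].
intros x s Ho.
assert (Hn := opn_n x s Ho).
specialize (Heq x s Ho). unfold potential_div in Heq.
apply Rmult_integral in Heq.
destruct Heq as [Heq | Heq]; [apply Rinv_neq_0_compat in Heq; lra |].
destruct (C1 x s Ho) as (D1 & _). destruct (C2 x s Ho) as (_ & D2 & _).
assert (L := open2_opn a b Ka Kb x s Ho). apply locally_box in L. destruct L as [d [Hd L]].
rewrite <- Heq. f_equal; symmetry; apply is_derive_unique.
- refine (is_derive_ext_loc _ _ _ _ _ D1). exists (mkposreal d Hd). intros t Ht.
  assert (Ht' : opn a b t s).
  { apply (L t s); [exact Ht | now rewrite Rminus_diag, Rabs_R0]. }
  assert (Hnt := opn_n t s Ht').
  rewrite E1, E2 by exact Ht'. rewrite rho_speed by lra. unfold sqp, bq. simpl. ring.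
- refine (is_derive_ext_loc _ _ _ _ _ D2). exists (mkposreal d Hd). intros t Ht.
  assert (Ht' : opn a b x t).
  { apply (L x t); [now rewrite Rminus_diag, Rabs_R0 | exact Ht]. }
  rewrite E1, E2 by exact Ht'. rewrite rho_speed by lra. unfold sqp, bq. simpl.
  unfold Rdiv. ring.
Qed.

End Mass.

(** * The supersonic region *)

(** Before [T], with [tau = T - x], the weight is [tau^2] and its derivative [- 2 tau]. Hence
    [cutoff' * E1 + cutoff * Es] equals [tau * (tau * Es - 2 * E1)], negative for small [tau]
    wherever [E1] dominates the source. The square also makes the weight C^1 at [T]. At the exit the
    same function is applied to values of the potential. *)
Definition cutoff (T x : R) : R := Rmax 0 (T - x) * Rmax 0 (T - x).
Definition cutoff' (T x : R) : R := - 2 * Rmax 0 (T - x).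

Lemma continuous_pospart (T x : R) : continuous (fun x => Rmax 0 (T - x)) x.
Proof.
apply flim_eps. intros eps He. exists (mkposreal _ He). intros y Hy.
change (Rabs (y - x) < eps) in Hy. eapply Rle_lt_trans; [| exact Hy].
unfold Rmax, Rabs; repeat destruct Rle_dec; repeat destruct Rcase_abs; lra.
Qed.

Lemma cutoff_derive (T x : R) : is_derive (cutoff T) x (cutoff' T x).
Proof.
unfold cutoff'. destruct (Rtotal_order x T) as [Hx | [-> | Hx]].
- rewrite Rmax_right by lra.
  apply (is_derive_ext_loc (fun x => (T - x) * (T - x))).
  + apply (locally_interval _ x m_infty T); simpl; try easy.
    intros y _ Hy. unfold cutoff. simpl in Hy. now rewrite Rmax_right by lra.
  + auto_derive; [exact I | ring].
- rewrite Rminus_diag, Rmax_left, Rmult_0_r by lra.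
  apply is_derive_Reals. intros eps He. exists (mkposreal _ He). intros h Hh Hhd. simpl in Hhd.
  unfold cutoff. rewrite Rminus_diag, (Rmax_left 0 0) by lra.
  eapply Rle_lt_trans; [| exact Hhd].
  unfold Rmax. destruct Rle_dec as [H1 | H1].
  + replace (((T - (T + h)) * (T - (T + h)) - 0 * 0) / h - 0) with h by (now field).
    apply Rle_refl.
  + replace ((0 * 0 - 0 * 0) / h - 0) with 0 by (now field).
    rewrite Rabs_R0. apply Rabs_pos.
- rewrite Rmax_left, Rmult_0_r by lra.
  apply (is_derive_ext_loc (fun x => 0)).
  + apply (locally_interval _ x T p_infty); simpl; try easy.
    intros y Hy _. unfold cutoff. simpl in Hy. rewrite Rmax_left by lra. ring.
  + exact (is_derive_const 0 x).
Qed.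

Lemma continuous_cutoff' (T x : R) : continuous (cutoff' T) x.
Proof. apply (flim_mult (F := locally x)); [apply filterlim_const | apply continuous_pospart]. Qed.

Section Supersonic.

Variable n : R -> R.
Hypothesis Dn : forall x, is_derive n x (Derive n x).
Hypothesis Kn' : forall x, continuous (Derive n) x.
Hypothesis Hnpos : forall x, 0 <= x <= 1 -> 0 < n x.

Variable u : R -> R.
Hypothesis Ku : forall x, continuous u x.
Hypothesis Hu : forall x, 0 < u x /\ sstar < u x ^ 2 < smax.
Hypothesis Du : forall x, 0 < x < 1 -> is_derive u x (Derive n x / n x * kappa (u x)).

Variable xs : R -> R.
Hypothesis Dxs : forall s, is_derive xs s (Derive xs s).
Hypothesis Kxs' : forall s, continuous (Derive xs) s.
Hypothesis Hxs : forall s, 0 < xs s < 1.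
Hypothesis Pxs : forall s, xs (s + 2 * PI) = xs s.

Let a (s : R) : R := 0.
Let Ka (s : R) : continuous a s := continuous_const _ _.
Let Kxs (s : R) : continuous xs s := continuous_of_is_derive _ _ _ (Dxs s).
Let Hab (s : R) : a s < xs s := proj1 (Hxs s).

Variables G1 G2 H11 H12 H22 : R -> R -> R.
Hypothesis HG1 : isC1 (opn a xs) G1 H11 H12.
Hypothesis HG2 : isC1 (opn a xs) G2 H12 H22.
Hypothesis KG1 : cont_cls a xs G1.
Hypothesis KG2 : cont_cls a xs G2.
Hypothesis PG1 : forall x s, opn a xs x s -> G1 x (s + 2 * PI) = G1 x s.
Hypothesis PG2 : forall x s, opn a xs x s -> G2 x (s + 2 * PI) = G2 x s.
Hypothesis Hspeed : forall x s, opn a xs x s -> sqp n G1 G2 x s < smax.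
Variables M1x M1y M2x M2y : R -> R -> R.
Hypothesis HM1 : isC1 (opn a xs) (mass1 n G1 G2) M1x M1y.
Hypothesis HM2 : isC1 (opn a xs) (mass2 n G1 G2) M2x M2y.
Hypothesis Hmass : forall x s, opn a xs x s -> M1x x s + M2y x s = 0.
Hypothesis HG10 : forall s, G1 0 s = u 0.
Hypothesis HG20 : forall s, G2 0 s = 0.
(** Conditional on an axial trace: the continuation invokes it only at points of the shock that the
    axial part has already reached. *)
Hypothesis Hshock : forall s, G1 (xs s) s = u (xs s) -> G2 (xs s) s = 0 ->
  (1 + (Derive xs s / n (xs s)) ^ 2) * c2 (u (xs s) ^ 2) < u (xs s) ^ 2.

Let x1 (x s : R) : R := G1 x s - u x.
Let x2 (x s : R) : R := G2 x s * / n x.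
(** The factor [n] is the density of the area element; in the coordinates (x, s) the field (E1, E2)
    has divergence [Es]. *)
Let E1 (x s : R) : R := n x * energy1 (u x) (x1 x s) (x2 x s).
Let E2 (x s : R) : R := energy2 (u x) (x1 x s) (x2 x s).
Let Es (x s : R) : R := Derive n x * esource (u x) (x1 x s) (x2 x s).

Let cls01 (x s : R) : cls a xs x s -> 0 <= x < 1.
Proof. unfold cls, a. pose proof (Hxs s). lra. Qed.

Let sq_sqp (x s : R) : sq (u x) (x1 x s) (x2 x s) = sqp n G1 G2 x s.
Proof. unfold sq, x1, x2, sqp, bq. ring. Qed.

(** Here and in [E2_eq] the energy is expressed through the mass flux, so that the mass equation can
    enter its divergence although [M1x] and [M2y] are abstract. *)
Let E1_eq (x s : R) :
  n x * (Pi (u x ^ 2) - Pi (sqp n G1 G2 x s)) - mass1 n G1 G2 x s * (G1 x s - u x)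
  = E1 x s.
Proof. unfold E1, energy1. rewrite sq_sqp. unfold x1, mass1. ring. Qed.

Let E2_eq (x s : R) : - (mass2 n G1 G2 x s * (G1 x s - u x)) = E2 x s.
Proof. unfold E2, energy2. rewrite sq_sqp. unfold x1, x2, mass2, bq. ring. Qed.

Let u' (x : R) : R := Derive n x / n x * kappa (u x).

Let continuous_u' (x : R) : 0 < x < 1 -> continuous u' x.
Proof.
intros Hx. assert (Hn : 0 < n x) by (apply Hnpos; lra).
destruct (Hu x) as [_ [Hx2 _]]. apply (super_c2) in Hx2.
apply ode_rhs_continuous; [| apply Kn' | apply Ku | lra | lra].
eapply continuous_of_is_derive, Dn.
Qed.

(* [T - x] is a time left, so that [n E1] decreases fast enough there
   to absorb the source. *)
Let good (d x s : R) : Prop :=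
  sqp n G1 G2 x s < smax /\
  (forall t, 0 < t <= d -> (G1 x s = u x /\ G2 x s = 0) \/ t * Es x s < 2 * E1 x s) /\
  (x = xs s -> 0 <= E1 x s - Derive xs s * E2 x s).

Let vanishes (T : R) : Prop :=
  forall x s, opn a xs x s -> x < T -> G1 x s = u x /\ G2 x s = 0.

Let vanishes_cls (T : R) : vanishes T ->
  forall x s, cls a xs x s -> x <= T -> G1 x s = u x /\ G2 x s = 0.
Proof.
intros HZ x s Hc Hx.
destruct (Req_dec x 0) as [-> | Hx0]; [now split |].
assert (Hx1 : 0 < x) by (unfold cls, a in Hc; lra).
assert (Hlim : forall g : R -> R -> R, cont_cls a xs g ->
  (forall y, opn a xs y s -> y < T -> g y s = 0) -> g x s = 0).
{ intros g Hg Hz. apply NNPP. intros Hne.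
  destruct (cont_cls_eps a xs g Hg x s Hc (Rabs (g x s)) (Rabs_pos_lt _ Hne)) as [d [Hd H]].
  set (y := x - Rmin d x / 2).
  assert (Hm : 0 < Rmin d x) by (apply Rmin_glb_lt; lra).
  assert (Hm1 := Rmin_l d x). assert (Hm2 := Rmin_r d x).
  assert (Hy : opn a xs y s) by (unfold cls, opn, a, y in *; lra).
  specialize (H y s (opn_cls _ _ _ _ Hy)).
  rewrite Hz in H by (try exact Hy; unfold y; lra).
  rewrite Rminus_diag, Rabs_R0, Rminus_0_l, Rabs_Ropp in H.
  specialize (H ltac:(apply Rabs_def1; unfold y; lra) Hd). lra. }
assert (KU : cont_cls a xs (fun x s => G1 x s - u x)).
{ intros x' s' Hc'. apply (flim_minus (uncurry G1) (fun p => u (fst p))).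
  - apply KG1, Hc'.
  - apply flim_comp; [apply Ku |].
    apply flim_within, continuous_fst2. }
split.
- apply Rminus_diag_uniq. apply (Hlim (fun x s => G1 x s - u x)); [exact KU |].
  intros y Ho Hy. destruct (HZ y s Ho Hy) as [-> _]. ring.
- apply (Hlim G2 KG2). intros y Ho Hy. now destruct (HZ y s Ho Hy).
Qed.

(** At abscissa [T] the flow is axial by continuity, so near (T, s0) the perturbation is small.
    Slope 0 in [energy_pos] controls [E1] against the source. If the shock passes through (T, s0),
    its own slope is admissible by [Hshock] and gives the sign of the flux across it. If it lies
    before [T], the region has no points nearby. *)
Let good_near (T s0 : R) : 0 <= T < 1 -> vanishes T ->
  exists d, 0 < d /\ forall s, Rabs (s - s0) < d ->
    forall x, cls a xs x s -> Rabs (x - T) < d -> good d x s.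
Proof.
intros HT HZ.
destruct (Rlt_le_dec (xs s0) T) as [Hlt | Hle].
{ destruct (proj1 (flim_eps (F := locally s0) _ _) (Kxs s0) ((T - xs s0) / 2) ltac:(lra)) as [d H].
  exists (Rmin d ((T - xs s0) / 2)). pose proof (cond_pos d).
  split; [apply Rmin_glb_lt; lra |]. intros s Hs x Hc Hx. exfalso.
  specialize (H s (Rlt_le_trans _ _ _ Hs (Rmin_l _ _))).
  assert (Hx' := Rlt_le_trans _ _ _ Hx (Rmin_r _ _)). simpl in H.
  apply Rabs_def2 in H, Hx'. unfold cls in Hc. lra. }
assert (Hc0' : cls a xs T s0) by (unfold cls, a; lra).
destruct (vanishes_cls T HZ T s0 Hc0' (Rle_refl T)) as [Z1 Z2].
assert (HnT : 0 < n T) by (apply Hnpos; lra).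
destruct (Hu T) as [HuT0 HuT].
assert (HcT : (1 + 0 ^ 2) * c2 (u T ^ 2) < u T ^ 2).
{ assert (H := super_c2 _ (proj1 HuT)). lra. }
destruct (energy_pos (u T) HuT 0 HcT) as [e1 [He1 P1]].
destruct (esource_bound (u T) HuT0 HuT) as [e2 [C [He2 [HC P2]]]].
assert (Hk : exists e3, 0 < e3 /\ (T = xs s0 -> forall v y1 y2 k,
   Rabs (v - u T) < e3 -> Rabs y1 < e3 -> Rabs y2 < e3 ->
   Rabs (k - Derive xs s0 / n T) < e3 ->
   0 <= energy1 v y1 y2 - k * energy2 v y1 y2)).
{ destruct (Req_dec T (xs s0)) as [ET | NT].
  - assert (HS := Hshock s0). rewrite <- ET in HS.
    destruct (energy_pos (u T) HuT _ (HS Z1 Z2)) as [e3 [He3 P3]].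
    exists e3. split; [exact He3 |]. intros _ v y1 y2 k B1 B2 B3 B4.
    specialize (P3 v y1 y2 k B1 B2 B3 B4).
    assert (0 <= e3 * (y1 ^ 2 + y2 ^ 2)).
    { apply Rmult_le_pos; [lra |]. apply Rplus_le_le_0_compat; apply pow2_ge_0. }
    lra.
  - exists 1. split; [lra | intros; contradiction]. }
destruct Hk as [e3 [He3 P3]].
destruct (sq_near (u T) (smax - u T ^ 2) ltac:(lra)) as [e4 [He4 P4]].
set (e := Rmin (Rmin e1 e2) (Rmin e3 e4)).
assert (He : 0 < e) by (repeat apply Rmin_glb_lt; lra).
assert (Hea : e <= e1) by (eapply Rle_trans; apply Rmin_l).
assert (Heb : e <= e2) by (eapply Rle_trans; [apply Rmin_l | apply Rmin_r]).
assert (Hec : e <= e3) by (eapply Rle_trans; [apply Rmin_r | apply Rmin_l]).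
assert (Hed : e <= e4) by (eapply Rle_trans; [apply Rmin_r | apply Rmin_r]).
set (W := within (fun p => cls a xs (fst p) (snd p)) (locally (T, s0))).
assert (FW : Filter W) by (apply within_filter, locally_filter).
assert (Lw : forall f : R * R -> R, forall l, filterlim f (locally (T, s0)) (locally l) ->
  filterlim f W (locally l)).
{ intros f l Hf. now apply flim_within. }
assert (Lx := Lw _ _ (continuous_fst2 T s0)). assert (Ls := Lw _ _ (continuous_snd2 T s0)).
assert (Lu : filterlim (fun p : R * R => u (fst p)) W (locally (u T))).
{ apply flim_comp; [apply Ku | exact Lx]. }
assert (Ln : filterlim (fun p : R * R => n (fst p)) W (locally (n T))).
{ apply flim_comp; [eapply continuous_of_is_derive, Dn | exact Lx]. }
assert (Ln' : filterlim (fun p : R * R => Derive n (fst p)) W (locally (Derive n T))).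
{ apply flim_comp; [apply Kn' | exact Lx]. }
assert (L1 : filterlim (fun p : R * R => x1 (fst p) (snd p)) W (locally 0)).
{ replace 0 with (G1 T s0 - u T) by (rewrite Z1; ring).
  apply flim_minus; [exact (KG1 _ _ Hc0') | exact Lu]. }
assert (L2 : filterlim (fun p : R * R => x2 (fst p) (snd p)) W (locally 0)).
{ replace 0 with (G2 T s0 * / n T) by (rewrite Z2; ring).
  apply flim_mult; [exact (KG2 _ _ Hc0') | apply flim_inv; [lra | exact Ln]]. }
assert (Lk : filterlim (fun p : R * R => Derive xs (snd p) * / n (fst p)) W
   (locally (Derive xs s0 / n T))).
{ apply flim_mult; [apply flim_comp; [apply Kxs' | exact Ls] | apply flim_inv; [lra | exact Ln]]. }
assert (HnT2 : 0 < n T / 2) by lra.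
assert (EV := filter_and _ _ (filter_and _ _
  (filter_and _ _ (proj1 (flim_eps (F := W) _ _) Lu e He) (proj1 (flim_eps (F := W) _ _) L1 e He))
  (filter_and _ _ (proj1 (flim_eps (F := W) _ _) L2 e He) (proj1 (flim_eps (F := W) _ _) Lk e He)))
  (filter_and _ _ (proj1 (flim_eps (F := W) _ _) Ln (n T / 2) HnT2)
                  (proj1 (flim_eps (F := W) _ _) Ln' 1 Rlt_0_1))).
unfold W, within in EV. apply locally_box in EV. destruct EV as [d1 [Hd1 EV]].
set (M := (Rabs (Derive n T) + 1) * C).
assert (HM0 : 0 <= M).
{ apply Rmult_le_pos; [pose proof (Rabs_pos (Derive n T)); lra | exact HC]. }
(* With [N] the squared perturbation, [t * Es] is at most [d2 * M * N], less than [n T * e1 * N];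
   the latter is at most [2 * E1] because [n x > n T / 2]. *)
set (d2 := n T * e1 / (2 * (M + 1))).
assert (Hd2 : 0 < d2).
{ apply Rdiv_lt_0_compat; [now apply Rmult_lt_0_compat | lra]. }
assert (Hxs3 : exists d3, 0 < d3 /\ (T <> xs s0 -> forall s x, Rabs (s - s0) < d3 ->
   Rabs (x - T) < d3 -> x <> xs s)).
{ destruct (Req_dec T (xs s0)) as [ET | NT].
  - exists 1. split; [lra | intros; contradiction].
  - assert (Hgap : 0 < (xs s0 - T) / 2) by lra.
    destruct (proj1 (flim_eps (F := locally s0) _ _) (Kxs s0) _ Hgap) as [d H].
    exists (Rmin d ((xs s0 - T) / 2)). split; [apply Rmin_glb_lt; [apply cond_pos | lra] |].
    intros _ s x Hs Hx Hxx.
    specialize (H s (Rlt_le_trans _ _ _ Hs (Rmin_l _ _))).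
    assert (Hx' := Rlt_le_trans _ _ _ Hx (Rmin_r _ _)). simpl in H.
    apply Rabs_def2 in H, Hx'. lra. }
destruct Hxs3 as [d3 [Hd3 Hxs3]].
set (d := Rmin (Rmin d1 d2) d3).
assert (Hda : d <= d1) by (eapply Rle_trans; apply Rmin_l).
assert (Hdb : d <= d2) by (eapply Rle_trans; [apply Rmin_l | apply Rmin_r]).
assert (Hdc : d <= d3) by apply Rmin_r.
exists d. split; [repeat apply Rmin_glb_lt; lra |].
intros s Hs x Hc Hx.
destruct (EV x s (Rlt_le_trans _ _ _ Hx Hda) (Rlt_le_trans _ _ _ Hs Hda) Hc)
  as [[[V1 V2] [V3 V4]] [V5 V6]]. simpl in V1, V2, V3, V4, V5, V6.
rewrite Rminus_0_r in V2, V3.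
assert (Hnx : n T / 2 < n x) by (apply Rabs_def2 in V5; lra).
assert (Hn'x : Rabs (Derive n x) <= Rabs (Derive n T) + 1).
{ replace (Derive n x) with ((Derive n x - Derive n T) + Derive n T) by ring.
  eapply Rle_trans; [apply Rabs_triang | lra]. }
split; [| split].
- destruct (P4 (u x) (x1 x s) (x2 x s)) as [_ S4]; try lra.
  apply Rabs_def2 in S4. rewrite sq_sqp in S4. lra.
- intros t Ht.
  set (N := x1 x s ^ 2 + x2 x s ^ 2).
  assert (HN : 0 <= N) by (unfold N; apply Rplus_le_le_0_compat; apply pow2_ge_0).
  destruct (Req_dec N 0) as [N0 | N0].
  { left. assert (Q1 := pow2_ge_0 (x1 x s)). assert (Q2 := pow2_ge_0 (x2 x s)).
    assert (R1 : x1 x s = 0) by (apply Rsqr_0_uniq; unfold Rsqr, N in *; nra).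
    assert (R2 : x2 x s = 0) by (apply Rsqr_0_uniq; unfold Rsqr, N in *; nra).
    unfold x1, x2 in R1, R2. split; [lra |].
    apply Rmult_integral in R2. destruct R2 as [R2 | R2]; [exact R2 |].
    exfalso. apply Rinv_neq_0_compat in R2; lra. }
  right. assert (HN' : 0 < N) by lra.
  assert (Q1 := P1 (u x) (x1 x s) (x2 x s) 0 ltac:(lra) ltac:(lra) ltac:(lra)
    ltac:(rewrite Rminus_diag, Rabs_R0; exact He1)).
  rewrite Rmult_0_l, Rminus_0_r in Q1. fold N in Q1.
  assert (Q2 := P2 (u x) (x1 x s) (x2 x s) ltac:(lra) ltac:(lra) ltac:(lra)). fold N in Q2.
  assert (Q3 : Rabs (Es x s) <= M * N).
  { unfold Es, M. rewrite Rabs_mult, Rmult_assoc. apply Rmult_le_compat; try apply Rabs_pos; assumption. }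
  assert (Q4 : Es x s <= M * N) by (eapply Rle_trans; [apply Rle_abs | exact Q3]).
  assert (Q5 : t * Es x s <= d2 * (M * N)).
  { apply Rle_trans with (t * (M * N)); [apply Rmult_le_compat_l; lra |].
    apply Rmult_le_compat_r; [now apply Rmult_le_pos | lra]. }
  assert (Q6 : d2 * (M * N) < n T * e1 * N).
  { assert (Ed : d2 * (2 * (M + 1)) = n T * e1) by (unfold d2; field; lra).
    rewrite <- Ed. clear - HN' Hd2 HM0.
    assert (0 < d2 * N) by (now apply Rmult_lt_0_compat). nra. }
  assert (Q7 : n T * e1 * N <= 2 * E1 x s).
  { unfold E1. apply Rle_trans with (2 * (n x * (e1 * N))).
    - assert (0 <= e1 * N) by (apply Rmult_le_pos; lra). clear - H Hnx. nra.
    - apply Rmult_le_compat_l; [lra |]. apply Rmult_le_compat_l; lra. }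
  lra.
- intros Exs.
  destruct (Req_dec T (xs s0)) as [ET | NT].
  + assert (Q := P3 ET (u x) (x1 x s) (x2 x s) _ ltac:(lra) ltac:(lra) ltac:(lra)
      (Rlt_le_trans _ _ _ V4 Hec)).
    unfold E1, E2.
    set (e10 := energy1 (u x) (x1 x s) (x2 x s)) in *.
    set (e20 := energy2 (u x) (x1 x s) (x2 x s)) in *.
    replace (n x * e10 - Derive xs s * e20) with (n x * (e10 - Derive xs s * / n x * e20))
      by (field; lra).
    apply Rmult_le_pos; lra.
  + exfalso. exact (Hxs3 NT s x (Rlt_le_trans _ _ _ Hs Hdc) (Rlt_le_trans _ _ _ Hx Hdc) Exs).
Qed.

Let a_nonneg (s : R) : 0 <= a s := Rle_refl 0.
Let xs_le1 (s : R) : xs s <= 1.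
Proof. pose proof (Hxs s). lra. Qed.

Let opn01 (x s : R) : opn a xs x s -> 0 < x < 1.
Proof. unfold opn, a. pose proof (Hxs s). lra. Qed.

(** * The weighted energy current and the continuation step *)

Let u_isC1 : isC1 (opn a xs) (fun x _ => u x) (fun x _ => u' x) (fun _ _ => 0).
Proof.
apply C1_fst. intros x s Ho. apply opn01 in Ho. split; [now apply Du | now apply continuous_u'].
Qed.

Let Piu_isC1 : isC1 (opn a xs) (fun x _ => Pi (u x ^ 2))
  (fun x _ => (u' x * (2 * u x)) * (- rs (u x ^ 2) / 2))
  (fun x _ => (0 * (2 * u x)) * (- rs (u x ^ 2) / 2)).
Proof.
apply (C1_comp (opn a xs) Pi (fun s => - rs s / 2) (fun x _ => u x ^ 2)
  (fun x _ => u' x * (2 * u x)) (fun x _ => 0 * (2 * u x))).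
- intros x s _. destruct (Hu x) as [_ [_ Hx]]. apply c2_pos in Hx.
  split; [now apply Pi_derive | eapply continuous_of_is_derive; now apply Pi1_derive].
- apply (C1_comp (opn a xs) (fun y => y ^ 2) (fun y => 2 * y)); [| exact u_isC1].
  intros x s _. split; [auto_derive; [exact I | ring] |].
  apply (ex_derive_continuous (V := R_NormedModule)). auto_derive. exact I.
Qed.

Let cutoff_isC1 (T : R) : isC1 (opn a xs) (fun x _ => cutoff T x) (fun x _ => cutoff' T x) (fun _ _ => 0).
Proof. apply C1_fst. intros x s _. split; [apply cutoff_derive | apply continuous_cutoff']. Qed.

(** An exact identity, with no smallness: it uses mass conservation, the common mixed partial [H12]
    and the equation of [u]. The minus signs give the field the orientation that [flux_rigidity]
    expects. *)
Let energy_current (T : R) : exists W1x W1y W2x W2y,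
  isC1 (opn a xs) (fun x s => - (cutoff T x * E1 x s)) W1x W1y /\
  isC1 (opn a xs) (fun x s => - (cutoff T x * E2 x s)) W2x W2y /\
  forall x s, opn a xs x s ->
    W1x x s + W2y x s = - (cutoff' T x * E1 x s + cutoff T x * Es x s).
Proof.
assert (HO := open2_opn a xs Ka Kxs).
assert (CG := C1_minus _ _ _ _ _ _ _ HG1 u_isC1).
assert (CP := Pi_sqp_isC1 n Dn Kn' Hnpos a xs a_nonneg xs_le1 G1 G2 H11 H12 H22
  HG1 HG2 Hspeed).
assert (CnP := C1_mult _ _ _ _ _ _ _ (n_isC1 n Dn Kn' a xs) (C1_minus _ _ _ _ _ _ _ Piu_isC1 CP)).
assert (CW1 := C1_opp _ _ _ _ (C1_mult _ _ _ _ _ _ _ (cutoff_isC1 T)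
  (C1_minus _ _ _ _ _ _ _ CnP (C1_mult _ _ _ _ _ _ _ HM1 CG)))).
assert (CW2 := C1_opp _ _ _ _ (C1_mult _ _ _ _ _ _ _ (cutoff_isC1 T)
  (C1_opp _ _ _ _ (C1_mult _ _ _ _ _ _ _ HM2 CG)))).
eexists; eexists; eexists; eexists. split; [| split].
- refine (C1_ext _ _ _ _ _ _ _ HO _ (fun _ _ _ => eq_refl) (fun _ _ _ => eq_refl) CW1).
  intros x s _. simpl. now rewrite <- E1_eq.
- refine (C1_ext _ _ _ _ _ _ _ HO _ (fun _ _ _ => eq_refl) (fun _ _ _ => eq_refl) CW2).
  intros x s _. simpl. now rewrite <- E2_eq.
- intros x s Ho. cbv beta.
  assert (Hn : n x <> 0).
  { apply opn01 in Ho. assert (0 < n x) by (apply Hnpos; lra). lra. }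
  rewrite <- E1_eq. unfold Es, esource. rewrite sq_sqp.
  replace (M2y x s) with (- M1x x s) by (specialize (Hmass x s Ho); lra).
  unfold mass1, mass2, x1, x2, sqx, bqx, bq, u'. field. exact Hn.
Qed.

(** The strict bound on the speed is known before the shock and may be lost in the limit on it,
    while [rs] and [Pi] are controlled only below [smax]. The bound is thus a premise; near [T] it
    is part of [good]. *)
Let lim_E (x s : R) : cls a xs x s -> sqp n G1 G2 x s < smax ->
  filterlim (uncurry E1) (within (fun p => cls a xs (fst p) (snd p)) (locally (x, s)))
    (locally (E1 x s)) /\
  filterlim (uncurry E2) (within (fun p => cls a xs (fst p) (snd p)) (locally (x, s)))
    (locally (E2 x s)).
Proof.
intros Hc Hs.
set (W := within (fun p => cls a xs (fst p) (snd p)) (locally (x, s))).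
assert (FW : Filter W) by (apply within_filter, locally_filter).
assert (Hn : 0 < n x) by (apply cls01 in Hc; apply Hnpos; lra).
destruct (Hu x) as [_ [_ Hux]].
assert (Lx : filterlim (fun p : R * R => fst p) W (locally x)).
{ apply flim_within, continuous_fst2. }
assert (Lu : filterlim (fun p : R * R => u (fst p)) W (locally (u x))).
{ apply flim_comp; [apply Ku | exact Lx]. }
assert (Ln : filterlim (fun p : R * R => n (fst p)) W (locally (n x))).
{ apply flim_comp; [eapply continuous_of_is_derive, Dn | exact Lx]. }
assert (L1 := KG1 x s Hc : filterlim (fun p => G1 (fst p) (snd p)) W _).
assert (L2 := KG2 x s Hc : filterlim (fun p => G2 (fst p) (snd p)) W _).
assert (Lb : filterlim (fun p : R * R => bq n G2 (fst p) (snd p)) W (locally (bq n G2 x s))).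
{ apply flim_mult; [exact L2 | apply flim_inv; [lra | exact Ln]]. }
assert (Ls : filterlim (fun p : R * R => sqp n G1 G2 (fst p) (snd p)) W (locally (sqp n G1 G2 x s))).
{ apply flim_plus; apply flim_mult; assumption. }
assert (Hcs := c2_pos _ Hs). assert (Hcu := c2_pos _ Hux).
assert (Lr : filterlim (fun p : R * R => rs (sqp n G1 G2 (fst p) (snd p))) W
  (locally (rs (sqp n G1 G2 x s)))).
{ apply flim_comp; [now apply continuous_rs | exact Ls]. }
assert (LP : filterlim (fun p : R * R => Pi (sqp n G1 G2 (fst p) (snd p))) W
  (locally (Pi (sqp n G1 G2 x s)))).
{ apply flim_comp; [| exact Ls]. exact (continuous_of_is_derive _ _ _ (Pi_derive _ Hcs)). }
assert (LPu : filterlim (fun p : R * R => Pi (u (fst p) ^ 2)) W (locally (Pi (u x ^ 2)))).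
{ apply (flim_comp (fun v => Pi (v ^ 2))); [| exact Lu].
  apply (flim_comp (F := locally (u x)) Pi (fun v => v ^ 2)).
  - exact (continuous_of_is_derive _ _ _ (Pi_derive _ Hcu)).
  - apply (ex_derive_continuous (V := R_NormedModule)). auto_derive. exact I. }
assert (Ld : filterlim (fun p : R * R => G1 (fst p) (snd p) - u (fst p)) W (locally (G1 x s - u x))).
{ now apply flim_minus. }
split.
- rewrite <- E1_eq.
  apply (filterlim_ext (fun p => n (fst p) * (Pi (u (fst p) ^ 2)
      - Pi (sqp n G1 G2 (fst p) (snd p)))
      - mass1 n G1 G2 (fst p) (snd p) * (G1 (fst p) (snd p) - u (fst p)))).
  { intros p. apply E1_eq. }
  apply flim_minus.
  + apply flim_mult; [exact Ln |]. now apply flim_minus.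
  + apply flim_mult; [| exact Ld]. apply flim_mult; [exact Ln |]. now apply flim_mult.
- rewrite <- E2_eq.
  apply (filterlim_ext (fun p => - (mass2 n G1 G2 (fst p) (snd p)
    * (G1 (fst p) (snd p) - u (fst p))))).
  { intros p. apply E2_eq. }
  apply flim_opp, flim_mult; [| exact Ld]. now apply flim_mult.
Qed.

(** Beyond [T] the weight removes [E], so its continuity is needed only slightly past [T], where the
    speed bound is available. *)
Let cont_current (T T' : R) (E : R -> R -> R) : T < T' ->
  (forall x s, cls a xs x s -> x < T' ->
    filterlim (uncurry E) (within (fun p => cls a xs (fst p) (snd p)) (locally (x, s)))
      (locally (E x s))) ->
  cont_cls a xs (fun x s => - (cutoff T x * E x s)).
Proof.
intros HT HE x s Hc. destruct (Rlt_le_dec x T') as [Hx | Hx].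
- apply (flim_opp (fun p => cutoff T (fst p) * E (fst p) (snd p))).
  apply flim_mult; [| now apply HE].
  apply flim_within. apply flim_comp; [| apply continuous_fst2].
  exact (continuous_of_is_derive _ _ _ (cutoff_derive T x)).
- assert (Z : forall y, T < y -> cutoff T y = 0).
  { intros y Hy. unfold cutoff. rewrite Rmax_left by lra. ring. }
  apply flim_eps. intros eps He. apply locally_box.
  exists (x - T). split; [lra |]. intros x' s' Hx' _ _. unfold uncurry; simpl.
  apply Rabs_def2 in Hx'. rewrite !Z by lra.
  replace (- (0 * E x' s') - - (0 * E x s)) with 0 by ring. now rewrite Rabs_R0.
Qed.

Let Pxs' (s : R) : Derive xs (s + 2 * PI) = Derive xs s.
Proof.
symmetry. now apply is_derive_unique, is_derive_periodic with (2 * PI).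
Qed.

Let Gper (x s : R) : cls a xs x s -> G1 x (s + 2 * PI) = G1 x s /\ G2 x (s + 2 * PI) = G2 x s.
Proof.
intros Hc. split.
- now apply (cont_cls_periodic a xs Hab G1).
- now apply (cont_cls_periodic a xs Hab G2).
Qed.

(** Compactness makes [d] independent of [s], and with the weight ending at [T + d / 2] every sign
    required by [flux_rigidity] holds. At points where the flow is not axial [good] makes the
    divergence strictly positive, so zero divergence means axial flow. *)
Let vanishes_step (T : R) : 0 <= T < 1 -> vanishes T -> exists e, 0 < e /\ vanishes (T + e).
Proof.
intros HT HZ.
destruct (uniform_delta (fun d s => forall x, cls a xs x s -> Rabs (x - T) < d -> good d x s)
  0 (2 * PI)) as [d [Hd Hgood]].
{ intros d d' s Hdd H x Hc Hx. destruct (H x Hc ltac:(lra)) as (A1 & A2 & A3).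
  split; [exact A1 | split; [| exact A3]]. intros t Ht. apply A2; lra. }
{ intros s0. now apply good_near. }
assert (Hg : forall s x, cls a xs x s -> Rabs (x - T) < d -> good d x s).
{ apply (periodic_reduce (fun s => forall x, cls a xs x s -> Rabs (x - T) < d -> good d x s));
    [| exact Hgood].
  assert (Ec : forall x s, cls a xs x (s + 2 * PI) <-> cls a xs x s).
  { intros x s. unfold cls, a. now rewrite Pxs. }
  assert (Eg : forall x s, cls a xs x s -> (good d x (s + 2 * PI) <-> good d x s)).
  { intros x s Hc. destruct (Gper x s Hc) as [Q1 Q2].
    unfold good, E1, E2, Es, x1, x2, sqp, bq. rewrite Q1, Q2, Pxs, Pxs'. reflexivity. }
  intros s. split; intros H x Hc Hx.
  - assert (Hc' := proj1 (Ec x s) Hc). apply (Eg x s Hc'), H; assumption.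
  - apply (Eg x s Hc), H; [now apply Ec | exact Hx]. }
clear Hgood.
assert (zeroE : forall x s, G1 x s = u x -> G2 x s = 0 -> E1 x s = 0 /\ E2 x s = 0 /\ Es x s = 0).
{ intros x s Q1 Q2. unfold E1, E2, Es, energy1, energy2, esource, x1, x2.
  rewrite Q1, Q2. replace (sq (u x) (u x - u x) (0 * / n x)) with (u x ^ 2) by (unfold sq; ring).
  repeat split; ring. }
assert (Hsmall : forall x s, cls a xs x s -> x < T + d -> sqp n G1 G2 x s < smax).
{ intros x s Hc Hx. destruct (Rlt_le_dec (T - d) x) as [Hlo | Hlo].
  - apply Hg; [exact Hc | apply Rabs_def1; lra].
  - destruct (vanishes_cls T HZ x s Hc ltac:(lra)) as [Q1 Q2].
    unfold sqp, bq. rewrite Q1, Q2. destruct (Hu x) as [_ [_ Hx2]].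
    replace (u x * u x + 0 * / n x * (0 * / n x)) with (u x ^ 2) by ring. exact Hx2. }
(* Half of [d] leaves a margin beyond the end of the weight in which the speed bound still holds, as
   [cont_current] requires. *)
exists (d / 2). split; [lra |].
set (T2 := T + d / 2).
destruct (energy_current T2) as (W1x & W1y & W2x & W2y & CW1 & CW2 & Hdiv).
assert (Hpos : forall x, 0 <= cutoff T2 x) by (intros x; apply Rle_0_sqr).
assert (Hbeyond : forall x, T2 <= x -> cutoff T2 x = 0 /\ cutoff' T2 x = 0).
{ intros x Hx. unfold cutoff, cutoff'. rewrite Rmax_left by lra. split; ring. }
assert (Hbefore : forall x, x < T2 ->
  cutoff T2 x = (T2 - x) * (T2 - x) /\ cutoff' T2 x = - 2 * (T2 - x)).
{ intros x Hx. unfold cutoff, cutoff'. rewrite Rmax_right by lra. split; ring. }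
assert (Hin : forall x s, opn a xs x s -> T < x < T2 -> (G1 x s = u x /\ G2 x s = 0) \/
   0 < - (cutoff' T2 x * E1 x s + cutoff T2 x * Es x s)).
{ intros x s Ho Hx.
  destruct (Hg s x (opn_cls _ _ _ _ Ho)) as (_ & A2 & _); [apply Rabs_def1; unfold T2 in Hx; lra |].
  destruct (A2 (T2 - x)) as [Q | Q]; [unfold T2 in *; lra | now left | right].
  destruct (Hbefore x (proj2 Hx)) as [-> ->].
  replace (- (- 2 * (T2 - x) * E1 x s + (T2 - x) * (T2 - x) * Es x s))
    with ((T2 - x) * (2 * E1 x s - (T2 - x) * Es x s)) by ring.
  apply Rmult_lt_0_compat; lra. }
assert (Hzero : forall x s, G1 x s = u x /\ G2 x s = 0 ->
  - (cutoff' T2 x * E1 x s + cutoff T2 x * Es x s) = 0).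
{ intros x s [Q1 Q2]. destruct (zeroE x s Q1 Q2) as (-> & _ & ->). ring. }
destruct (flux_rigidity a xs (fun _ => 0) (Derive xs)
  (fun x s => - (cutoff T2 x * E1 x s)) (fun x s => - (cutoff T2 x * E2 x s))
  W1x W1y W2x W2y) as [Hfin _]; try assumption.
- intros s. apply (is_derive_const 0 s).
- intros s. reflexivity.
- intros x s Ho. unfold E2, x1, x2. now rewrite PG1, PG2.
- apply cont_current with (T + d); [unfold T2; lra |].
  intros x s Hc Hx. now apply lim_E, Hsmall.
- apply cont_current with (T + d); [unfold T2; lra |].
  intros x s Hc Hx. now apply lim_E, Hsmall.
- intros x s Ho. rewrite Hdiv by exact Ho.
  destruct (Rle_lt_dec x T) as [H1 | H1].
  + rewrite Hzero; [lra |]. apply (vanishes_cls T HZ); [now apply opn_cls | exact H1].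
  + destruct (Rlt_le_dec x T2) as [H2 | H2].
    * destruct (Hin x s Ho (conj H1 H2)) as [Q | Q]; [rewrite Hzero by exact Q; lra | lra].
    * destruct (Hbeyond x H2) as [-> ->]. lra.
- intros s. unfold a. destruct (zeroE 0 s (HG10 s) (HG20 s)) as (-> & _ & _). lra.
- intros s. assert (Hc : cls a xs (xs s) s) by (unfold cls, a; pose proof (Hxs s); lra).
  destruct (Rle_lt_dec (xs s) T) as [H1 | H1].
  + destruct (vanishes_cls T HZ _ s Hc H1) as [Q1 Q2].
    destruct (zeroE _ s Q1 Q2) as (-> & -> & _). lra.
  + destruct (Rlt_le_dec (xs s) T2) as [H2 | H2].
    * destruct (Hg s _ Hc) as (_ & _ & A3); [apply Rabs_def1; unfold T2 in H2; lra |].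
      specialize (A3 eq_refl). specialize (Hpos (xs s)).
      replace (- (cutoff T2 (xs s) * E1 (xs s) s) - Derive xs s * - (cutoff T2 (xs s) * E2 (xs s) s))
        with (- (cutoff T2 (xs s) * (E1 (xs s) s - Derive xs s * E2 (xs s) s))) by ring.
      assert (0 <= cutoff T2 (xs s) * (E1 (xs s) s - Derive xs s * E2 (xs s) s))
        by (now apply Rmult_le_pos). lra.
    * destruct (Hbeyond _ H2) as [-> _]. lra.
- intros x s Ho Hx. destruct (Rle_lt_dec x T) as [H1 | H1].
  + apply (vanishes_cls T HZ); [now apply opn_cls | exact H1].
  + destruct (Hin x s Ho (conj H1 Hx)) as [Q | Q]; [exact Q |].
    specialize (Hfin x s Ho). rewrite Hdiv in Hfin by exact Ho. lra.
Qed.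

(** The supremum of the abscissae up to which the flow is axial is attained, because [vanishes] is a
    condition on strictly smaller abscissae; [vanishes_step] then excludes any value below 1. *)
Lemma supersonic_rigidity (x s : R) : cls a xs x s -> G1 x s = u x /\ G2 x s = 0.
Proof.
intros Hc.
set (S := fun T => 0 <= T <= 1 /\ vanishes T).
assert (S0 : S 0).
{ split; [lra |]. intros y t Ho Hy. unfold opn, a in Ho. lra. }
destruct (completeness S) as [T [Hub Hlub]].
- exists 1. intros t [Ht _]. lra.
- now exists 0.
- assert (HT0 : 0 <= T) by (now apply Hub).
  assert (HT1 : T <= 1) by (apply Hlub; intros t [Ht _]; lra).
  assert (HZ : vanishes T).
  { intros y t Ho Hy. apply NNPP. intros Hne.
    assert (T <= y); [| lra]. apply Hlub. intros t' [Ht' Hz].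
    destruct (Rle_lt_dec t' y) as [? | Hlt]; [assumption | exfalso].
    now apply Hne, Hz. }
  destruct (Req_dec T 1) as [E | Hne].
  + apply (vanishes_cls T HZ); [exact Hc |]. apply cls01 in Hc. lra.
  + exfalso. destruct (vanishes_step T ltac:(lra) HZ) as [e [He Hz]].
    assert (S (Rmin (T + e) 1)).
    { split.
      - split; [apply Rmin_glb; lra | apply Rmin_r].
      - intros y t Ho Hy. apply Hz; [exact Ho |].
        eapply Rlt_le_trans; [exact Hy | apply Rmin_l]. }
    apply Hub in H. unfold Rmin in H. destruct Rle_dec; lra.
Qed.

End Supersonic.

(** * The subsonic region *)

Lemma periodic_min (f : R -> R) :
  (forall s, continuous f s) -> (forall s, f (s + 2 * PI) = f s) ->
  exists s0, forall s, f s0 <= f s.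
Proof.
intros Kf Pf. assert (Hpi := PI_RGT_0).
destruct (continuity_ab_min f 0 (2 * PI)) as [s0 [Hs0 _]]; [lra | |].
- intros c _. apply continuity_pt_filterlim, Kf.
- exists s0. apply (periodic_reduce (fun s => f s0 <= f s)); [| exact Hs0].
  intros s. now rewrite Pf.
Qed.

Lemma derive_at_min (f : R -> R) (s0 l : R) :
  (forall s, f s0 <= f s) -> is_derive f s0 l -> l = 0.
Proof.
intros Hm D. apply is_derive_Reals in D.
exact (deriv_minimum f (s0 - 1) (s0 + 1) s0 (exist _ l D) ltac:(lra) ltac:(lra) (fun s _ _ => Hm s)).
Qed.

(** Supplies the convergence along sliding curves that [trace_derive] asks for. *)
Lemma slide_lim (a b : R -> R) (phi : R -> R -> R) (c e s : R) :
  cont_cls a b phi -> cls a b c s ->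
  (forall t, 0 < t < 1 -> opn a b ((1 - t) * c + t * e) s) ->
  filterlim (fun t => phi ((1 - t) * c + t * e) s) (at_right 0) (locally (phi c s)).
Proof.
intros Hphi Hc Ho.
apply (filterlim_comp _ _ _ (fun t => ((1 - t) * c + t * e, s)) (uncurry phi) _
  (within (fun p => cls a b (fst p) (snd p)) (locally (c, s)))); [| exact (Hphi c s Hc)].
intros P HP. unfold within in HP. apply locally_box in HP. destruct HP as [d [Hd HP]].
assert (L : filterlim (fun t => (1 - t) * c + t * e) (locally 0) (locally c)).
{ assert (I : filterlim (fun t : R => t) (locally 0) (locally 0)) by apply filterlim_id.
  assert (L0 : filterlim (fun t => (1 - t) * c + t * e) (locally 0)
    (locally ((1 - 0) * c + 0 * e))).
  { apply flim_plus; apply flim_mult; try exact I; try apply filterlim_const.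
    apply flim_minus; [apply filterlim_const | exact I]. }
  replace ((1 - 0) * c + 0 * e) with c in L0 by ring. exact L0. }
assert (L1 := proj1 (flim_eps (F := locally 0) _ _) L d Hd).
destruct L1 as [d1 L1].
exists (mkposreal (Rmin d1 1) (Rmin_glb_lt _ _ _ (cond_pos d1) Rlt_0_1)).
intros t Ht Ht0. change (Rabs (t - 0) < Rmin d1 1) in Ht.
assert (T1 := Rlt_le_trans _ _ _ Ht (Rmin_l _ _)).
assert (T2 := Rlt_le_trans _ _ _ Ht (Rmin_r _ _)). apply Rabs_def2 in T2.
apply HP; [exact (L1 t T1) | now rewrite Rminus_diag, Rabs_R0 |].
apply opn_cls, Ho. lra.
Qed.

Section Subsonic.

Variable n : R -> R.
Hypothesis Dn : forall x, is_derive n x (Derive n x).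
Hypothesis Hnpos : forall x, 0 <= x <= 1 -> 0 < n x.

Variables (u U : R -> R) (m : R).
Hypothesis Ku : forall x, continuous u x.
Hypothesis DU : forall x, is_derive U x (u x).
Hypothesis Hu : forall x, 0 < u x /\ u x ^ 2 < sstar.
Hypothesis Hm : forall x, 0 <= x <= 1 -> n x * (rs (u x ^ 2) * u x) = m.

Variable xs : R -> R.
Hypothesis Dxs : forall s, is_derive xs s (Derive xs s).
Hypothesis Kxs' : forall s, continuous (Derive xs) s.
Hypothesis Hxs : forall s, 0 < xs s < 1.
Hypothesis Pxs : forall s, xs (s + 2 * PI) = xs s.

Let b (s : R) : R := 1.
Let Kb (s : R) : continuous b s := continuous_const _ _.
Let Kxs (s : R) : continuous xs s := continuous_of_is_derive _ _ _ (Dxs s).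
Let Hab (s : R) : xs s < b s := proj2 (Hxs s).

Variables phi G1 G2 : R -> R -> R.
Hypothesis Hphi : isC1 (opn xs b) phi G1 G2.
Hypothesis Kphi : cont_cls xs b phi.
Hypothesis KG1 : cont_cls xs b G1.
Hypothesis KG2 : cont_cls xs b G2.
Hypothesis Pphi : forall x s, phi x (s + 2 * PI) = phi x s.
Hypothesis PG1 : forall x s, opn xs b x s -> G1 x (s + 2 * PI) = G1 x s.
Hypothesis PG2 : forall x s, opn xs b x s -> G2 x (s + 2 * PI) = G2 x s.
Hypothesis Hspeed : forall x s, cls xs b x s -> sqp n G1 G2 x s <= sstar.
Variables M1x M1y M2x M2y : R -> R -> R.
Hypothesis HM1 : isC1 (opn xs b) (mass1 n G1 G2) M1x M1y.
Hypothesis HM2 : isC1 (opn xs b) (mass2 n G1 G2) M2x M2y.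
Hypothesis Hmass : forall x s, opn xs b x s -> M1x x s + M2y x s = 0.
Hypothesis Hflux : forall s,
  mass1 n G1 G2 (xs s) s - Derive xs s * mass2 n G1 G2 (xs s) s = m.
Variable c1 : R.
Hypothesis Hc1 : 0 < c1.
Hypothesis Hexit : forall s, sqp n G1 G2 1 s = c1 ^ 2.
Hypothesis Hexit0 : forall s, 0 <= G1 1 s.

Let psi (x s : R) : R := phi x s - U x.
Let M1 := mass1 n G1 G2.
Let M2 := mass2 n G1 G2.

Let cls01 (x s : R) : cls xs b x s -> 0 < x <= 1.
Proof. unfold cls, b. pose proof (Hxs s). lra. Qed.

Let cls_exit (s : R) : cls xs b 1 s.
Proof. unfold cls, b. pose proof (Hxs s). lra. Qed.

Let cont_fst (f : R -> R) : (forall x, continuous f x) -> cont_cls xs b (fun x _ => f x).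
Proof.
intros Kf x s _. apply (flim_comp f (fun p : R * R => fst p)); [apply Kf |].
apply flim_within, continuous_fst2.
Qed.

Let cont_psi : cont_cls xs b psi.
Proof.
intros x s Hc. apply (flim_minus (uncurry phi) (fun p => U (fst p))); [now apply Kphi |].
apply (cont_fst U); [| exact Hc]. intros y. exact (continuous_of_is_derive _ _ _ (DU y)).
Qed.

Let cont_rs : cont_cls xs b (fun x s => rs (sqp n G1 G2 x s)) /\ cont_cls xs b (bq n G2).
Proof.
assert (Kn : cont_cls xs b (fun x _ => n x)).
{ apply cont_fst. intros y. eapply continuous_of_is_derive, Dn. }
assert (Kbq : cont_cls xs b (bq n G2)).
{ intros x s Hc. apply (flim_mult (uncurry G2) (fun p => / n (fst p))); [now apply KG2 |].
  apply flim_inv; [| now apply (Kn x s)].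
  apply cls01 in Hc. assert (0 < n x) by (apply Hnpos; lra). lra. }
split; [| exact Kbq].
intros x s Hc. apply (flim_comp rs (fun p => sqp n G1 G2 (fst p) (snd p))).
- apply continuous_rs. apply c2_pos.
  assert (H := sstar_lt_smax). specialize (Hspeed x s Hc). lra.
- apply flim_plus; apply flim_mult; try (now apply (KG1 x s)); now apply (Kbq x s).
Qed.

Let cont_M1 : cont_cls xs b M1.
Proof.
intros x s Hc. apply (flim_mult (fun p => n (fst p))
  (fun p => rs (sqp n G1 G2 (fst p) (snd p)) * G1 (fst p) (snd p))).
- apply (cont_fst n); [| exact Hc]. intros y. eapply continuous_of_is_derive, Dn.
- apply flim_mult; [now apply (proj1 cont_rs) | now apply KG1].
Qed.

Let cont_M2 : cont_cls xs b M2.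
Proof.
intros x s Hc. apply (flim_mult (fun p => rs (sqp n G1 G2 (fst p) (snd p)))
  (fun p => bq n G2 (fst p) (snd p))).
- now apply (proj1 cont_rs).
- now apply (proj2 cont_rs).
Qed.

(* Testing the difference of the two mass equations with [h psi]. *)
Let test_identity (h h' : R -> R) :
  (forall y, is_derive h y (h' y)) -> (forall y, continuous h' y) -> (forall y, 0 <= h' y) ->
  (forall s, h (psi 1 s) * (M1 1 s - m) <= 0) ->
  (forall x s, opn xs b x s -> h' (psi x s) = 0 \/ (G1 x s = u x /\ G2 x s = 0)) /\
  (forall s, h (psi 1 s) * (M1 1 s - m) = 0).
Proof.
intros Dh Kh' Hh' Hex.
assert (CU : isC1 (opn xs b) (fun x _ => U x) (fun x _ => u x) (fun _ _ => 0)).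
{ apply C1_fst. intros x s _. split; [apply DU | apply Ku]. }
assert (Cpsi := C1_minus _ _ _ _ _ _ _ Hphi CU).
assert (Ch := C1_comp (opn xs b) h h' psi _ _ (fun x s _ => conj (Dh _) (Kh' _)) Cpsi).
assert (CM := C1_minus _ _ _ _ _ _ _ HM1 (C1_const _ m)).
assert (CW1 := C1_mult _ _ _ _ _ _ _ Ch CM).
assert (CW2 := C1_mult _ _ _ _ _ _ _ Ch HM2).
assert (Kh : forall y, continuous h y) by (intros y; exact (continuous_of_is_derive _ _ _ (Dh y))).
set (d := fun x s => (rs (G1 x s ^ 2 + bq n G2 x s ^ 2) * G1 x s - rs (u x ^ 2) * u x)
  * (G1 x s - u x) + rs (G1 x s ^ 2 + bq n G2 x s ^ 2) * bq n G2 x s ^ 2).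
assert (Esq : forall x s, G1 x s ^ 2 + bq n G2 x s ^ 2 = sqp n G1 G2 x s)
  by (intros; unfold sqp; ring).
assert (Hd : forall x s, cls xs b x s -> 0 <= d x s /\ (d x s = 0 -> G1 x s = u x /\ bq n G2 x s = 0)).
{ intros x s Hc. destruct (Hu x) as [Hu0 Hu1].
  apply (flux_monotone); [| exact Hu0 | lra].
  rewrite Esq. now apply Hspeed. }
assert (Hdiv : forall x s, opn xs b x s ->
  (G1 x s - u x) * h' (psi x s) * (mass1 n G1 G2 x s - m) + h (psi x s) * (M1x x s - 0) +
  ((G2 x s - 0) * h' (psi x s) * mass2 n G1 G2 x s + h (psi x s) * M2y x s)
  = h' (psi x s) * (n x * d x s)).
{ intros x s Ho. assert (Hn : 0 < n x).
  { apply opn_cls, cls01 in Ho. apply Hnpos; lra. }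
  assert (Hx := opn_cls _ _ _ _ Ho). apply cls01 in Hx.
  rewrite <- (Hm x) by lra.
  replace (M2y x s) with (- M1x x s) by (specialize (Hmass x s Ho); lra).
  unfold d. rewrite Esq. unfold mass1, mass2, bq. field. lra. }
assert (PW : forall x s, opn xs b x s -> h (psi x (s + 2 * PI)) * mass2 n G1 G2 x (s + 2 * PI)
  = h (psi x s) * mass2 n G1 G2 x s).
{ intros x s Ho. unfold psi, mass2, sqp, bq. now rewrite PG1, PG2, Pphi. }
assert (FR := flux_rigidity xs b (Derive xs) (fun _ => 0)
  (fun x s => h (psi x s) * (mass1 n G1 G2 x s - m))
  (fun x s => h (psi x s) * mass2 n G1 G2 x s) _ _ _ _ Dxs
  (fun s => is_derive_const 1 s) Kxs' (fun s => continuous_const 0 s) Hab Pxs (fun s => eq_refl)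
  PW CW1 CW2).
destruct FR as [F1 F2].
- intros x s Hc. apply (flim_mult (fun p => h (psi (fst p) (snd p))) (fun p => M1 (fst p) (snd p) - m)).
  + apply flim_comp; [apply Kh | now apply (cont_psi x s)].
  + apply flim_minus; [now apply (cont_M1 x s) | apply filterlim_const].
- intros x s Hc. apply (flim_mult (fun p => h (psi (fst p) (snd p))) (fun p => M2 (fst p) (snd p))).
  + apply flim_comp; [apply Kh | now apply (cont_psi x s)].
  + now apply (cont_M2 x s).
- intros x s Ho. rewrite Hdiv by exact Ho.
  apply opn_cls in Ho. destruct (Hd x s Ho) as [H0 _]. apply cls01 in Ho.
  assert (0 < n x) by (apply Hnpos; lra).
  apply Rmult_le_pos; [apply Hh' | apply Rmult_le_pos; lra].
(* The flux through the shock equals [m] pointwise, so the boundary term there vanishes whatever the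
   value of [psi]. *)
- intros s. right. symmetry.
  replace (h (psi (xs s) s) * (mass1 n G1 G2 (xs s) s - m)
    - Derive xs s * (h (psi (xs s) s) * mass2 n G1 G2 (xs s) s))
  with (h (psi (xs s) s) * (mass1 n G1 G2 (xs s) s
    - Derive xs s * mass2 n G1 G2 (xs s) s - m)) by ring.
  rewrite Hflux. ring.
- intros s. rewrite Rmult_0_l, Rminus_0_r. apply Hex.
- split.
  + intros x s Ho. specialize (F1 x s Ho). rewrite Hdiv in F1 by exact Ho.
    assert (Hc := opn_cls _ _ _ _ Ho). destruct (Hd x s Hc) as [_ H0].
    apply cls01 in Hc. assert (Hn : 0 < n x) by (apply Hnpos; lra).
    apply Rmult_integral in F1. destruct F1 as [F1 | F1]; [now left | right].
    apply Rmult_integral in F1. destruct F1 as [F1 | F1]; [lra |].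
    destruct (H0 F1) as [Q1 Q2]. split; [exact Q1 |].
    unfold bq in Q2. apply Rmult_integral in Q2. destruct Q2 as [Q2 | Q2]; [exact Q2 |].
    apply Rinv_neq_0_compat in Q2; lra.
  + intros s. specialize (F2 s). rewrite Rmult_0_l, Rminus_0_r in F2. exact F2.
Qed.

Let exit_cont (f : R -> R -> R) : cont_cls xs b f -> forall s, continuous (f 1) s.
Proof.
intros Hf s. apply flim_eps. intros eps He.
destruct (cont_cls_eps xs b f Hf 1 s (cls_exit s) eps He) as [d [Hd H]].
exists (mkposreal d Hd). intros t Ht. apply H; [apply cls_exit | | exact Ht].
now rewrite Rminus_diag, Rabs_R0.
Qed.

Let mass_at_exit (s : R) : M1 1 s = n 1 * (rs (c1 ^ 2) * G1 1 s).
Proof. unfold M1, mass1. now rewrite Hexit. Qed.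

Let n1_pos : 0 < n 1.
Proof. apply Hnpos. lra. Qed.

Let c1_sub : c1 ^ 2 <= sstar.
Proof. rewrite <- (Hexit 0). apply Hspeed, cls_exit. Qed.

Let psi_periodic (s : R) : psi 1 (s + 2 * PI) = psi 1 s.
Proof. unfold psi. now rewrite Pphi. Qed.

(** If [c1 > u 1], the exit flux exceeds [m] where the velocity is axial, but need not where it is
    tilted. A weight of one sign on the whole exit is therefore useless; it has to be confined to
    where the flux is known to be larger. *)
Let exit_le_u : c1 <= u 1.
Proof.
destruct (Rle_lt_dec c1 (u 1)) as [? | Hgt]; [assumption | exfalso].
destruct (periodic_min (psi 1) (exit_cont psi cont_psi) psi_periodic) as [s0 Hs0].
set (m0 := psi 1 s0) in *.
assert (Hflow : m < n 1 * (rs (c1 ^ 2) * c1)).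
{ rewrite <- (Hm 1) by lra. apply Rmult_lt_compat_l; [exact n1_pos |].
  destruct (Hu 1). apply flux_incr; try assumption. lra. }
(* At a minimum of [psi] on the exit the speed is purely axial, hence
   equal to [c1]. *)
assert (Hmin : forall s, psi 1 s = m0 -> m < M1 1 s).
{ intros s Es.
  assert (D : is_derive (fun s => phi 1 s) s (G1 1 s * 0 + G2 1 s)).
  { assert (Hsl : forall t s, 0 < t < 1 -> opn xs b ((1 - t) * 1 + t * xs s) s).
    { intros t s' Ht. unfold opn, b. pose proof (Hxs s'). split; nra. }
    apply (trace_derive xs b (fun _ => 1) xs (fun _ => 0) (Derive xs)); try assumption.
    - intros t. apply (is_derive_const 1 t).
    - intros t. apply continuous_const.
    - intros t. apply (slide_lim xs b); [exact Kphi | apply cls_exit | intros; now apply Hsl]. }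
  assert (G0 : G1 1 s * 0 + G2 1 s = 0).
  { apply (derive_at_min (fun s => phi 1 s) s); [| exact D]. intros t.
    specialize (Hs0 t). fold m0 in Hs0. unfold psi in Hs0, Es. lra. }
  (* The speed fixes [G1] up to sign; [Hexit0] excludes [- c1]. *)
  assert (EG : G1 1 s = c1).
  { assert (HE := Hexit s). unfold sqp, bq in HE.
    replace (G2 1 s) with 0 in HE by lra.
    assert (H0 := Hexit0 s). assert (G1 1 s * G1 1 s = c1 * c1) by nra.
    apply Rsqr_inj; [exact H0 | lra | exact H]. }
  rewrite mass_at_exit, EG. exact Hflow. }
(* Off the minimum of [psi] the first summand is positive, at the minimum the second. So [f] has a
   positive minimum [f s1], and [psi < m0 + f s1] forces [M1 > m]: this is the level below which the
   weight may live. *)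
set (f := fun s => (psi 1 s - m0) + Rmax 0 (M1 1 s - m)).
assert (Kf : forall s, continuous f s).
{ intros s. apply (flim_plus (F := locally s)).
  - apply (flim_minus (F := locally s)); [now apply exit_cont | apply filterlim_const].
  - change (continuous (fun s => Rmax 0 (M1 1 s - m)) s).
    apply (continuous_ext (fun s => Rmax 0 (- m - - M1 1 s))).
    { intros t. f_equal. ring. }
    apply (flim_comp (F := locally s) (fun y => Rmax 0 (- m - y)) (fun s => - M1 1 s)).
    + apply continuous_pospart.
    + apply (flim_opp (F := locally s)). now apply exit_cont. }
assert (Pf : forall s, f (s + 2 * PI) = f s).
{ intros s. unfold f. rewrite psi_periodic, !mass_at_exit.
  now rewrite (cont_cls_periodic xs b Hab G1). }
destruct (periodic_min f Kf Pf) as [s1 Hs1].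
assert (Hf1 : 0 < f s1).
{ unfold f. assert (Q1 := Hs0 s1). assert (Q2 := Rmax_l 0 (M1 1 s1 - m)).
  destruct (Req_dec (psi 1 s1) m0) as [E | E]; [| fold m0 in Q1; lra].
  assert (Q3 := Hmin s1 E). rewrite Rmax_right; lra. }
set (k := m0 + f s1).
destruct (test_identity (fun y => - cutoff k y) (fun y => - cutoff' k y)) as [_ T2].
- intros y. apply (is_derive_opp (K := R_AbsRing) (V := R_NormedModule) (cutoff k)), cutoff_derive.
- intros y. apply (flim_opp (F := locally y)), continuous_cutoff'.
- intros y. unfold cutoff'. assert (H := Rmax_l 0 (k - y)). lra.
- intros s. destruct (Rlt_le_dec (psi 1 s) k) as [H | H].
  + assert (Q := Hs1 s). unfold f at 2 in Q.
    assert (HV : 0 < M1 1 s - m).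
    { unfold k in H. unfold Rmax in Q. destruct Rle_dec as [L | L]; lra. }
    assert (0 <= cutoff k (psi 1 s)) by apply Rle_0_sqr. nra.
  + unfold cutoff. rewrite Rmax_left by lra. lra.
- specialize (T2 s0). assert (Q := Hmin s0 eq_refl). fold m0 in T2.
  unfold cutoff in T2. rewrite Rmax_right in T2 by (unfold k; lra).
  replace (k - m0) with (f s1) in T2 by (unfold k; ring).
  assert (0 < f s1 * f s1 * (M1 1 s0 - m)) by (repeat apply Rmult_lt_0_compat; lra). lra.
Qed.

Lemma subsonic_rigidity :
  c1 = u 1 /\ forall x s, cls xs b x s -> G1 x s = u x /\ G2 x s = 0.
Proof.
destruct (periodic_min (psi 1) (exit_cont psi cont_psi) psi_periodic) as [s0 Hs0].
assert (Hflow : n 1 * (rs (c1 ^ 2) * c1) <= m).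
{ rewrite <- (Hm 1) by lra. apply Rmult_le_compat_l; [lra |].
  destruct (Rle_lt_or_eq_dec _ _ exit_le_u) as [H | ->]; [left | apply Rle_refl].
  destruct (Hu 1). apply flux_incr; try assumption; lra. }
(* Subtracting the exit minimum makes the weight nonnegative on the exit, where [M1 <= m]; its
   derivative 1 never vanishes, so the first alternative of the identity is excluded everywhere. *)
destruct (test_identity (fun y => y - psi 1 s0) (fun _ => 1)) as [T1 _].
- intros y. auto_derive; [exact I | ring].
- intros y. apply continuous_const.
- intros y. lra.
- intros s. specialize (Hs0 s). assert (HE := Hexit s). assert (H0 := Hexit0 s).
  assert (HG : G1 1 s <= c1).
  { apply Rsqr_incr_0_var; [| lra]. unfold sqp in HE. unfold Rsqr.
    assert (0 <= bq n G2 1 s * bq n G2 1 s) by apply Rle_0_sqr. lra. }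
  assert (HM : M1 1 s <= m).
  { eapply Rle_trans; [| exact Hflow]. rewrite mass_at_exit.
    apply Rmult_le_compat_l; [lra |]. apply Rmult_le_compat_l; [left; apply rs_pos | exact HG]. }
  nra.
- assert (HO : forall x s, opn xs b x s -> G1 x s = u x /\ G2 x s = 0).
  { intros x s Ho. destruct (T1 x s Ho) as [H | H]; [lra | exact H]. }
  assert (HC : forall x s, cls xs b x s -> G1 x s = u x /\ G2 x s = 0).
  { intros x s Hc. split.
    - apply (cont_cls_eq xs b Hab G1 (fun x _ => u x)); try assumption; [now apply cont_fst |].
      intros y t Ho. now apply HO.
    - apply (cont_cls_eq xs b Hab G2 (fun _ _ => 0)); try assumption.
      + apply (cont_fst (fun _ => 0)). intros y. apply continuous_const.
      + intros y t Ho. now apply HO. }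
  split; [| exact HC].
  destruct (HC 1 0 (cls_exit 0)) as [Q1 Q2].
  assert (HE := Hexit 0). unfold sqp, bq in HE. rewrite Q1, Q2 in HE.
  destruct (Hu 1). apply Rsqr_inj; unfold Rsqr; lra.
Qed.

End Subsonic.

(** * Axial velocities *)

Lemma is_derive_quotient (f : R -> R) (x l : R) :
  is_derive f x l <->
  filterlim (fun h => (f (x + h) - f x) / h) (locally' 0) (locally l).
Proof.
split.
- intros D. apply is_derive_Reals in D. apply flim_eps. intros eps He.
  destruct (D eps He) as [d Hd]. exists d. intros h Hh Hh0.
  apply Hd; [exact Hh0 |]. change (Rabs (h - 0) < d) in Hh. now rewrite Rminus_0_r in Hh.
- intros L. apply is_derive_Reals. intros eps He.
  destruct (proj1 (flim_eps (F := locally' 0) _ _) L eps He) as [d Hd].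
  exists d. intros h Hh0 Hh. apply (Hd h); [| exact Hh0].
  change (Rabs (h - 0) < d). now rewrite Rminus_0_r.
Qed.

(** * Continuity and derivative of a solution of a monotone equation *)

Section Implicit_inverse.

Variables (lo hi : R) (f f' g y : R -> R).
Hypothesis Hf : forall a b, lo < a -> a < b -> b < hi -> f a < f b.
Hypothesis Df : forall a, lo < a < hi -> is_derive f a (f' a).
Hypothesis Hf' : forall a, lo < a < hi -> f' a <> 0.
Hypothesis Hg : forall x, lo < g x < hi.
Hypothesis Hfg : forall x, f (g x) = y x.

Lemma implicit_inverse_continuous (x : R) : continuous y x -> continuous g x.
Proof.
intros Ky. apply flim_eps. intros eps He.
destruct (Hg x) as [G1 G2].
set (e := Rmin eps (Rmin ((g x - lo) / 2) ((hi - g x) / 2))).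
assert (He0 : 0 < e) by (repeat apply Rmin_glb_lt; lra).
assert (Ha : e <= eps) by apply Rmin_l.
assert (Hb : e <= (g x - lo) / 2) by (eapply Rle_trans; [apply Rmin_r | apply Rmin_l]).
assert (Hc : e <= (hi - g x) / 2) by (eapply Rle_trans; [apply Rmin_r | apply Rmin_r]).
assert (F1 : f (g x - e) < y x) by (rewrite <- Hfg; apply Hf; lra).
assert (F2 : y x < f (g x + e)) by (rewrite <- Hfg; apply Hf; lra).
set (r := Rmin (y x - f (g x - e)) (f (g x + e) - y x)).
assert (Hr : 0 < r) by (apply Rmin_glb_lt; lra).
assert (Hr1 := Rmin_l (y x - f (g x - e)) (f (g x + e) - y x)).
assert (Hr2 := Rmin_r (y x - f (g x - e)) (f (g x + e) - y x)). fold r in Hr1, Hr2.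
generalize (proj1 (flim_eps (F := locally x) _ _) Ky r Hr). apply filter_imp.
intros t Ht. apply Rabs_def2 in Ht. rewrite <- !Hfg in *. destruct (Hg t) as [T1 T2].
assert (Q1 : g x - e < g t).
{ destruct (Rlt_le_dec (g x - e) (g t)) as [? | [H | H]]; [assumption | |].
  - assert (f (g t) < f (g x - e)) by (apply Hf; lra). lra.
  - rewrite H in Ht. lra. }
assert (Q2 : g t < g x + e).
{ destruct (Rlt_le_dec (g t) (g x + e)) as [? | [H | H]]; [assumption | |].
  - assert (f (g x + e) < f (g t)) by (apply Hf; lra). lra.
  - rewrite <- H in Ht. lra. }
apply Rabs_def1; lra.
Qed.

(** Caratheodory's form of the derivative: the slope function [phi] of [f] at [g x] is continuous
    there, and the difference quotient of [g] is that of [y] divided by [phi (g (x + h))]. No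
    division by the increment of [g] occurs. *)
Lemma implicit_inverse_derive (x y' : R) : is_derive y x y' -> is_derive g x (y' / f' (g x)).
Proof.
intros Dy. assert (Kg := implicit_inverse_continuous x (continuous_of_is_derive _ _ _ Dy)).
set (phi := fun z : R => if Req_EM_T z (g x) then f' (g x) else (f z - f (g x)) / (z - g x)).
assert (Kphi : continuous phi (g x)).
{ assert (D := Df (g x) (Hg x)). apply is_derive_Reals in D.
  apply flim_eps. intros eps He. destruct (D eps He) as [d Hd].
  exists d. intros z Hz. change (Rabs (z - g x) < d) in Hz. unfold phi.
  destruct (Req_EM_T (g x) (g x)) as [_ | H]; [| contradiction].
  destruct (Req_EM_T z (g x)) as [_ | Hne]; [now rewrite Rminus_diag, Rabs_R0 |].
  specialize (Hd (z - g x) ltac:(lra) Hz).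
  now replace (g x + (z - g x))%R with (z : R) in Hd by (simpl; lra). }
assert (Ephi : forall z : R, f z - f (g x) = phi z * (z - g x)).
{ intros z. unfold phi. destruct (Req_EM_T z (g x)) as [-> | Hne]; [ring | field; lra]. }
assert (E0 : phi (g x) = f' (g x)).
{ unfold phi. now destruct (Req_EM_T (g x) (g x)). }
assert (Hne := Hf' (g x) (Hg x)).
apply is_derive_quotient. apply is_derive_quotient in Dy.
assert (Lg : filterlim (fun h => phi (g (x + h))) (locally' 0) (locally (phi (g x)))).
{ apply flim_within. apply flim_comp; [exact Kphi |].
  apply (flim_comp g (fun h => x + h) x); [exact Kg |].
  assert (L0 : filterlim (fun h => x + h) (locally 0) (locally (x + 0))).
  { apply flim_plus; [apply filterlim_const | apply filterlim_id]. }
  now rewrite Rplus_0_r in L0. }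
rewrite <- E0. rewrite <- E0 in Hne.
apply (filterlim_ext_loc (fun h => (y (x + h) - y x) / h * / phi (g (x + h)))).
- assert (NZ : locally' 0 (fun h => Rabs (phi (g (x + h)) - phi (g x)) < Rabs (phi (g x)))).
  { apply (proj1 (flim_eps (F := locally' 0) _ _) Lg). now apply Rabs_pos_lt. }
  assert (N0 : locally' 0 (fun h => h <> 0)) by (exists (mkposreal 1 Rlt_0_1); now intros).
  generalize (filter_and _ _ NZ N0). apply filter_imp. intros h [H1 H2].
  assert (H3 : phi (g (x + h)) <> 0).
  { intros H. rewrite H, Rminus_0_l, Rabs_Ropp in H1. lra. }
  rewrite <- !Hfg, Ephi. field. now split.
- apply flim_mult; [exact Dy | now apply flim_inv].
Qed.

End Implicit_inverse.

(** * Subsonic and supersonic speeds of given mass flux *)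

Section Branches.

Let cs := cstar gam c0.
Let qm := qmax gam c0.
Let F (q : R) : R := rs (q ^ 2) * q.
Let F' (q : R) : R := rs (q ^ 2) * (1 - q ^ 2 / c2 (q ^ 2)).

Let cs_pos : 0 < cs := cstar_pos.
Let cs_sq : cs ^ 2 = sstar := cstar_sq.
Let qm_sq : qm ^ 2 = smax := qmax_sq.
Let cs_qm : cs < qm := cstar_lt_qmax.

Let DF (q : R) : 0 <= q < qm -> is_derive F q (F' q).
Proof. intros Hq. apply flux_derive. apply c2_pos. nra. Qed.

(** The density tends to 0 towards the vacuum. The value at [qm] itself cannot serve as the end
    point for the intermediate value theorem: [Rpower 0] takes the default value 1, so [F] is
    discontinuous there. *)
Lemma flux_vanishes (eps : R) : 0 < eps -> exists q, cs < q < qm /\ F q < eps.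
Proof.
intros He.
(* The point [s] below is the one with [c2 s / gam = t]. The bound [t1] makes the density at most
   [eps / (2 * qm)]; the bound [t2] keeps [s] at least halfway from [sstar] to [smax]. *)
set (t1 := Rpower (eps / (2 * qm)) (gam - 1)).
set (t2 := (smax - sstar) * (gam - 1) / (4 * gam)).
assert (Hss := sstar_lt_smax).
assert (Ht2 : 0 < t2).
{ unfold t2. apply Rdiv_lt_0_compat; [apply Rmult_lt_0_compat |]; lra. }
assert (Ht1 : 0 < t1) by apply exp_pos.
set (t := Rmin t1 t2).
assert (Ht : 0 < t) by (now apply Rmin_glb_lt).
set (s := smax - 2 * gam * t / (gam - 1)).
assert (Ec : / gam * c2 s = t).
{ assert (E := c2_smax). unfold c2 in *. unfold s.
  replace (c0 ^ 2 - (gam - 1) / 2 * (smax - 2 * gam * t / (gam - 1)))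
   with ((c0 ^ 2 - (gam - 1) / 2 * smax) + gam * t) by (field; lra).
  rewrite E. field. lra. }
assert (Hs1 : sstar < s).
{ assert (t <= t2) by apply Rmin_r.
  assert (2 * gam * t / (gam - 1) <= 2 * gam * t2 / (gam - 1)).
  { unfold Rdiv. apply Rmult_le_compat_r; [left; apply Rinv_0_lt_compat; lra |].
    apply Rmult_le_compat_l; lra. }
  assert (E2 : 2 * gam * t2 / (gam - 1) = (smax - sstar) / 2)
    by (unfold t2; field; lra).
  unfold s. lra. }
assert (Hs2 : s < smax).
{ assert (0 < 2 * gam * t / (gam - 1)).
  { apply Rdiv_lt_0_compat; [apply Rmult_lt_0_compat |]; lra. }
  unfold s. lra. }
assert (Hsp := sstar_pos).
exists (sqrt s).
assert (Eq : sqrt s ^ 2 = s) by (apply pow2_sqrt; lra).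
assert (Hq0 := sqrt_pos s).
split; [split |].
- apply Rsqr_incrst_0; unfold Rsqr; nra.
- apply Rsqr_incrst_0; unfold Rsqr; nra.
- unfold F. rewrite Eq. unfold rs. rewrite Ec.
  assert (H1 : Rpower t (/ (gam - 1)) <= eps / (2 * qm)).
  { assert (Hx : 0 < eps / (2 * qm)) by (apply Rdiv_lt_0_compat; lra).
    apply Rle_trans with (Rpower t1 (/ (gam - 1))).
    - apply Rle_Rpower_l; [left; apply Rinv_0_lt_compat; lra |].
      split; [exact Ht | apply Rmin_l].
    - right. unfold t1. rewrite Rpower_mult, Rinv_r, Rpower_1; lra. }
  assert (H2 : sqrt s < qm) by (apply Rsqr_incrst_0; unfold Rsqr; nra).
  apply Rle_lt_trans with (eps / (2 * qm) * qm).
  + apply Rmult_le_compat; [left; apply exp_pos | exact Hq0 | exact H1 | lra].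
  + replace (eps / (2 * qm) * qm) with (eps / 2) by (field; lra). lra.
Qed.

Let F_continuity (q : R) : 0 <= q < qm -> continuity_pt F q.
Proof.
intros Hq. apply continuity_pt_filterlim. exact (continuous_of_is_derive _ _ _ (DF q Hq)).
Qed.

Lemma subsonic_root (y : R) : 0 < y < F cs -> exists q, 0 < q < cs /\ F q = y.
Proof.
intros Hy.
destruct (IVT_interv (fun q => F q - y) 0 cs) as [q [Hq E]].
- intros q Hq. apply continuity_pt_minus; [apply F_continuity; lra |].
  apply continuity_pt_const. now intros ? ?.
- exact cs_pos.
- unfold F. rewrite Rmult_0_r. lra.
- lra.
- exists q. split; [| lra].
  assert (q <> 0) by (intros ->; unfold F in E; rewrite Rmult_0_r in E; lra).
  assert (q <> cs) by (intros ->; lra). lra.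
Qed.

Lemma supersonic_root (y : R) : 0 < y < F cs -> exists q, cs < q < qm /\ F q = y.
Proof.
intros Hy. destruct (flux_vanishes y (proj1 Hy)) as [q1 [Hq1 Hf1]].
destruct (IVT_interv (fun q => y - F q) cs q1) as [q [Hq E]].
- intros q Hq. apply continuity_pt_minus; [| apply F_continuity; lra].
  apply continuity_pt_const. now intros ? ?.
- lra.
- lra.
- lra.
- exists q. split; [| lra].
  assert (q <> cs) by (intros ->; lra). lra.
Qed.

Variable n : R -> R.
Hypothesis Dn : forall x, is_derive n x (Derive n x).
Hypothesis Hnpos : forall x, 0 <= x <= 1 -> 0 < n x.
Variable m : R.
Hypothesis Hm0 : 0 < m.
Hypothesis Hm : forall x, 0 <= x <= 1 -> m < rs (cs ^ 2) * cs * n x.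

(** Freezing [n] outside [0, 1] keeps it positive, so that the branches are defined and continuous
    on the whole line. *)
Let nc (x : R) : R := n (clamp x).
Let nc_pos (x : R) : 0 < nc x.
Proof. apply Hnpos, clamp_range. Qed.

Let level (x : R) : 0 < m / nc x < F cs.
Proof.
split; [now apply Rdiv_lt_0_compat |].
apply Rmult_lt_reg_r with (nc x); [apply nc_pos |].
unfold Rdiv. rewrite Rmult_assoc, Rinv_l, Rmult_1_r by (pose proof (nc_pos x); lra).
apply Hm, clamp_range.
Qed.

Let nc_continuous (x : R) : continuous nc x.
Proof.
apply (flim_comp (F := locally x) n); [| apply continuous_clamp].
exact (continuous_of_is_derive _ _ _ (Dn _)).
Qed.

Let level_continuous (x : R) : continuous (fun x => m / nc x) x.
Proof.
apply (flim_mult (F := locally x)); [apply filterlim_const |].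
apply (flim_inv (F := locally x)); [pose proof (nc_pos x); lra | apply nc_continuous].
Qed.

Let level_derive (x : R) : 0 < x < 1 ->
  is_derive (fun x => m / nc x) x (- (m / n x) * (Derive n x / n x)).
Proof.
intros Hx. apply (is_derive_ext_loc (fun x => m / n x)).
- apply (locally_interval _ x 0 1); simpl; try lra.
  intros t H1 H2. simpl in *. unfold nc. rewrite clamp_id; lra.
- assert (0 < n x) by (apply Hnpos; lra). assert (D := Dn x).
  auto_derive; [split; [now exists (Derive n x) | split; [lra | exact I]] |].
  change (Derive (fun x0 => n x0) x) with (Derive n x). field. lra.
Qed.

Let branch (lo hi sg : R) : 0 <= lo -> hi <= qm -> sg <> 0 ->
  (forall a b, lo < a -> a < b -> b < hi -> sg * F a < sg * F b) ->
  (forall a, lo < a < hi -> a ^ 2 <> c2 (a ^ 2)) ->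
  (forall y, 0 < y < F cs -> exists q, lo < q < hi /\ F q = y) ->
  exists u : R -> R,
    (forall x, lo < u x < hi) /\
    (forall x, 0 <= x <= 1 -> n x * (rs (u x ^ 2) * u x) = m) /\
    (forall x, continuous u x) /\
    (forall x, 0 < x < 1 -> is_derive u x (Derive n x / n x * kappa (u x))).
Proof.
intros Hlo Hhi Hsg Hmono Hcrit Hroot.
set (u := fun x => proj1_sig (constructive_indefinite_description _ (Hroot _ (level x)))).
assert (Hu : forall x, lo < u x < hi /\ F (u x) = m / nc x).
{ intros x. unfold u. now destruct (constructive_indefinite_description _ _). }
assert (Hc : forall a, lo < a < hi -> 0 < c2 (a ^ 2)).
{ intros a Ha. apply c2_pos. rewrite <- qm_sq. nra. }
assert (DF0 : forall a, lo < a < hi -> is_derive (fun q => sg * F q) a (sg * F' a)).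
{ intros a Ha. apply is_derive_scal, DF. lra. }
assert (HF' : forall a, lo < a < hi -> sg * F' a <> 0).
{ intros a Ha. specialize (Hc a Ha). specialize (Hcrit a Ha).
  assert (H := rs_pos (a ^ 2)). unfold F'.
  apply Rmult_integral_contrapositive. split; [exact Hsg |].
  apply Rmult_integral_contrapositive. split; [lra |]. intros E. apply Hcrit.
  apply Rmult_eq_reg_r with (/ c2 (a ^ 2)); [| apply Rinv_neq_0_compat; lra].
  rewrite Rinv_r by lra. unfold Rdiv in E. lra. }
assert (Hfu : forall x, sg * F (u x) = sg * (m / nc x)) by (intros; f_equal; apply Hu).
exists u. split; [apply Hu | split; [| split]].
- intros x Hx. destruct (Hu x) as [_ H]. unfold F in H. rewrite H.
  unfold nc. rewrite clamp_id by exact Hx. assert (0 < n x) by (now apply Hnpos). field. lra.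
- intros x. apply (implicit_inverse_continuous lo hi (fun q => sg * F q) u (fun x => sg * (m / nc x)));
    try assumption; [apply Hu |].
  apply (flim_mult (F := locally x)); [apply filterlim_const | apply level_continuous].
- intros x Hx. destruct (Hu x) as [H1 H2].
  evar_last.
  + apply (implicit_inverse_derive lo hi (fun q => sg * F q) (fun q => sg * F' q) u
      (fun x => sg * (m / nc x))); try assumption; [apply Hu |].
    apply is_derive_scal. now apply level_derive.
  + assert (Hn : 0 < n x) by (apply Hnpos; lra).
    assert (E : m / n x = F (u x)) by (rewrite H2; unfold nc; now rewrite clamp_id by lra).
    rewrite E. unfold F, F', kappa. specialize (Hc _ H1). specialize (Hcrit _ H1).
    assert (R0 := rs_pos (u x ^ 2)). field.
    repeat split; try lra; try exact Hsg; intros Z; apply Hcrit; lra.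
Qed.

Lemma subsonic_branch : exists u : R -> R,
  (forall x, 0 < u x /\ u x ^ 2 < sstar) /\
  (forall x, 0 <= x <= 1 -> n x * (rs (u x ^ 2) * u x) = m) /\
  (forall x, continuous u x) /\
  (forall x, 0 < x < 1 -> is_derive u x (Derive n x / n x * kappa (u x))).
Proof.
destruct (branch 0 cs 1) as (u & Hu & H); try lra.
- intros a b Ha Hab Hb. rewrite !Rmult_1_l. apply flux_incr; try assumption; [lra |].
  rewrite <- cs_sq. nra.
- intros a Ha. apply Rlt_not_eq, sub_c2. rewrite <- cs_sq. nra.
- exact subsonic_root.
- exists u. split; [| exact H]. intros x. specialize (Hu x). rewrite <- cs_sq. split; [lra | nra].
Qed.

Lemma supersonic_branch : exists u : R -> R,
  (forall x, 0 < u x /\ sstar < u x ^ 2 < smax) /\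
  (forall x, 0 <= x <= 1 -> n x * (rs (u x ^ 2) * u x) = m) /\
  (forall x, continuous u x) /\
  (forall x, 0 < x < 1 -> is_derive u x (Derive n x / n x * kappa (u x))).
Proof.
destruct (branch cs qm (-1)) as (u & Hu & H); try lra.
- intros a b Ha Hab Hb.
  assert (F b < F a); [| lra].
  apply flux_decr; try assumption; [lra | rewrite <- cs_sq; nra | rewrite <- qm_sq; nra].
- intros a Ha. apply Rgt_not_eq, super_c2. rewrite <- cs_sq. nra.
- exact supersonic_root.
- exists u. split; [| exact H]. intros x. specialize (Hu x).
  rewrite <- cs_sq, <- qm_sq. split; [lra | split; nra].
Qed.

End Branches.

(** * Axial solutions *)

Lemma locally_fst (P : R -> Prop) (x s : R) :
  locally x P -> locally (x, s) (fun p => P (fst p)).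
Proof. intros H. exact (continuous_fst2 x s P H). Qed.

Lemma locally_between (lo hi x : R) : lo < x < hi -> locally x (fun t => lo < t < hi).
Proof. intros H. apply (locally_interval _ x lo hi); simpl; try lra. intros; simpl in *; lra. Qed.

Lemma C2_on_axial (lo hi : R) (f v v' : R -> R) :
  (forall x, lo < x < hi -> is_derive f x (v x)) ->
  (forall x, lo < x < hi -> is_derive v x (v' x)) ->
  (forall x, lo < x < hi -> continuous v' x) ->
  C2_on (fun p => lo < fst p < hi) (fun x _ => f x).
Proof.
intros Df Dv Kv' x s Hx. simpl in Hx.
set (phi := fun x _ : R => f x).
assert (E1 : forall t y, lo < t < hi -> d1 phi t y = v t).
{ intros t y Ht. now apply is_derive_unique, Df. }
assert (E2 : forall t y, d2 phi t y = 0) by (intros t y; exact (Derive_const (f t) y)).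
assert (L := locally_between lo hi x Hx).
assert (E11 : forall t y, lo < t < hi -> d1 (d1 phi) t y = v' t).
{ intros t y Ht. unfold d1 at 1. rewrite (Derive_ext_loc _ v).
  - now apply is_derive_unique, Dv.
  - generalize (locally_between lo hi t Ht). apply filter_imp. intros z Hz. now apply E1. }
assert (E21 : forall t y, d2 (d1 phi) t y = 0) by (intros t y; exact (Derive_const (Derive f t) y)).
assert (E12 : forall t y, d1 (d2 phi) t y = 0).
{ intros t y. unfold d1. rewrite (Derive_ext _ (fun _ => 0)); [apply Derive_const | intros; apply E2]. }
assert (E22 : forall t y, d2 (d2 phi) t y = 0).
{ intros t y. unfold d2 at 1. rewrite (Derive_ext _ (fun _ => 0)); [apply Derive_const | intros; apply E2]. }
assert (KC : forall g : R -> R -> R, (forall t y, g t y = 0) -> continuous (uncurry g) (x, s)).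
{ intros g Hg. apply (continuous_ext (fun _ => 0)); [intros [t y]; symmetry; apply Hg |].
  apply continuous_const. }
assert (KF : forall (g : R -> R -> R) (h : R -> R), (forall t y, lo < t < hi -> g t y = h t) ->
  continuous h x -> continuous (uncurry g) (x, s)).
{ intros g h Hg Kh. apply (continuous_ext_loc _ (fun p => h (fst p))).
  - generalize (locally_fst _ x s L). apply filter_imp. intros [t y] Ht. symmetry. now apply Hg.
  - apply (flim_comp (F := locally (x, s)) h); [exact Kh | apply continuous_fst2]. }
split; [now exists (v x); apply Df |].
split; [exists 0; exact (is_derive_const (f x) s) |].
split.
{ exists (v' x). apply (is_derive_ext_loc v); [| now apply Dv].
  revert L. apply filter_imp. intros t Ht. symmetry. now apply E1. }
split; [exists 0; exact (is_derive_const (Derive f x) s) |].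
split.
{ exists 0. apply (is_derive_ext (fun _ => 0)); [intros; symmetry; apply E2 | exact (is_derive_const 0 x)]. }
split.
{ exists 0. apply (is_derive_ext (fun _ => 0)); [intros; symmetry; apply E2 | exact (is_derive_const 0 s)]. }
split; [now apply (KF phi f); [| exact (continuous_of_is_derive _ _ _ (Df x Hx))] |].
split; [now apply (KF _ v); [exact E1 | exact (continuous_of_is_derive _ _ _ (Dv x Hx))] |].
split; [now apply KC |].
split; [now apply (KF _ v'); [exact E11 | apply Kv'] |].
split; [now apply KC |]. split; now apply KC.
Qed.

Section Axial.

Variable n : R -> R.
Hypothesis Dn : forall x, is_derive n x (Derive n x).
Hypothesis Kn' : forall x, continuous (Derive n) x.
Hypothesis Hnpos : forall x, 0 <= x <= 1 -> 0 < n x.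

Variables (um up : R -> R) (m : R).
Hypothesis Hum : forall x, 0 < um x /\ sstar < um x ^ 2 < smax.
Hypothesis Hup : forall x, 0 < up x /\ up x ^ 2 < sstar.
Hypothesis Mm : forall x, 0 <= x <= 1 -> n x * (rs (um x ^ 2) * um x) = m.
Hypothesis Mp : forall x, 0 <= x <= 1 -> n x * (rs (up x ^ 2) * up x) = m.
Hypothesis Kum : forall x, continuous um x.
Hypothesis Kup : forall x, continuous up x.
Hypothesis Dum : forall x, 0 < x < 1 -> is_derive um x (Derive n x / n x * kappa (um x)).
Hypothesis Dup : forall x, 0 < x < 1 -> is_derive up x (Derive n x / n x * kappa (up x)).

Variable xb : R.
Hypothesis Hxb : 0 < xb < 1.

Let Am (x : R) : R := RInt um 0 x.
Let Ap (x : R) : R := RInt up 0 x.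

(** With [Rmin] and [Rmax] in place of a case distinction the two primitives are matched at [xb]
    from the start, and monotonicity and the Lipschitz bound follow from theirs. *)
Definition axial_potential (x : R) : R := Am (Rmin x xb) + (Ap (Rmax x xb) - Ap xb).

Lemma cstar_lt_super (q : R) : 0 < q -> sstar < q ^ 2 < smax ->
  cstar gam c0 < q < qmax gam c0.
Proof.
intros Hq Hs. rewrite <- (cstar_sq), <- (qmax_sq) in Hs.
assert (H1 := cstar_pos). assert (H2 := cstar_lt_qmax).
clear - Hq Hs H1 H2. split; nra.
Qed.

Lemma sub_lt_cstar (q : R) : 0 < q -> q ^ 2 < sstar -> q < cstar gam c0.
Proof.
intros Hq Hs. rewrite <- (cstar_sq) in Hs.
assert (H1 := cstar_pos). clear - Hq Hs H1. nra.
Qed.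

Lemma axial_derive_left (x : R) : x < xb -> is_derive axial_potential x (um x).
Proof.
intros Hx. apply (is_derive_ext_loc (fun x => Am x + (Ap xb - Ap xb))).
- apply (locally_interval _ x m_infty xb); simpl; try easy. intros y _ Hy. simpl in Hy.
  unfold axial_potential. now rewrite Rmin_left, Rmax_right by lra.
- evar_last.
  + apply (is_derive_plus (K := R_AbsRing) (V := R_NormedModule) Am).
    * now apply is_derive_RInt0.
    * exact (is_derive_const (Ap xb - Ap xb) x).
  + apply Rplus_0_r.
Qed.

Lemma axial_derive_right (x : R) : xb < x -> is_derive axial_potential x (up x).
Proof.
intros Hx. apply (is_derive_ext_loc (fun x => (Am xb - Ap xb) + Ap x)).
- apply (locally_interval _ x xb p_infty); simpl; try easy. intros y Hy _. simpl in Hy.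
  unfold axial_potential. rewrite Rmin_right, Rmax_left by lra. ring.
- evar_last.
  + apply (is_derive_plus (K := R_AbsRing) (V := R_NormedModule) _ Ap).
    * exact (is_derive_const (Am xb - Ap xb) x).
    * now apply is_derive_RInt0.
  + apply Rplus_0_l.
Qed.

Let incr (v : R -> R) (M : R) : (forall x, continuous v x) -> (forall x, 0 < v x <= M) ->
  forall x y, x <= y -> 0 <= RInt v 0 y - RInt v 0 x <= M * (y - x).
Proof.
intros Kv Hv x y Hxy.
destruct (MVT_gen (fun x => RInt v 0 x) x y v) as [c [_ E]].
- intros z _. now apply is_derive_RInt0.
- intros z _. apply continuity_pt_filterlim. exact (continuous_of_is_derive _ _ _ (is_derive_RInt0 v z Kv)).
- rewrite E. destruct (Hv c). split; [apply Rmult_le_pos; lra | apply Rmult_le_compat_r; lra].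
Qed.

Let um_bound (x : R) : 0 < um x <= qmax gam c0.
Proof. destruct (Hum x) as [H1 H2]. destruct (cstar_lt_super _ H1 H2). lra. Qed.

Let up_bound (x : R) : 0 < up x <= qmax gam c0.
Proof.
destruct (Hup x) as [H1 H2]. assert (H := sub_lt_cstar _ H1 H2).
assert (H0 := cstar_lt_qmax). lra.
Qed.

Let axial_incr (x y : R) : x <= y ->
  0 <= axial_potential y - axial_potential x <= qmax gam c0 * (y - x).
Proof.
intros Hxy. unfold axial_potential.
assert (H1 : Rmin x xb <= Rmin y xb) by (unfold Rmin; repeat destruct Rle_dec; lra).
assert (H2 : Rmax x xb <= Rmax y xb) by (unfold Rmax; repeat destruct Rle_dec; lra).
assert (I1 := incr um _ Kum um_bound _ _ H1). assert (I2 := incr up _ Kup up_bound _ _ H2).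
fold (Am (Rmin x xb)) (Am (Rmin y xb)) in I1. fold (Ap (Rmax x xb)) (Ap (Rmax y xb)) in I2.
(* The parts of [x, y] on the two sides of [xb] have total length [y - x], so the two bounds with
   the same constant add up. *)
assert (E : (Rmin y xb - Rmin x xb) + (Rmax y xb - Rmax x xb) = y - x).
{ unfold Rmin, Rmax; repeat destruct Rle_dec; lra. }
rewrite <- E. lra.
Qed.

Lemma axial_lipschitz (x y : R) :
  Rabs (axial_potential x - axial_potential y) <= qmax gam c0 * Rabs (x - y).
Proof.
destruct (Rle_dec x y) as [H | H].
- rewrite (Rabs_minus_sym x y), (Rabs_minus_sym (axial_potential x)).
  assert (I := axial_incr x y H). rewrite !Rabs_pos_eq; lra.
- assert (I := axial_incr y x ltac:(lra)). rewrite !Rabs_pos_eq; lra.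
Qed.

Lemma axial_continuous (x : R) : continuous axial_potential x.
Proof.
assert (Hq : 0 < qmax gam c0) by (destruct (um_bound 0); lra).
apply flim_eps. intros eps He.
exists (mkposreal (eps / qmax gam c0) (Rdiv_lt_0_compat _ _ He Hq)). intros y Hy.
change (Rabs (y - x) < eps / qmax gam c0) in Hy.
eapply Rle_lt_trans; [apply axial_lipschitz |].
apply Rlt_le_trans with (qmax gam c0 * (eps / qmax gam c0)).
- now apply Rmult_lt_compat_l.
- right. field. lra.
Qed.

Let velocity (x : R) : R := if Rlt_dec x xb then um x else up x.

Lemma axial_is_phi_b (u0 : R) : um 0 = u0 -> is_phi_b gam c0 u0 n xb axial_potential.
Proof.
intros E0. split.
{ intros x _. apply flim_within, axial_continuous. }
assert (Vl : forall x, x < xb -> velocity x = um x).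
{ intros x Hx. unfold velocity. now destruct Rlt_dec. }
assert (Vr : forall x, xb < x -> velocity x = up x).
{ intros x Hx. unfold velocity. destruct Rlt_dec; [lra | reflexivity]. }
exists velocity. split; [| split; [| split; [| split; [| split]]]].
- intros x _ Hne. destruct (Rlt_le_dec x xb) as [H | H].
  + rewrite Vl by exact H. now apply axial_derive_left.
  + rewrite Vr by lra. apply axial_derive_right; lra.
- rewrite <- E0. apply (filterlim_ext_loc um).
  + exists (mkposreal xb (proj1 Hxb)). intros y Hy Hy0. symmetry. apply Vl.
    change (Rabs (y - 0) < xb) in Hy. apply Rabs_def2 in Hy. lra.
  + apply flim_within, Kum.
- intros x Hx. rewrite Vl by lra. destruct (Hum x) as [H1 H2].
  split; [now apply cstar_lt_super |].
  apply (is_derive_ext_loc um); [| apply Dum; lra].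
  apply (locally_interval _ x m_infty xb); simpl; try easy.
  intros y _ Hy. symmetry. now apply Vl.
- intros x Hx. rewrite Vr by lra. destruct (Hup x) as [H1 H2].
  split; [split; [exact H1 | now apply sub_lt_cstar] |].
  apply (is_derive_ext_loc up); [| apply Dup; lra].
  apply (locally_interval _ x xb p_infty); simpl; try easy.
  intros y Hy _. symmetry. now apply Vr.
- exists (up 1). destruct (Hup 1) as [H1 H2].
  split; [| split; [exact H1 | now apply sub_lt_cstar]].
  apply (filterlim_ext_loc up).
  + exists (mkposreal (1 - xb) ltac:(lra)). intros y Hy Hy1. symmetry. apply Vr.
    change (Rabs (y - 1) < 1 - xb) in Hy. apply Rabs_def2 in Hy. lra.
  + apply flim_within, Kup.
- exists (um xb), (up xb). destruct (Hup xb) as [H1 H2].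
  split; [| split; [| split]].
  + apply (filterlim_ext_loc um); [| apply flim_within, Kum].
    exists (mkposreal 1 Rlt_0_1). intros y _ Hy. symmetry. now apply Vl.
  + apply (filterlim_ext_loc up); [| apply flim_within, Kup].
    exists (mkposreal 1 Rlt_0_1). intros y _ Hy. symmetry. now apply Vr.
  + split; [exact H1 | now apply sub_lt_cstar].
  + change (rs (up xb ^ 2) * up xb = rs (um xb ^ 2) * um xb).
    assert (Hn : 0 < n xb) by (apply Hnpos; lra).
    apply Rmult_eq_reg_l with (n xb); [| lra]. rewrite Mm, Mp by lra. reflexivity.
Qed.

Lemma axial_d1_nonneg : d1_nonneg_on_boundary (fun x _ => axial_potential x).
Proof.
intros s. split; intros D HD.
- apply (flim_le (F := at_right 0) (fun _ => 0) _ _ _) with (2 := filterlim_const 0) (3 := HD).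
  exists (mkposreal 1 Rlt_0_1). intros t _ Ht.
  assert (I := axial_incr 0 t ltac:(lra)).
  apply Rmult_le_pos; [lra | left; now apply Rinv_0_lt_compat].
- apply (flim_le (F := at_left 1) (fun _ => 0) _ _ _) with (2 := filterlim_const 0) (3 := HD).
  exists (mkposreal 1 Rlt_0_1). intros t _ Ht.
  assert (I := axial_incr t 1 ltac:(lra)).
  replace ((axial_potential t - axial_potential 1) / (t - 1)) with
    ((axial_potential 1 - axial_potential t) / (1 - t)) by (field; lra).
  apply Rmult_le_pos; [lra | left; apply Rinv_0_lt_compat; lra].
Qed.

Let speed_axial (x v : R) : 0 < n x -> 0 < v -> speed n x v 0 = v.
Proof.
intros Hn Hv. unfold speed. replace (v ^ 2 + 0 ^ 2 / n x ^ 2) with (v ^ 2) by (field; lra).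
apply sqrt_pow2. lra.
Qed.

Let axial_div (lo hi : R) (v : R -> R) (x s : R) :
  0 <= lo -> hi <= 1 -> lo < x < hi -> (forall t, 0 < v t) ->
  (forall t, lo < t < hi -> is_derive axial_potential t (v t)) ->
  (forall t, lo < t < hi -> n t * (rs (v t ^ 2) * v t) = m) ->
  potential_div gam c0 n (fun x _ => axial_potential x) x s = 0.
Proof.
intros Hlo Hhi Hx Hv Dv Mv. unfold potential_div.
set (phi := fun x _ : R => axial_potential x).
assert (E2 : forall t y, d2 phi t y = 0)
  by (intros t y; exact (Derive_const (axial_potential t) y)).
rewrite (Derive_ext_loc _ (fun _ => m)), Derive_const.
- rewrite (Derive_ext _ (fun _ => 0)), Derive_const; [ring |].
  intros t. rewrite E2. ring.
- generalize (locally_between lo hi x Hx). apply filter_imp. intros t Ht.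
  assert (Hn : 0 < n t) by (apply Hnpos; lra).
  replace (d1 phi t s) with (v t) by (symmetry; apply is_derive_unique, Dv, Ht).
  rewrite E2, speed_axial by (apply Hv || exact Hn).
  rewrite <- (Mv t Ht). unfold rho. rewrite Rmult_assoc. reflexivity.
Qed.

Let lim_d1 (lo hi : R) (v : R -> R) (x s : R) : (forall x, continuous v x) ->
  (forall t, lo < t < hi -> is_derive axial_potential t (v t)) ->
  filterlim (uncurry (d1 (fun x _ => axial_potential x)))
    (within (fun p : R * R => lo < fst p < hi) (locally (x, s))) (locally (v x)).
Proof.
intros Kv Dv.
apply (filterlim_within_ext _ (fun p : R * R => v (fst p))).
- intros [t y] Ht. symmetry. now apply is_derive_unique, Dv.
- apply flim_within. apply flim_comp; [apply Kv | apply continuous_fst2].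
Qed.

Let lim_d2 (P : R * R -> Prop) (x s : R) :
  filterlim (uncurry (d2 (fun x _ => axial_potential x))) (within P (locally (x, s))) (locally 0).
Proof.
apply (filterlim_ext (fun _ => 0)).
- intros [t y]. symmetry. exact (Derive_const (axial_potential t) y).
- apply filterlim_const.
Qed.

Let C2_branch (lo hi : R) (v : R -> R) : 0 <= lo -> hi <= 1 ->
  (forall x, continuous v x) ->
  (forall t, lo < t < hi -> is_derive axial_potential t (v t)) ->
  (forall x, 0 < x < 1 -> is_derive v x (Derive n x / n x * kappa (v x))) ->
  (forall x, v x ^ 2 <> c2 (v x ^ 2)) ->
  C2_on (fun p => lo < fst p < hi) (fun x _ => axial_potential x).
Proof.
intros Hlo Hhi Kv Dv Dv' Hv.
apply (C2_on_axial lo hi _ v (fun x => Derive n x / n x * kappa (v x))); [exact Dv | |].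
- intros x Hx. apply Dv'. lra.
- intros x Hx. apply ode_rhs_continuous; [| apply Kn' | apply Kv | | apply Hv].
  + eapply continuous_of_is_derive, Dn.
  + assert (0 < n x) by (apply Hnpos; lra). lra.
Qed.

Lemma axial_transonic (u0 c1 : R) : um 0 = u0 -> up 1 = c1 ->
  transonic_shock_solution gam c0 u0 c1 n (fun x _ => axial_potential x) (fun _ => xb).
Proof.
intros E0 E1.
assert (Dl : forall t, 0 < t < xb -> is_derive axial_potential t (um t)) by (intros; apply axial_derive_left; lra).
assert (Dr : forall t, xb < t < 1 -> is_derive axial_potential t (up t)) by (intros; apply axial_derive_right; lra).
split; [now intros s |].
split; [intros s; exists 0; exact (is_derive_const xb s) |].
split.
{ intros s. apply (continuous_ext (fun _ => 0)); [intros; symmetry; apply Derive_const |].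
  apply continuous_const. }
split; [intros _; exact Hxb |].
split; [reflexivity |].
split.
{ exists (qmax gam c0). intros a1 a2 b1 b2 _ _.
  eapply Rle_trans; [apply axial_lipschitz |].
  apply Rmult_le_compat_l; [destruct (um_bound 0); lra |].
  pose proof (Rabs_pos (a2 - b2)). lra. }
split.
{ apply (C2_branch 0 xb um); try assumption; try lra.
  intros x. destruct (Hum x) as [_ [H _]]. apply (super_c2) in H. lra. }
split.
{ apply (C2_branch xb 1 up); try assumption; try lra.
  intros x. destruct (Hup x) as [_ H]. apply (sub_c2) in H. lra. }
exists (fun x _ => um x), (fun _ _ => 0), (fun x _ => up x), (fun _ _ => 0).
split; [intros x s _; split; [now apply (lim_d1 0 xb) | apply lim_d2] |].
split; [intros x s _; split; [now apply (lim_d1 xb 1) | apply lim_d2] |].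
split.
{ intros x s Hx. destruct (Hum x) as [H1 H2].
  rewrite speed_axial; [now apply cstar_lt_super | apply Hnpos; lra | exact H1]. }
split.
{ intros x s Hx. destruct (Hup x) as [H1 H2].
  rewrite speed_axial; [now apply sub_lt_cstar | apply Hnpos; lra | exact H1]. }
split.
{ intros x s [Hx | Hx]; unfold int_minus, int_plus in Hx; simpl in Hx.
  - apply (axial_div 0 xb um); try lra; [intros t; apply Hum | exact Dl |].
    intros t Ht. apply Mm. lra.
  - apply (axial_div xb 1 up); try lra; [intros t; apply Hup | exact Dr |].
    intros t Ht. apply Mp. lra. }
split; [intros s; now split |].
split.
{ intros s. destruct (Hup 1) as [H1 H2]. rewrite speed_axial; [exact E1 | apply Hnpos; lra | exact H1]. }
intros s. cbv zeta.
assert (Hn : 0 < n xb) by (apply Hnpos; lra).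
destruct (Hum xb) as [H1 _]. destruct (Hup xb) as [H2 _].
assert (Q : forall v, 0 < v -> sqrt (v ^ 2 + (0 / n xb) ^ 2) = v).
{ intros v Hv. replace (v ^ 2 + (0 / n xb) ^ 2) with (v ^ 2) by (field; lra).
  apply sqrt_pow2. lra. }
rewrite !Q by assumption. split.
- assert (E : rho gam c0 (um xb) * um xb = rho gam c0 (up xb) * up xb).
  { change (rs (um xb ^ 2) * um xb = rs (up xb ^ 2) * up xb).
    apply Rmult_eq_reg_l with (n xb); [| lra]. rewrite Mm, Mp by lra. reflexivity. }
  rewrite E. unfold Rdiv. ring.
(* Both sides equal [c0^2 / (gam - 1)]: Bernoulli's law is built into the definition of the sound
   speed. *)
- unfold csq. field. lra.
Qed.

End Axial.

(** * Rigidity *)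

Lemma lipschitz_cont_cls (a b : R -> R) (phi : R -> R -> R) (L : R) :
  (forall s, 0 <= a s) -> (forall s, b s <= 1) ->
  (forall a1 a2 b1 b2, 0 <= a1 <= 1 -> 0 <= b1 <= 1 ->
      Rabs (phi a1 a2 - phi b1 b2) <= L * (Rabs (a1 - b1) + Rabs (a2 - b2))) ->
  cont_cls a b phi.
Proof.
intros Ha Hb HL x s Hc. apply flim_eps. intros eps He.
set (K := Rabs L + 1). assert (HK : 0 < K) by (unfold K; pose proof (Rabs_pos L); lra).
apply locally_box. exists (eps / (2 * K)).
split; [apply Rdiv_lt_0_compat; lra |]. intros x' s' Hx Hs Hc'.
assert (B : forall y t, cls a b y t -> 0 <= y <= 1).
{ intros y t Hy. unfold cls in Hy. specialize (Ha t). specialize (Hb t). lra. }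
unfold uncurry; simpl.
eapply Rle_lt_trans; [apply HL; [exact (B _ _ Hc') | exact (B _ _ Hc)] |].
assert (P : 0 <= Rabs (x' - x) + Rabs (s' - s)).
{ pose proof (Rabs_pos (x' - x)). pose proof (Rabs_pos (s' - s)). lra. }
apply Rle_lt_trans with (K * (Rabs (x' - x) + Rabs (s' - s))).
- apply Rmult_le_compat_r; [exact P |]. unfold K. pose proof (Rle_abs L). lra.
- apply Rlt_le_trans with (K * (eps / (2 * K) + eps / (2 * K))); [| right; field; lra].
  apply Rmult_lt_compat_l; [exact HK | lra].
Qed.

(* The Lipschitz bound is only available on [[0, 1]], whence the truncation
   in the application of the mean value theorem up to the end points. *)
Lemma mean_value_lipschitz (g v : R -> R) (L t1 t2 : R) :
  (forall x y, 0 <= x <= 1 -> 0 <= y <= 1 -> Rabs (g x - g y) <= L * Rabs (x - y)) ->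
  0 <= t1 < t2 -> t2 <= 1 -> (forall x, t1 < x < t2 -> is_derive g x (v x)) ->
  exists c, t1 < c < t2 /\ g t2 - g t1 = v c * (t2 - t1).
Proof.
intros HL H1 H2 Dg.
set (G := fun t => g (clamp t)).
assert (KG : forall t, continuous G t).
{ intros t. apply flim_eps. intros eps He.
  set (K := Rabs L + 1). assert (HK : 0 < K) by (unfold K; pose proof (Rabs_pos L); lra).
  destruct (proj1 (flim_eps (F := locally t) _ _) (continuous_clamp t) (eps / K)
    (Rdiv_lt_0_compat _ _ He HK)) as [d Hd].
  exists d. intros y Hy. specialize (Hd y Hy). unfold G.
  eapply Rle_lt_trans; [apply HL; apply clamp_range |].
  apply Rle_lt_trans with (K * Rabs (clamp y - clamp t)).
  - apply Rmult_le_compat_r; [apply Rabs_pos |]. unfold K. pose proof (Rle_abs L). lra.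
  - apply Rlt_le_trans with (K * (eps / K)); [now apply Rmult_lt_compat_l | right; field; lra]. }
assert (DG : forall x, t1 < x < t2 -> derivable_pt_lim G x (v x)).
{ intros x Hx. apply is_derive_Reals, (is_derive_ext_loc g); [| now apply Dg].
  generalize (locally_between t1 t2 x Hx). apply filter_imp. intros y Hy.
  unfold G. rewrite clamp_id; [reflexivity | lra]. }
destruct (MVT G id t1 t2 (fun c Hc => exist _ _ (DG c Hc)) (fun c _ => derivable_pt_id c))
  as [c [Hc E]]; [lra | | |].
- intros x _. apply continuity_pt_filterlim, KG.
- intros x _. apply derivable_continuous_pt, derivable_pt_id.
- exists c. split; [exact Hc |].
  rewrite derive_pt_id in E. unfold id, G in E. rewrite !clamp_id in E by lra.
  simpl in E. lra.
Qed.

(** * Every transonic shock solution is axial *)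

Section Uniqueness.

Variables u0 c1 : R.
Variable n : R -> R.
Hypothesis Dn : forall x, is_derive n x (Derive n x).
Hypothesis Kn' : forall x, continuous (Derive n) x.
Hypothesis Hnpos : forall x, 0 <= x <= 1 -> 0 < n x.

Variables (um up : R -> R) (m : R).
Hypothesis Hum : forall x, 0 < um x /\ sstar < um x ^ 2 < smax.
Hypothesis Hup : forall x, 0 < up x /\ up x ^ 2 < sstar.
Hypothesis Mm : forall x, 0 <= x <= 1 -> n x * (rs (um x ^ 2) * um x) = m.
Hypothesis Mp : forall x, 0 <= x <= 1 -> n x * (rs (up x ^ 2) * up x) = m.
Hypothesis Kum : forall x, continuous um x.
Hypothesis Kup : forall x, continuous up x.
Hypothesis Dum : forall x, 0 < x < 1 -> is_derive um x (Derive n x / n x * kappa (um x)).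
Hypothesis Eu0 : um 0 = u0.
Hypothesis Hc1 : 0 < c1.

Lemma transonic_rigidity (phi : R -> R -> R) (xs : R -> R) :
  transonic_shock_solution gam c0 u0 c1 n phi xs -> d1_nonneg_on_boundary phi ->
  c1 = up 1 /\ exists xb, 0 < xb < 1 /\ (forall s, xs s = xb) /\
    exists C, forall x s, 0 <= x <= 1 -> phi x s = axial_potential um up xb x + C.
Proof.
intros (Pxs & Exs & Kxs' & Hxs & Pphi & [L HL] & C2m & C2p & Gm1 & Gm2 & Gp1 & Gp2 &
  Lm & Lp & Sm & Sp & Heq & Hin & Hout & Hrh) Hnn.
assert (Dxs : forall s, is_derive xs s (Derive xs s)) by (intros; now apply Derive_correct).
assert (Kxs : forall s, continuous xs s) by (intros s; exact (continuous_of_is_derive _ _ _ (Dxs s))).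
set (z := fun _ : R => 0). set (o := fun _ : R => 1).
assert (Kz : forall s, continuous z s) by (intros; apply continuous_const).
assert (Ko : forall s, continuous o s) by (intros; apply continuous_const).
assert (Hz : forall s, z s < xs s) by (intros; apply Hxs).
assert (Ho : forall s, xs s < o s) by (intros; apply Hxs).
assert (Pz : forall s, z (s + 2 * PI) = z s) by reflexivity.
assert (Po : forall s, o (s + 2 * PI) = o s) by reflexivity.
assert (z0 : forall s, 0 <= z s) by (intros; apply Rle_refl).
assert (o1 : forall s, o s <= 1) by (intros; apply Rle_refl).
assert (xs0 : forall s, 0 <= xs s) by (intros s; destruct (Hxs s); lra).
assert (xs1 : forall s, xs s <= 1) by (intros s; destruct (Hxs s); lra).
change (C2_on (fun p => opn z xs (fst p) (snd p)) phi) in C2m.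
change (C2_on (fun p => opn xs o (fst p) (snd p)) phi) in C2p.
assert (Lm1 := fun x s Hc => proj1 (Lm x s Hc)). assert (Lm2 := fun x s Hc => proj2 (Lm x s Hc)).
assert (Lp1 := fun x s Hc => proj1 (Lp x s Hc)). assert (Lp2 := fun x s Hc => proj2 (Lp x s Hc)).
assert (Cm := phi_isC1 z xs Kz Kxs Hz phi Gm1 Gm2 C2m Lm1 Lm2).
assert (Cm1 := G1_isC1 z xs Kz Kxs Hz phi Gm1 C2m Lm1).
assert (Cm2 := G2_isC1 z xs Kz Kxs Hz phi Gm2 C2m Lm2).
assert (Cp := phi_isC1 xs o Kxs Ko Ho phi Gp1 Gp2 C2p Lp1 Lp2).
assert (Cp1 := G1_isC1 xs o Kxs Ko Ho phi Gp1 C2p Lp1).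
assert (Cp2 := G2_isC1 xs o Kxs Ko Ho phi Gp2 C2p Lp2).
assert (Km1 := cont_cls_of_limits z xs Hz _ _ Lm1).
assert (Km2 := cont_cls_of_limits z xs Hz _ _ Lm2).
assert (Kp1 := cont_cls_of_limits xs o Ho _ _ Lp1).
assert (Kp2 := cont_cls_of_limits xs o Ho _ _ Lp2).
assert (Kphim := lipschitz_cont_cls z xs phi L z0 xs1 HL).
assert (Kphip := lipschitz_cont_cls xs o phi L xs0 o1 HL).
assert (Pm1 := G1_periodic z xs Hz phi Gm1 C2m Lm1 Pz Pxs Pphi).
assert (Hcm : forall x s, cls z xs x s -> 0 <= x < 1).
{ intros x s Hc. unfold cls, z in Hc. destruct (Hxs s). lra. }
assert (Hcp : forall x s, cls xs o x s -> 0 < x <= 1).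
{ intros x s Hc. unfold cls, o in Hc. destruct (Hxs s). lra. }
assert (nm : forall x s, cls z xs x s -> 0 < n x).
{ intros x s Hc. apply Hcm in Hc. apply Hnpos. lra. }
assert (np : forall x s, cls xs o x s -> 0 < n x).
{ intros x s Hc. apply Hcp in Hc. apply Hnpos. lra. }
assert (Vm : forall x s, opn z xs x s -> sqp n Gm1 Gm2 x s < smax).
{ intros x s Hx. assert (Hn := nm x s (opn_cls _ _ _ _ Hx)).
  unfold sqp, bq. rewrite <- speed_sq by lra. rewrite <- (qmax_sq).
  destruct (Sm x s) as [S1 S2]; [unfold opn, z in Hx; lra |].
  assert (Hp := cstar_pos). clear - S1 S2 Hp. nra. }
assert (Vp0 : forall x s, xs s < x <= 1 -> sqp n Gp1 Gp2 x s < sstar).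
{ intros x s Hx. assert (Hn : 0 < n x) by (apply Hnpos; destruct (Hxs s); lra).
  unfold sqp, bq. rewrite <- speed_sq by lra. rewrite <- (cstar_sq).
  assert (S1 := Sp x s Hx). assert (S0 := sqrt_pos (Gp1 x s ^ 2 + Gp2 x s ^ 2 / n x ^ 2)).
  fold (speed n x (Gp1 x s) (Gp2 x s)) in S0. clear - S0 S1. nra. }
(* On the shock itself only the limit of the strict subsonic bound is available. *)
assert (Vp : forall x s, cls xs o x s -> sqp n Gp1 Gp2 x s <= sstar).
{ intros x s Hc.
  assert (PF := within_opn_proper xs o Ho x s Hc).
  apply (flim_le (F := within (fun p => opn xs o (fst p) (snd p)) (locally (x, s)))
    (fun p => d1 phi (fst p) (snd p) * d1 phi (fst p) (snd p)
      + (d2 phi (fst p) (snd p) * / n (fst p)) * (d2 phi (fst p) (snd p) * / n (fst p)))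
    (fun _ => sstar)); [| | apply filterlim_const].
  - unfold within. apply filter_forall. intros [y t] Hy. simpl in *.
    rewrite (G1_inside xs o Ho phi Gp1 C2p Lp1), (G2_inside xs o Ho phi Gp2 C2p Lp2) by exact Hy.
    left. apply Vp0. unfold opn, o in Hy. lra.
  - assert (Hn := np x s Hc).
    assert (Q1 : filterlim (fun p : R * R => d1 phi (fst p) (snd p))
      (within (fun p => opn xs o (fst p) (snd p)) (locally (x, s))) (locally (Gp1 x s)))
      by exact (Lp1 x s Hc).
    assert (Q2 : filterlim (fun p : R * R => d2 phi (fst p) (snd p) * / n (fst p))
      (within (fun p => opn xs o (fst p) (snd p)) (locally (x, s))) (locally (bq n Gp2 x s))).
    { apply flim_mult; [exact (Lp2 x s Hc) |]. apply flim_inv; [lra |].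
      apply flim_within, flim_comp; [| apply continuous_fst2].
      eapply continuous_of_is_derive, Dn. }
    apply flim_plus; apply flim_mult; assumption. }
assert (Vp' : forall x s, opn xs o x s -> sqp n Gp1 Gp2 x s < smax).
{ intros x s Hx. apply opn_cls, Vp in Hx. assert (H := sstar_lt_smax). lra. }
destruct (mass_conservation n Dn Kn' Hnpos z xs Kz Kxs z0 xs1 Gm1 Gm2 _ _ _ Cm1 Cm2 Vm phi
  (G1_inside z xs Hz phi Gm1 C2m Lm1) (G2_inside z xs Hz phi Gm2 C2m Lm2)
  (fun x s Hx => Heq x s (or_introl Hx))) as (A1 & A2 & A3 & A4 & HA1 & HA2 & HA).
destruct (mass_conservation n Dn Kn' Hnpos xs o Kxs Ko xs0 o1 Gp1 Gp2 _ _ _ Cp1 Cp2 Vp' phi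
  (G1_inside xs o Ho phi Gp1 C2p Lp1) (G2_inside xs o Ho phi Gp2 C2p Lp2)
  (fun x s Hx => Heq x s (or_intror Hx))) as (B1 & B2 & B3 & B4 & HB1 & HB2 & HB).
assert (Sxs_m : forall s, cls z xs (xs s) s) by (intros s; unfold cls, z; destruct (Hxs s); lra).
assert (Sxs_p : forall s, cls xs o (xs s) s) by (intros s; unfold cls, o; destruct (Hxs s); lra).
assert (Lsec : forall s x y, 0 <= x <= 1 -> 0 <= y <= 1 ->
  Rabs (phi x s - phi y s) <= L * Rabs (x - y)).
{ intros s x y Hx Hy. assert (H := HL x s y s Hx Hy).
  now rewrite Rminus_diag, Rabs_R0, Rplus_0_r in H. }
assert (Htr : forall s, is_derive (fun s => phi (xs s) s) s (Gm1 (xs s) s * Derive xs s + Gm2 (xs s) s)).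
{ intros s.
  assert (Slm : forall t s, 0 < t < 1 -> opn z xs ((1 - t) * xs s + t * z s) s).
  { intros t s' Ht. unfold opn, z. destruct (Hxs s'). split; nra. }
  apply (trace_derive z xs xs z (Derive xs) z); try assumption.
  - intros t. exact (is_derive_const 0 t).
  - intros t. apply (slide_lim z xs); [exact Kphim | apply Sxs_m | intros; now apply Slm]. }
(* Both sides are the derivative of the one function [phi (xs s) s], computed from the two sides of
   the shock: this is the tangential jump condition. *)
assert (Htan : forall s, Gm1 (xs s) s * Derive xs s + Gm2 (xs s) s
  = Gp1 (xs s) s * Derive xs s + Gp2 (xs s) s).
{ intros s.
  assert (Slp : forall t s, 0 < t < 1 -> opn xs o ((1 - t) * xs s + t * o s) s).
  { intros t s' Ht. unfold opn, o. destruct (Hxs s'). split; nra. }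
  assert (T2 : is_derive (fun s => phi (xs s) s) s (Gp1 (xs s) s * Derive xs s + Gp2 (xs s) s)).
  { apply (trace_derive xs o xs o (Derive xs) z); try assumption.
    - intros t. exact (is_derive_const 1 t).
    - intros t. apply (slide_lim xs o); [exact Kphip | apply Sxs_p | intros; now apply Slp]. }
  rewrite <- (is_derive_unique _ _ _ (Htr s)). now apply is_derive_unique. }
(* Stated for an axial trace ahead of the shock, since it has to yield [Hshock] before axiality is
   known everywhere; it is used again for the flux entering the subsonic part. *)
assert (Hjump : forall s, Gm1 (xs s) s = um (xs s) -> Gm2 (xs s) s = 0 ->
  let k := Derive xs s / n (xs s) in
  um (xs s) * k = Gp1 (xs s) s * k + bq n Gp2 (xs s) s /\
  rs (um (xs s) ^ 2) * um (xs s)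
  = rs (Gp1 (xs s) s ^ 2 + bq n Gp2 (xs s) s ^ 2) * (Gp1 (xs s) s - k * bq n Gp2 (xs s) s)).
{ intros s Q1 Q2 k. assert (Hn := nm _ _ (Sxs_m s)). split.
  - assert (T := Htan s). rewrite Q1, Q2 in T.
    unfold k, bq. replace (um (xs s) * (Derive xs s / n (xs s))) with
      ((um (xs s) * Derive xs s + 0) / n (xs s)) by (field; lra).
    rewrite T. field. lra.
  - destruct (Hrh s) as [R _]. cbv zeta in R. rewrite Q1, Q2 in R. fold k in R.
    change (Gp2 (xs s) s / n (xs s)) with (bq n Gp2 (xs s) s) in R.
    assert (Erho : forall y, 0 <= y -> rho gam c0 (sqrt y) = rs y).
    { intros y Hy. change (rs (sqrt y ^ 2) = rs y). now rewrite pow2_sqrt. }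
    rewrite !Erho in R by (apply Rplus_le_le_0_compat; apply pow2_ge_0).
    replace (um (xs s) ^ 2 + (0 / n (xs s)) ^ 2) with (um (xs s) ^ 2) in R by (field; lra).
    set (r := rs (um (xs s) ^ 2)) in *.
    set (r' := rs (Gp1 (xs s) s ^ 2 + bq n Gp2 (xs s) s ^ 2)) in *.
    assert (HS : 0 < sqrt (1 + k ^ 2)) by (apply sqrt_lt_R0; pose proof (pow2_ge_0 k); lra).
    assert (R' : (r * um (xs s) - r' * Gp1 (xs s) s) - k * (r * 0 - r' * bq n Gp2 (xs s) s) = 0).
    { replace (0 / n (xs s)) with 0 in R by (field; lra).
      apply Rmult_eq_reg_r with (/ sqrt (1 + k ^ 2)).
      - rewrite Rmult_0_l. etransitivity; [| exact R]. field. lra.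
      - apply Rinv_neq_0_compat. lra. }
    lra. }
assert (Hsuper : forall x s, cls z xs x s -> Gm1 x s = um x /\ Gm2 x s = 0).
{ apply (supersonic_rigidity n Dn Kn' Hnpos um Kum Hum Dum xs Dxs Kxs' Hxs Pxs
    Gm1 Gm2 _ _ _ Cm1 Cm2 Km1 Km2 Pm1 (G2_periodic z xs Kz Kxs Hz phi Gm1 Gm2 C2m Lm1 Lm2 Pz Pxs Pphi)
    Vm A1 A2 A3 A4 HA1 HA2 HA).
  - intros s. rewrite (proj1 (Hin s)). now symmetry.
  - intros s. apply Hin.
  - intros s Q1 Q2. destruct (Hjump s Q1 Q2) as [J1 J2]. destruct (Hum (xs s)) as [U1 U2].
    apply (normal_supersonic) with (4 := J1) (5 := J2); try assumption.
    assert (V := Vp _ _ (Sxs_p s)). unfold sqp in V. lra. }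
assert (Eexit : forall s, cls xs o 1 s) by (intros s; unfold cls, o; destruct (Hxs s); lra).
assert (Hexit : forall s, sqp n Gp1 Gp2 1 s = c1 ^ 2).
{ intros s. assert (Hn := np _ _ (Eexit s)). unfold sqp, bq. rewrite <- speed_sq by lra. now rewrite Hout. }
(* The boundary assumption bounds any limit of the difference quotients of [phi]. The mean value
   theorem writes each quotient as a nearby value of [Gp1], so the limit exists and is the trace. *)
assert (Hexit0 : forall s, 0 <= Gp1 1 s).
{ intros s. apply (proj2 (Hnn s)). apply flim_eps. intros eps He.
  destruct (cont_cls_eps xs o Gp1 Kp1 1 s (Eexit s) eps He) as [d [Hd HG]].
  assert (Hd' : 0 < Rmin d (1 - xs s)) by (apply Rmin_glb_lt; destruct (Hxs s); lra).
  exists (mkposreal _ Hd'). intros t Ht Ht1. change (Rabs (t - 1) < Rmin d (1 - xs s)) in Ht.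
  assert (T1 := Rlt_le_trans _ _ _ Ht (Rmin_l _ _)).
  assert (T2 := Rlt_le_trans _ _ _ Ht (Rmin_r _ _)). apply Rabs_def2 in T1, T2.
  destruct (mean_value_lipschitz (fun t => phi t s) (fun t => Gp1 t s) L t 1) as [c [Hc E]].
  - now apply Lsec.
  - destruct (Hxs s). lra.
  - lra.
  - intros y Hy. destruct (Cp y s) as [D _]; [unfold opn, o; lra | exact D].
  - replace ((phi t s - phi 1 s) / (t - 1)) with (Gp1 c s).
    + apply HG; [unfold cls, o; lra | apply Rabs_def1; lra | now rewrite Rminus_diag, Rabs_R0].
    + replace (phi t s - phi 1 s) with (- (phi 1 s - phi t s)) by ring.
      simpl in E. rewrite E. field. lra. }
set (U := fun x => RInt up 0 x).
assert (DU : forall x, is_derive U x (up x)).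
{ intros x. now apply is_derive_RInt0. }
destruct (subsonic_rigidity n Dn Hnpos up U m Kup DU Hup Mp xs Dxs Kxs' Hxs Pxs
  phi Gp1 Gp2 Cp Kphip Kp1 Kp2 Pphi (G1_periodic xs o Ho phi Gp1 C2p Lp1 Pxs Po Pphi)
  (G2_periodic xs o Kxs Ko Ho phi Gp1 Gp2 C2p Lp1 Lp2 Pxs Po Pphi)
  Vp B1 B2 B3 B4 HB1 HB2 HB) with (c1 := c1) as [Ec Hsub]; try assumption.
{ intros s. destruct (Hsuper _ _ (Sxs_m s)) as [Q1 Q2]. destruct (Hjump s Q1 Q2) as [_ J2].
  assert (Hn := nm _ _ (Sxs_m s)). rewrite <- (Mm (xs s)) by (destruct (Hxs s); lra).
  rewrite J2. unfold mass1, mass2.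
  replace (Gp1 (xs s) s ^ 2 + bq n Gp2 (xs s) s ^ 2) with (sqp n Gp1 Gp2 (xs s) s)
    by (unfold sqp; ring).
  field. lra. }
split; [exact Ec |].
(* With axial flow on both sides the tangential condition reads [(um - up) * xs' = 0], and the two
   branches never meet. *)
assert (xs'0 : forall s, Derive xs s = 0).
{ intros s. assert (T := Htan s).
  destruct (Hsuper _ _ (Sxs_m s)) as [Q1 Q2]. destruct (Hsub _ _ (Sxs_p s)) as [Q3 Q4].
  rewrite Q1, Q2, Q3, Q4 in T. destruct (Hum (xs s)) as [U1 U2]. destruct (Hup (xs s)) as [V1 V2].
  assert (Hgt : up (xs s) < um (xs s)) by (clear - U1 U2 V1 V2; nra).
  assert (P : (um (xs s) - up (xs s)) * Derive xs s = 0) by lra.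
  apply Rmult_integral in P. destruct P; lra. }
assert (Hconst : forall s, xs s = xs 0).
{ intros s. destruct (MVT_gen xs 0 s (fun _ => 0)) as [c [_ E]].
  - intros y _. rewrite <- (xs'0 y). apply Dxs.
  - intros y _. apply continuity_pt_filterlim, Kxs.
  - lra. }
set (xb := xs 0) in *. assert (Hxb : 0 < xb < 1) by apply Hxs.
exists xb. split; [exact Hxb | split; [exact Hconst |]].
set (f := axial_potential um up xb).
exists (phi xb 0 - f xb).
assert (Hs0 : forall s, phi xb s = phi xb 0).
{ intros s. destruct (MVT_gen (fun s => phi (xs s) s) 0 s (fun _ => 0)) as [c [_ E]].
  - intros y _. evar_last; [apply Htr |]. rewrite xs'0, (proj2 (Hsuper _ _ (Sxs_m y))). change (Gm1 (xs y) y * 0 + 0 = 0); ring.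
  - intros y _. apply continuity_pt_filterlim. exact (continuous_of_is_derive _ _ _ (Htr y)).
  - cbv beta in E. rewrite Hconst in E. fold xb in E. lra. }
intros x s Hx.
set (g := fun x => phi x s - f x).
set (L' := L + qmax gam c0).
assert (Lg : forall x y, 0 <= x <= 1 -> 0 <= y <= 1 -> Rabs (g x - g y) <= L' * Rabs (x - y)).
{ intros y t Hy Ht. unfold g, L'. assert (Q1 := Lsec s y t Hy Ht).
  assert (Q2 := axial_lipschitz um up Hum Hup Kum Kup xb y t). fold f in Q2.
  replace (phi y s - f y - (phi t s - f t)) with ((phi y s - phi t s) + - (f y - f t)) by ring.
  eapply Rle_trans; [apply Rabs_triang |]. rewrite Rabs_Ropp. lra. }
assert (Hd : g x = g xb).
{ destruct (Rtotal_order x xb) as [H | [-> | H]]; [| reflexivity |].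
  - destruct (mean_value_lipschitz g (fun _ => 0) L' x xb Lg) as [c [_ E]]; try lra.
    intros y Hy. assert (Hyo : opn z xs y s) by (unfold opn, z; rewrite Hconst; fold xb; lra).
    destruct (Cm y s Hyo) as [D _]. rewrite (proj1 (Hsuper y s (opn_cls _ _ _ _ Hyo))) in D.
    assert (D2 := axial_derive_left um up Kum xb y (proj2 Hy)).
    evar_last; [exact (is_derive_minus _ _ _ _ _ D D2) |]. apply Rminus_diag.
  - destruct (mean_value_lipschitz g (fun _ => 0) L' xb x Lg) as [c [_ E]]; try lra.
    intros y Hy. assert (Hyo : opn xs o y s) by (unfold opn, o; rewrite Hconst; fold xb; lra).
    destruct (Cp y s Hyo) as [D _]. rewrite (proj1 (Hsub y s (opn_cls _ _ _ _ Hyo))) in D.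
    assert (D2 := axial_derive_right um up Kup xb y (proj1 Hy)).
    evar_last; [exact (is_derive_minus _ _ _ _ _ D D2) |]. apply Rminus_diag. }
unfold g in Hd. rewrite Hs0 in Hd. lra.
Qed.

End Uniqueness.

End Gas.

(** * Identification of the branches with the data, and conclusion *)

Theorem theorem3p1 (gam c0 u0 u1 c1 : R) (n : R -> R)
  (Hgam : 1 < gam) (Hc0 : 0 < c0)
  (Hu0 : cstar gam c0 < u0 < qmax gam c0)
  (* n positive and smooth on [0,1] *)
  (Hnsmooth : forall k x, ex_derive_n n k x)
  (Hnpos : forall x, 0 <= x <= 1 -> 0 < n x)
  (* standing assumption: rho(u0) u0 n(0) < rho(c_* ) c_* min_[0,1] n *)
  (Hstand : forall x, 0 <= x <= 1 ->
     rho gam c0 u0 * u0 * n 0 < rho gam c0 (cstar gam c0) * cstar gam c0 * n x)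
  (* u1 : the number in (0,c_* ) with rho(u1) u1 n(1) = rho(u0) u0 n(0) *)
  (Hu1 : 0 < u1 < cstar gam c0)
  (Hu1eq : rho gam c0 u1 * u1 * n 1 = rho gam c0 u0 * u0 * n 0)
  (Hc1 : 0 < c1 < cstar gam c0) :
  ((exists phi xs, transonic_shock_solution gam c0 u0 c1 n phi xs /\
                   d1_nonneg_on_boundary phi) <-> c1 = u1) /\
  (forall phi xs, transonic_shock_solution gam c0 u0 c1 n phi xs ->
     d1_nonneg_on_boundary phi ->
     exists xb, 0 < xb < 1 /\ (forall x2, xs x2 = xb) /\
       exists phib C, is_phi_b gam c0 u0 n xb phib /\
         forall x1 x2, 0 <= x1 <= 1 -> phi x1 x2 = phib x1 + C) /\
  (c1 = u1 -> forall xb, 0 < xb < 1 ->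
     exists phib, is_phi_b gam c0 u0 n xb phib /\
       transonic_shock_solution gam c0 u0 c1 n (fun x1 _ => phib x1) (fun _ => xb) /\
       d1_nonneg_on_boundary (fun x1 _ => phib x1)).
Proof.
assert (Dn : forall x, is_derive n x (Derive n x)).
{ intros x. apply Derive_correct. exact (Hnsmooth 1%nat x). }
assert (Kn' : forall x, continuous (Derive n) x).
{ intros x. apply (ex_derive_continuous (V := R_NormedModule)). exact (Hnsmooth 2%nat x). }
set (m := rho gam c0 u0 * u0 * n 0).
assert (Hcs := cstar_pos gam c0 Hgam Hc0).
assert (n0 : 0 < n 0) by (apply Hnpos; lra). assert (n1 : 0 < n 1) by (apply Hnpos; lra).
assert (Hm0 : 0 < m).
{ unfold m. apply Rmult_lt_0_compat; [| exact n0].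
  apply Rmult_lt_0_compat; [apply (rs_pos gam c0 (u0 ^ 2)) | lra]. }
destruct (supersonic_branch gam c0 Hgam Hc0 n Dn Hnpos m Hm0 Hstand) as (um & Hum & Mm & Kum & Dum).
destruct (subsonic_branch gam c0 Hgam Hc0 n Dn Hnpos m Hm0 Hstand) as (up & Hup & Mp & Kup & Dup).
(* The branch is known only through its mass flux; strict monotonicity of the flux beyond [cstar]
   identifies its inlet value. The exit value of [up] is found in the same way below [cstar]. *)
assert (Eu0 : um 0 = u0).
{ destruct (Hum 0) as [H1 H2]. assert (H3 := Mm 0 ltac:(lra)).
  assert (E : rs gam c0 (um 0 ^ 2) * um 0 = rs gam c0 (u0 ^ 2) * u0).
  { apply Rmult_eq_reg_l with (n 0); [| lra]. rewrite H3. unfold m.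
    change (rho gam c0 u0) with (rs gam c0 (u0 ^ 2)). ring. }
  assert (S1 : sstar gam c0 <= u0 ^ 2) by (rewrite <- (cstar_sq gam c0 Hgam Hc0); nra).
  assert (S2 : u0 ^ 2 < smax gam c0) by (rewrite <- (qmax_sq gam c0 Hgam Hc0); nra).
  destruct (Rtotal_order (um 0) u0) as [H | [H | H]]; [| exact H |].
  - assert (Q := flux_decr gam c0 Hgam (um 0) u0 ltac:(lra) ltac:(lra) S2). lra.
  - assert (Q := flux_decr gam c0 Hgam u0 (um 0) ltac:(lra) S1 ltac:(lra)). lra. }
assert (Eu1 : up 1 = u1).
{ destruct (Hup 1) as [H1 H2]. assert (H3 := Mp 1 ltac:(lra)).
  assert (E : rs gam c0 (up 1 ^ 2) * up 1 = rs gam c0 (u1 ^ 2) * u1).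
  { apply Rmult_eq_reg_l with (n 1); [| lra]. rewrite H3. unfold m. rewrite <- Hu1eq.
    change (rho gam c0 u1) with (rs gam c0 (u1 ^ 2)). ring. }
  assert (S1 : u1 ^ 2 <= sstar gam c0) by (rewrite <- (cstar_sq gam c0 Hgam Hc0); nra).
  destruct (Rtotal_order (up 1) u1) as [H | [H | H]]; [| exact H |].
  - assert (Q := flux_incr gam c0 Hgam Hc0 (up 1) u1 ltac:(lra) S1). lra.
  - assert (Q := flux_incr gam c0 Hgam Hc0 u1 (up 1) ltac:(lra) ltac:(lra)). lra. }
assert (Exist : c1 = u1 -> forall xb, 0 < xb < 1 ->
     exists phib, is_phi_b gam c0 u0 n xb phib /\
       transonic_shock_solution gam c0 u0 c1 n (fun x1 _ => phib x1) (fun _ => xb) /\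
       d1_nonneg_on_boundary (fun x1 _ => phib x1)).
{ intros Ec xb Hxb. exists (axial_potential um up xb). split; [| split].
  - now apply axial_is_phi_b with m.
  - apply axial_transonic with m; try assumption. congruence.
  - now apply (axial_d1_nonneg gam c0). }
assert (Rigid := transonic_rigidity gam c0 Hgam Hc0 u0 c1 n Dn Kn' Hnpos um up m
  Hum Hup Mm Mp Kum Kup Dum Eu0 (proj1 Hc1)).
split; [split | split; [| exact Exist]].
- intros (phi & xs & Hsol & Hnn). destruct (Rigid phi xs Hsol Hnn) as [Ec _]. congruence.
(* Any shock position in (0, 1) would do. *)
- intros Ec. destruct (Exist Ec (1 / 2) ltac:(lra)) as (phib & _ & H1 & H2).
  now exists (fun x _ => phib x), (fun _ => 1 / 2).
- intros phi xs Hsol Hnn. destruct (Rigid phi xs Hsol Hnn) as (_ & xb & Hxb & Hxs & C & HC).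
  exists xb. split; [exact Hxb | split; [exact Hxs |]].
  exists (axial_potential um up xb), C. split; [now apply axial_is_phi_b with m | exact HC].
Qed.
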